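(* Let $\mathbb{F}$ be a perfect field of characteristic $p\geq 7$. Let $R:=\mathbb{F}[x,y,z]/(x^2+y^3-z^p)$, graded by $\deg x=3p$, $\deg y=2p$, $\deg z=6$. Then $R$ is sandwiched between $A:=\mathbb{F}[x,y]$ and $A^{1/p}=\mathbb{F}[x^{1/p},y^{1/p}]$, via $z=x^{2/p}+y^{3/p}$, and $R$ has finite Frobenius representation type (FFRT). Let $S:=\mathbb{F}[u,v]$, where $u$ and $v$ are indeterminates of degree $1$. Then the Segre product $R\,\#\,S$ has FFRT. However, $a(R)=p-6>0$, and $R\,\#\,S$ is not Cohen-Macaulay.
   Context: All rings are commutative and Noetherian. Segre product: for $\mathbb{N}$-graded rings $R=\bigoplus_{n\geq 0}R_n$ and $S=\bigoplus_{n\geq 0}S_n$, finitely generated over a field $R_0=\mathbb{F}=S_0$, the Segre product is the $\mathbb{N}$-graded ring $R\,\#\,S:=\bigoplus_{n\geq 0}R_n\otimes_{\mathbb{F}}S_n$, a subring of $R\otimes_{\mathbb{F}}S$. FFRT: a reduced ring $B$ of prime characteristic $p>0$, satisfying the Krull-Schmidt theorem, is said to have finite Frobenius representation type (FFRT) if there exists a finite set $\mathcal{S}$ of $B$-modules such that for each $q=p^e$, each indecomposable summand of $B^{1/q}$ is isomorphic to an element of $\mathcal{S}$. Here $B^{1/q}$ is the ring of $q$-th roots of elements of $B$, viewed as a $B$-module via $B\subseteq B^{1/q}$. The Krull-Schmidt theorem holds for $\mathbb{N}$-graded rings $B$ with $B_0$ a field. The $a$-invariant $a(R)$ is the largest integer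 $n$ such that the degree $n$ component of the local cohomology module $H^{\dim R}_{\mathfrak{m}_R}(R)$ is nonzero, where $\mathfrak{m}_R$ is the homogeneous maximal ideal of $R$. *)

(* Defs.v *)
From HB Require Import structures.
From mathcomp Require Import all_boot all_order all_algebra.
From mathcomp Require ssrcomplements.
From mathcomp Require Import boolp classical_sets mpoly.

Set Implicit Arguments.
Unset Strict Implicit.
Unset Printing Implicit Defensive.

Import GRing.Theory Num.Theory.
Local Open Scope ring_scope.
Local Open Scope classical_set_scope.
Local Open Scope quotient_scope.

Definition perfect_field (p : nat) (F : fieldType) : Prop :=
  forall a : F, exists b : F, b ^+ p = a.

Section Ideals.
Variable B : comNzRingType.
Implicit Types (I Q : set B) (s : seq B).

Definition reduced : Prop := forall (b : B) (n : nat), b ^+ n = 0 -> b = 0.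

Definition is_ideal I : Prop :=
  [/\ I 0, forall a b, I a -> I b -> I (a + b) & forall c a, I a -> I (c * a)].

Definition is_prime_ideal (P : set B) : Prop :=
  [/\ is_ideal P, ~ P 1 & forall a b, P (a * b) -> P a \/ P b].

Definition is_maximal_ideal (P : set B) : Prop :=
  [/\ is_ideal P, ~ P 1 & forall I, is_ideal I -> P `<` I -> I 1].

Definition ideal_gen s : set B :=
  [set b | exists c : nat -> B, b = \sum_(i < size s) c i * s`_i].

Definition prime_chain (d : nat) (P : nat -> set B) : Prop :=
  (forall i, (i <= d)%N -> is_prime_ideal (P i)) /\
  (forall i, (i < d)%N -> P i `<` P i.+1).

Definition is_krull_dim (d : nat) : Prop :=
  (exists P, prime_chain d P) /\
  (forall n P, prime_chain n P -> (n <= d)%N).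

Definition is_codim Q (d : nat) : Prop :=
  (exists P, prime_chain d P /\ P d `<=` Q) /\
  (forall n P, prime_chain n P -> P n `<=` Q -> (n <= d)%N).

Definition regular_sequence s : Prop :=
  (forall i, (i < size s)%N -> forall b,
     ideal_gen (take i s) (s`_i * b) -> ideal_gen (take i s) b)
  /\ ~ ideal_gen s 1.

Definition is_depth I (d : nat) : Prop :=
  (exists s, [/\ size s = d, (forall b, b \in s -> I b) & regular_sequence s]) /\
  (forall s, (forall b, b \in s -> I b) -> regular_sequence s ->
     (size s <= d)%N).

(* For a maximal ideal Q of a Noetherian ring B, the length of a longest regular
   sequence in Q is the depth of the local ring B_Q, and the codimension (height)
   of Q is the dimension of B_Q. *)
Definition cohen_macaulay : Prop :=
  forall Q, is_maximal_ideal Q -> exists d, is_codim Q d /\ is_depth Q d.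

End Ideals.
Arguments reduced : clear implicits.
Arguments is_krull_dim : clear implicits.
Arguments cohen_macaulay : clear implicits.

Record grading (F : fieldType) (B : comAlgType F) := Grading {
  piece :> nat -> set B;
  piece0 : forall d, piece d 0;
  pieceP : forall d (c : F) a b,
    piece d a -> piece d b -> piece d (c *: a + b);
  piece1 : piece 0 1;
  pieceM : forall d e a b, piece d a -> piece e b -> piece (d + e) (a * b);
  piece_sum : forall b, exists n (h : nat -> B),
    (forall d, piece d (h d)) /\ b = \sum_(d < n) h d;
  piece_free : forall n (h : nat -> B),
    (forall d, piece d (h d)) -> \sum_(d < n) h d = 0 ->
    forall d, (d < n)%N -> h d = 0
}.

Section Graded.
Variables (F : fieldType) (B : comAlgType F) (G : grading B).

Definition connected : Prop := forall b, G 0 b -> exists c : F, b = c%:A.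

(* The ideal of elements with zero component of degree 0; it is the homogeneous
   maximal ideal when G is connected. *)
Definition irrelevant_ideal : set B :=
  [set b | exists n (h : nat -> B),
     [/\ forall d, G d (h d), h 0%N = 0 & b = \sum_(d < n) h d]].

Definition zpiece (n : int) : set B :=
  [set b | b = 0 \/ exists d : nat, n = d%:Z /\ G d b].

End Graded.

(* Local cohomology with support in the ideal generated by the sequence f, as
   the cohomology of the Cech complex with terms
     C^i = \prod_(#|J| = i) B_{f_J},  where f_J = \prod_(j in J) f_j.
   A finite family of fractions has a common exponent, so a cochain is given by
   t and numerators a, standing for the family (a_J / f_J^t)_J. *)
Section Cech.
Variables (B : comNzRingType) (f : seq B).
Local Notation idx := {set 'I_(size f)}.

Definition cech_den (J : idx) : B := \prod_(j in J) f`_j.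

(* a / f_J^t = b / f_J^u in the localization B_{f_J} *)
Definition eq_frac (J : idx) (a : B) (t : nat) (b : B) (u : nat) : Prop :=
  exists k, cech_den J ^+ k * (cech_den J ^+ u * a - cech_den J ^+ t * b) = 0.

(* Numerator over f_J^t of the J-component of the differential of the cochain
   (a_K / f_K^t)_K: the fraction a_{J \ j} / f_{J \ j}^t becomes
   f_j^t a_{J \ j} / f_J^t. *)
Definition cech_diff (t : nat) (a : idx -> B) (J : idx) : B :=
  \sum_(j in J) (-1) ^+ #|[set k in J | (k < j)%N]|
                * (f`_j ^+ t * a (J :\ j)%SET).

Definition cech_cocycle (i t : nat) (a : idx -> B) : Prop :=
  forall J : idx, #|J| = i.+1 -> eq_frac J (cech_diff t a J) t 0 0.

Definition cech_coboundary (i t : nat) (a : idx -> B) : Prop :=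
  exists (u : nat) (b : idx -> B), forall J : idx, #|J| = i ->
    eq_frac J (a J) t (cech_diff u b J) u.

End Cech.

Section AInvariant.
Variables (F : fieldType) (B : comAlgType F) (G : grading B).

(* The degree n component of H^i_(f)(B) is nonzero; the j-th term of f is
   homogeneous of degree D j. *)
Definition local_cohomology_neq0 (f : seq B) (D : nat -> nat)
    (i : nat) (n : int) : Prop :=
  exists (t : nat) (a : {set 'I_(size f)} -> B),
    [/\ forall J : {set 'I_(size f)}, #|J| = i ->
          zpiece G (n + (t * \sum_(j in J) D j)%:Z) (a J),
        cech_cocycle i t a
      & ~ cech_coboundary i t a].

(* Up to isomorphism the graded modules H^i_(f)(B) do not depend on the choice
   of homogeneous generators f of the homogeneous maximal ideal, hence the
   existential. *)
Definition is_a_invariant (n : int) : Prop :=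
  exists (d : nat) (f : seq B) (D : nat -> nat),
    [/\ is_krull_dim B d,
        (forall j, (j < size f)%N -> G (D j) f`_j),
        ideal_gen f = irrelevant_ideal G,
        local_cohomology_neq0 f D d n
      & forall m : int, (n < m)%R -> ~ local_cohomology_neq0 f D d m].

End AInvariant.

(* iota : B -> C exhibits C as the ring B^{1/q} of q-th roots of elements
   of B. *)
Definition is_root_ring (q : nat) (B C : comNzRingType) (iota : B -> C) : Prop :=
  [/\ injective iota,
      (forall c, exists b, iota b = c ^+ q)
    & (forall b, exists! c, c ^+ q = iota b)].

Lemma root_ring_exists (B : comNzRingType) (p e : nat) :
  p \in [pchar B] -> reduced B ->
  exists (C : comNzRingType) (iota : {rmorphism B -> C}),
    is_root_ring (p ^ e) iota.
Proof.
move=> pB redB; have p_nat : [pchar B].-nat (p ^ e)%N.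
  by rewrite pnatX (pnatE _ (pcharf_prime pB)) pB.
pose phi (b : B) := b ^+ (p ^ e).
have phiB : zmod_morphism phi.
  move=> a b; apply/eqP; rewrite eq_sym subr_eq; apply/eqP.
  by rewrite /phi -exprDn_pchar // subrK.
have phiM : monoid_morphism phi.
  by split; [exact: expr1n | move=> a b; exact: exprMn].
pose phiA := GRing.isZmodMorphism.Build B B phi phiB.
pose phiR := GRing.isMonoidMorphism.Build B B phi phiM.
pose iota : {rmorphism B -> B} := HB.pack phi phiA phiR.
have iotaI : injective phi.
  move=> a b eq_ab; apply/eqP; rewrite -subr_eq0; apply/eqP.
  by apply: (redB _ (p ^ e)%N); rewrite -/(phi _) phiB eq_ab subrr.
exists B, iota; split=> [|c|b]; first exact: iotaI.
  by exists c.
by exists b; split=> // c /iotaI.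
Qed.

(* FFRT is considered for rings over which graded modules satisfy the
   Krull-Schmidt theorem, so B^{1/q} is taken as a graded B-module: an element
   of B^{1/q} has degree d / q when its q-th power has degree d in B. *)
Section FFRT.
Variables (F : fieldType) (B : comAlgType F) (G : grading B).

(* C is meant to be B^{1/q}, a B-module through iota : B -> C; the module
   isomorphisms below need not respect degrees. *)
Section RootModules.
Variables (q : nat) (C : comNzRingType) (iota : {rmorphism B -> C}).
Implicit Type N : set C.

Definition root_piece (d : nat) : set C :=
  [set c | exists2 b, G d b & iota b = c ^+ q].

Definition is_graded_submodule N : Prop :=
  [/\ N 0, forall c c', N c -> N c' -> N (c + c'),
      forall b c, N c -> N (iota b * c)
    & forall c, N c -> exists n (h : nat -> C),
        [/\ forall d, root_piece d (h d), forall d, N (h d)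
          & c = \sum_(d < n) h d]].

Definition is_direct_sum N N1 N2 : Prop :=
  [/\ is_graded_submodule N1, is_graded_submodule N2,
      forall c, N1 c -> N2 c -> c = 0
    & forall c, N c <-> exists c1 c2, [/\ N1 c1, N2 c2 & c = c1 + c2]].

Definition is_summand N : Prop := exists N', is_direct_sum setT N N'.

Definition is_zero_module N : Prop := forall c, N c -> c = 0.

Definition is_indecomposable N : Prop :=
  [/\ is_graded_submodule N, ~ is_zero_module N
    & forall N1 N2, is_direct_sum N N1 N2 ->
        is_zero_module N1 \/ is_zero_module N2].

Definition is_module_iso (M : lmodType B) N : Prop :=
  exists h : {linear M -> C | iota \; *%R},
    injective h /\ (forall c, N c <-> exists m, h m = c).

End RootModules.

Definition FFRT (p : nat) : Prop :=
  [/\ p \in [pchar B], connected G, reduced B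
    & exists (n : nat) (M : 'I_n -> lmodType B),
        forall (e : nat) (C : comNzRingType) (iota : {rmorphism B -> C}),
          is_root_ring (p ^ e) iota ->
          forall N : set C,
            is_summand (p ^ e) iota N -> is_indecomposable (p ^ e) iota N ->
            exists i, is_module_iso iota (M i) N].

End FFRT.

Definition is_bilinear (F : fieldType) (U V W : lmodType F)
    (b : U -> V -> W) : Prop :=
  (forall u, linear (b u)) /\ (forall v, linear (b^~ v)).

Record tensor_product (F : fieldType) (R S : comAlgType F) := TensorProduct {
  tensor_ring :> comAlgType F;
  tinl : {lrmorphism R -> tensor_ring};
  tinr : {lrmorphism S -> tensor_ring};
  tensor_lift : forall (W : lmodType F) (b : R -> S -> W), is_bilinear b ->
    exists g : {linear tensor_ring -> W},
      forall r s, g (tinl r * tinr s) = b r s;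
  tensor_uniq : forall (W : lmodType F) (g h : {linear tensor_ring -> W}),
    (forall r s, g (tinl r * tinr s) = h (tinl r * tinr s)) -> g =1 h
}.

Section GradingTheory.
Variables (F : fieldType) (B : comAlgType F) (G : grading B).

Lemma pieceD d a b : G d a -> G d b -> G d (a + b).
Proof. by move=> Ga Gb; rewrite -(scale1r a); exact: pieceP. Qed.

Lemma pieceZ d c a : G d a -> G d (c *: a).
Proof. by move=> Ga; rewrite -[_ *: _]addr0; apply/pieceP/piece0. Qed.

Lemma pieceB d a b : G d a -> G d b -> G d (a - b).
Proof. by move=> Ga Gb; rewrite -scaleN1r; exact/pieceD/pieceZ. Qed.

Lemma piece_sum_closed d (I : Type) (s : seq I) (h : I -> B) :
  (forall i, G d (h i)) -> G d (\sum_(i <- s) h i).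
Proof. by move=> Gh; elim/big_rec: _ => *; [exact: piece0|exact: pieceD]. Qed.

Lemma piece_sum_widen b : exists n0, forall n, (n0 <= n)%N ->
  exists h : nat -> B, (forall d, G d (h d)) /\ b = \sum_(d < n) h d.
Proof.
have [n0 [h [Gh ->]]] := piece_sum G b; exists n0 => n le_n.
exists (fun d => if (d < n0)%N then h d else 0); split=> [d|].
  by case: ifP => _ //; exact: piece0.
by rewrite -big_mkcond (big_ord_widen n h le_n).
Qed.

Lemma gproj_exists d : exists pr : {linear B -> B},
  forall e a, G e a -> pr a = if e == d then a else 0.
Proof.
have ex (b : B) : exists x, exists n (h : nat -> B),
    [/\ forall i, G i (h i), b = \sum_(i < n) h i & x = if (d < n)%N then h d else 0].
  by have [n [h [Gh bE]]] := piece_sum G b; eexists; exists n, h; split.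
pose pr b := projT1 (cid (ex b)).
have prE n (h : nat -> B) : (forall i, G i (h i)) ->
    pr (\sum_(i < n) h i) = if (d < n)%N then h d else 0.
  move=> Gh; rewrite /pr; case: cid => x /= [m [k [Gk eq_hk ->]]].
  pose cut n (h : nat -> B) i := if (i < n)%N then h i else 0.
  have Gcut n' h' i : (forall i, G i (h' i)) -> G i (cut n' h' i).
    by rewrite /cut; case: ifP => // *; exact: piece0.
  have sum_cut n' h' N : (n' <= N)%N ->
      \sum_(i < N) cut n' h' i = \sum_(i < n') h' i.
    by move=> le_N; rewrite -big_mkcond (big_ord_widen N h' le_N).
  pose N := maxn d.+1 (maxn n m).
  have := @piece_free _ _ G N (fun i => cut m k i - cut n h i).
  move=> /(_ (fun i => pieceB (Gcut m k i Gk) (Gcut n h i Gh))).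
  rewrite sumrB !sum_cut ?/N; try by rewrite !leq_max leqnn ?orbT.
  by rewrite eq_hk subrr => /(_ erefl d); rewrite leq_max leqnn => /(_ isT)/subr0_eq.
have pr_lin : linear pr.
  move=> c a b.
  have [na Na] := piece_sum_widen a; have [nb Nb] := piece_sum_widen b.
  have [h [Gh ->]] := Na (maxn d.+1 (maxn na nb)) ltac:(by rewrite !leq_max leqnn !orbT).
  have [k [Gk ->]] := Nb (maxn d.+1 (maxn na nb)) ltac:(by rewrite !leq_max leqnn !orbT).
  rewrite scaler_sumr -big_split /= (prE _ (fun i => c *: h i + k i)) ?prE //.
    by rewrite leq_max leqnn.
  by move=> i; exact: pieceP.
pose prL := GRing.isLinear.Build F B B _ pr pr_lin.
exists (HB.pack pr prL : {linear B -> B}) => e a Ga /=.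
pose h i := if i == e then a else 0.
have Gh i : G i (h i) by rewrite /h; case: eqP => [->|_] //; exact: piece0.
have := prE e.+1 h Gh; rewrite big_ord_recr /= big1 => [|i _]; last first.
  by rewrite /h ltn_eqF.
rewrite add0r {1}/h eqxx => ->; rewrite ltnS /h (eq_sym d).
by case: eqP => [->|]; rewrite ?leqnn // if_same.
Qed.

End GradingTheory.

Section Segre.
Variables (F : fieldType) (R S : comAlgType F).
Variables (GR : grading R) (GS : grading S) (T : tensor_product R S).

(* The image of R_n \otimes S_n in R \otimes S. *)
Definition segre_piece (n : nat) : set T :=
  [set x | exists s : seq (R * S),
     (forall rs, rs \in s -> GR n rs.1 /\ GS n rs.2) /\
     x = \sum_(rs <- s) tinl T rs.1 * tinr T rs.2].

Definition segre_pred : {pred T} := fun x =>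
  `[< exists n (h : nat -> T),
        (forall d, segre_piece d (h d)) /\ x = \sum_(d < n) h d >].

Record segre := Segre { segre_val : T; _ : segre_val \in segre_pred }.

HB.instance Definition _ := [isSub for segre_val].
HB.instance Definition _ := [Choice of segre by <:].

Lemma segre_piece0 d : segre_piece d 0.
Proof. by exists [::]; split=> //; rewrite big_nil. Qed.

Lemma segre_pieceP d (c : F) x y :
  segre_piece d x -> segre_piece d y -> segre_piece d (c *: x + y).
Proof.
move=> [s [Gs ->]] [t [Gt ->]].
exists ([seq (c *: rs.1, rs.2) | rs <- s] ++ t); split=> [rs|].
  rewrite mem_cat => /orP[/mapP[rs' /Gs[Gr Gs'] ->]|/Gt //].
  by split=> //=; exact: pieceZ.
rewrite big_cat big_map scaler_sumr; congr (_ + _).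
by apply: eq_bigr => rs _ /=; rewrite linearZ /= scalerAl.
Qed.

Lemma segre_pieceM d e x y :
  segre_piece d x -> segre_piece e y -> segre_piece (d + e) (x * y).
Proof.
move=> [s [Gs ->]] [t [Gt ->]].
exists [seq (rs.1 * rs'.1, rs.2 * rs'.2) | rs <- s, rs' <- t]; split=> [rs|].
  case/allpairsP=> [[a b] /= [/Gs[? ?] /Gt[? ?] ->]].
  by split; exact: pieceM.
rewrite big_allpairs_dep mulr_suml; apply: eq_bigr => a _.
by rewrite mulr_sumr; apply: eq_bigr => b _ /=; rewrite !rmorphM mulrACA.
Qed.

Lemma segre_piece1 : segre_piece 0 1.
Proof.
exists [:: (1, 1)]; split=> [rs|]; last by rewrite big_seq1 !rmorph1 mulr1.
by rewrite inE => /eqP ->; split; exact: piece1.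
Qed.

Lemma segre_pieceW d x : segre_piece d x -> x \in segre_pred.
Proof.
move=> Gx; apply/asboolP; exists d.+1, (fun i => if i == d then x else 0).
split=> [i|]; first by case: eqP => [->|_] //; exact: segre_piece0.
by rewrite big_ord_recr /= eqxx big1 ?add0r // => i _; rewrite ltn_eqF.
Qed.

Lemma segre_predP (c : F) x y :
  x \in segre_pred -> y \in segre_pred -> c *: x + y \in segre_pred.
Proof.
move=> /asboolP[n [h [Gh ->]]] /asboolP[m [k [Gk ->]]]; apply/asboolP.
exists (maxn n m), (fun d => c *: (if (d < n)%N then h d else 0) +
                            (if (d < m)%N then k d else 0)).
split=> [d|]; first by apply: segre_pieceP; case: ifP => _ //; exact: segre_piece0.
rewrite big_split -scaler_sumr -!big_mkcond /=.
by rewrite -!big_ord_widen ?leq_maxl ?leq_maxr.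
Qed.

Lemma segre_pred0 : 0 \in segre_pred.
Proof. exact: segre_pieceW (segre_piece0 0). Qed.

Lemma segre_pred_sum (I : Type) (s : seq I) (P : pred I) (h : I -> T) :
  (forall i, P i -> h i \in segre_pred) ->
  \sum_(i <- s | P i) h i \in segre_pred.
Proof.
move=> Ph; elim/big_rec: _ => [|i x Pi Px]; first exact: segre_pred0.
by rewrite -[h i]scale1r; apply: segre_predP => //; exact: Ph.
Qed.

Lemma segre_subalg : subalg_closed segre_pred.
Proof.
split=> [|c x y|]; [exact: segre_pieceW segre_piece1 | exact: segre_predP |].
move=> x y /asboolP[n [h [Gh ->]]] /asboolP[m [k [Gk ->]]].
rewrite mulr_suml; apply: segre_pred_sum => i _.
rewrite mulr_sumr; apply: segre_pred_sum => j _.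
exact: segre_pieceW (segre_pieceM (Gh i) (Gk j)).
Qed.

HB.instance Definition _ := GRing.isSubalgClosed.Build F T segre_pred
  segre_subalg.
HB.instance Definition _ := [SubChoice_isSubAlgebra of segre by <:].
HB.instance Definition _ := [SubNzRing_isSubComNzRing of segre by <:].

Definition segre_gpiece (d : nat) : set segre :=
  [set b | segre_piece d (segre_val b)].

Lemma segre_gpiece_sum b : exists n (h : nat -> segre),
  (forall d, segre_gpiece d (h d)) /\ b = \sum_(d < n) h d.
Proof.
have /asboolP[n [h [Gh bE]]] := valP b.
exists n, (fun d => Segre (segre_pieceW (Gh d))); split=> [d|]; first exact: Gh.
by apply: val_inj; rewrite raddf_sum.
Qed.

Lemma segre_gpiece_free n (h : nat -> segre) :
  (forall d, segre_gpiece d (h d)) -> \sum_(d < n) h d = 0 ->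
  forall d, (d < n)%N -> h d = 0.
Proof.
move=> Gh h0 d lt_d; have [pr prE] := gproj_exists GR d.
have pr_bil : is_bilinear (fun r s => tinl T (pr r) * tinr T s).
  split=> [r|s] c a b; first by rewrite linearP mulrDr scalerAr.
  by rewrite !linearP mulrDl scalerAl.
have [g gE] := tensor_lift T pr_bil.
have g_piece e x : segre_piece e x -> g x = if e == d then x else 0.
  move=> [s [Gs ->]]; rewrite linear_sum big_seq.
  rewrite (eq_bigr (fun rs => if e == d then tinl T rs.1 * tinr T rs.2 else 0)).
    by rewrite -big_seq; case: (e == d); rewrite // big1.
  by move=> rs /Gs[Gr _]; rewrite gE (prE _ _ Gr); case: ifP; rewrite ?raddf0 ?mul0r.
apply: val_inj; have := congr1 (fun b => g (val b)) h0.
rewrite !raddf_sum !raddf0 (bigD1 (Ordinal lt_d)) //= (g_piece _ _ (Gh d)) eqxx.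
rewrite big1 ?addr0 // => i ne_i; rewrite (g_piece _ _ (Gh i)) ifN //.
Qed.

Definition segre_grading : grading segre :=
  @Grading F segre segre_gpiece segre_piece0
    (fun d c a b => @segre_pieceP d c (segre_val a) (segre_val b))
    segre_piece1
    (fun d e a b => @segre_pieceM d e (segre_val a) (segre_val b))
    segre_gpiece_sum segre_gpiece_free.

End Segre.

Section MpolyGrading.
Variables (F : fieldType) (n : nat) (mf : measure n).

Definition mpoly_piece (d : nat) : set {mpoly F[n]} :=
  [set f | f \is d.-homog for mf].

Lemma mpoly_piece_sum f : exists k (h : nat -> {mpoly F[n]}),
  (forall d, mpoly_piece d (h d)) /\ f = \sum_(d < k) h d.
Proof.
exists (mmeasure mf f), (fun d => pihomog mf d f).
by split=> [d|]; [exact: pihomogP | exact: pihomog_partitionE].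
Qed.

Lemma mpoly_piece_free k (h : nat -> {mpoly F[n]}) :
  (forall d, mpoly_piece d (h d)) -> \sum_(d < k) h d = 0 ->
  forall d, (d < k)%N -> h d = 0.
Proof.
move=> Gh h0 d lt_d; have := congr1 (pihomog mf d) h0.
rewrite linear_sum linear0 (bigD1 (Ordinal lt_d)) //= (pihomog_dE (Gh d)).
rewrite big1 ?addr0 // => i ne_i; apply: pihomog_ne0 (Gh i).
by apply: contraNneq ne_i => eq_id; apply/eqP/val_inj.
Qed.

Lemma mpoly_pieceP d (c : F) f g :
  mpoly_piece d f -> mpoly_piece d g -> mpoly_piece d (c *: f + g).
Proof. by move=> Gf Gg; apply: rpredD => //; exact: rpredZ. Qed.

Definition mpoly_grading : grading {mpoly F[n]} :=
  @Grading F _ mpoly_piece (dhomog0 F mf) mpoly_pieceP (dhomog1 F mf)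
    (fun d e f g => @dhomogM n F mf d f e g) mpoly_piece_sum mpoly_piece_free.

End MpolyGrading.

(* R[X_1, ..., X_n] with its F-algebra structure is a model of the tensor
   product over F of R and F[X_1, ..., X_n]. *)
Section MpolyTensor.
Variables (F : fieldType) (R : comAlgType F) (n : nat).

Definition mpoly_ext : Type := {mpoly R[n]}.

HB.instance Definition _ := GRing.ComNzRing.on mpoly_ext.

Definition mpoly_ext_scale (c : F) (f : mpoly_ext) : mpoly_ext :=
  (c%:A : R) *: (f : {mpoly R[n]}).

Lemma mpoly_ext_scaleA c d f :
  mpoly_ext_scale c (mpoly_ext_scale d f) = mpoly_ext_scale (c * d) f.
Proof.
by rewrite /mpoly_ext_scale scalerA -scalerAl mul1r scalerA.
Qed.

Lemma mpoly_ext_scale1 : left_id 1 mpoly_ext_scale.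
Proof. by move=> f; rewrite /mpoly_ext_scale !scale1r. Qed.

Lemma mpoly_ext_scaleDr : right_distributive mpoly_ext_scale +%R.
Proof. by move=> c f g; rewrite /mpoly_ext_scale scalerDr. Qed.

Lemma mpoly_ext_scaleDl f : {morph mpoly_ext_scale^~ f : a b / a + b}.
Proof. by move=> a b; rewrite /mpoly_ext_scale !scalerDl. Qed.

HB.instance Definition _ := GRing.Zmodule_isLmodule.Build F mpoly_ext
  mpoly_ext_scaleA mpoly_ext_scale1 mpoly_ext_scaleDr mpoly_ext_scaleDl.

Lemma mpoly_ext_scaleAl (c : F) (f g : mpoly_ext) : c *: (f * g) = c *: f * g.
Proof. exact: (@scalerAl R {mpoly R[n]}). Qed.

HB.instance Definition _ :=
  GRing.Lmodule_isLalgebra.Build F mpoly_ext mpoly_ext_scaleAl.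
HB.instance Definition _ := GRing.Lalgebra_isComAlgebra.Build F mpoly_ext.

Definition ext_inl (r : R) : mpoly_ext := r%:MP_[n].
Definition ext_inr (f : {mpoly F[n]}) : mpoly_ext :=
  map_mpoly (in_alg R) f.


Lemma ext_inl_zmod : zmod_morphism ext_inl.
Proof. by move=> r s; rewrite /ext_inl raddfB. Qed.

Lemma ext_inl_monoid : monoid_morphism ext_inl.
Proof. by split=> [|r s]; rewrite /ext_inl ?rmorphM ?rmorph1. Qed.

Lemma ext_inl_scalable : scalable ext_inl.
Proof.
move=> c r; have -> : c *: r = c%:A * r by rewrite -scalerAl mul1r.
by rewrite /ext_inl mpolyCM mul_mpolyC.
Qed.

HB.instance Definition _ :=
  GRing.isZmodMorphism.Build R mpoly_ext ext_inl ext_inl_zmod.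
HB.instance Definition _ :=
  GRing.isMonoidMorphism.Build R mpoly_ext ext_inl ext_inl_monoid.
HB.instance Definition _ :=
  GRing.isScalable.Build F R mpoly_ext _ ext_inl ext_inl_scalable.

Lemma ext_inr_zmod : zmod_morphism ext_inr.
Proof. by move=> r s; rewrite /ext_inr raddfB. Qed.

Lemma ext_inr_monoid : monoid_morphism ext_inr.
Proof. by split=> [|r s]; rewrite /ext_inr ?rmorphM ?rmorph1. Qed.

Lemma ext_inr_scalable : scalable ext_inr.
Proof.
move=> c f; rewrite /ext_inr -mul_mpolyC rmorphM /= map_mpolyC /=.
by rewrite mul_mpolyC.
Qed.

HB.instance Definition _ :=
  GRing.isZmodMorphism.Build {mpoly F[n]} mpoly_ext ext_inr ext_inr_zmod.
HB.instance Definition _ :=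
  GRing.isMonoidMorphism.Build {mpoly F[n]} mpoly_ext ext_inr ext_inr_monoid.
HB.instance Definition _ :=
  GRing.isScalable.Build F {mpoly F[n]} mpoly_ext _ ext_inr ext_inr_scalable.

Lemma ext_pure (r : R) (m : 'X_{1..n}) :
  ext_inl r * ext_inr 'X_[m] = r *: ('X_[m] : {mpoly R[n]}).
Proof. by rewrite /ext_inl /ext_inr map_mpolyX mul_mpolyC. Qed.

Lemma mpoly_ext_uniq (W : lmodType F) (g h : {linear mpoly_ext -> W}) :
  (forall r f, g (ext_inl r * ext_inr f) = h (ext_inl r * ext_inr f)) ->
  g =1 h.
Proof.
move=> eq_gh f; rewrite [f](mpolyE (f : {mpoly R[n]})).
rewrite (linear_sum g) (linear_sum h); apply: eq_bigr => m _.
by have := eq_gh f@_m 'X_[m]; rewrite ext_pure.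
Qed.

Lemma mpoly_ext_lift (W : lmodType F) (b : R -> {mpoly F[n]} -> W) :
  is_bilinear b ->
  exists g : {linear mpoly_ext -> W},
    forall r f, g (ext_inl r * ext_inr f) = b r f.
Proof.
move=> [b_r b_l].
have b0 f : b 0 f = 0.
  by have := b_l f (-1) 0 0; rewrite /= scaler0 addr0 scaleN1r addNr.
have bD f : {morph b^~ f : r s / r + s}.
  by move=> r s; have := b_l f 1 r s; rewrite /= !scale1r.
have bZ f c r : b (c *: r) f = c *: b r f.
  by have := b_l f c r 0; rewrite /= b0 !addr0.
pose g (f : mpoly_ext) : W := \sum_(m <- msupp (f : {mpoly R[n]})) b f@_m 'X_[m].
have gwE k (f : {mpoly R[n]}) : (msize f <= k)%N ->
    g f = \sum_(m : 'X_{1..n < k}) b f@_m 'X_[m].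
  move=> le_fk; pose I : subFinType _ := 'X_{1..n < k}.
  rewrite /g (ssrcomplements.big_mksub I) //=; first last.
  - by move=> x /msize_mdeg_lt /leq_trans /(_ le_fk).
  - by rewrite msupp_uniq.
  by rewrite big_rmcond //= => m /memN_msupp_eq0 ->.
have g_lin : linear g.
  move=> c f1 f2; pose k := maxn (msize (c *: f1 + f2 : mpoly_ext))
                            (maxn (msize (f1 : {mpoly R[n]}))
                                  (msize (f2 : {mpoly R[n]}))).
  rewrite !(gwE k) ?leq_max ?leqnn ?orbT // scaler_sumr -big_split /=.
  apply: eq_bigr => m _; rewrite mcoeffD mcoeffZ -scalerAl mul1r.
  by rewrite bD bZ.
pose gL := GRing.isLinear.Build F mpoly_ext W _ g g_lin.
pose gG : {linear mpoly_ext -> W} := HB.pack g gL.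
exists gG => r f; rewrite [f]mpolyE.
pose brL := GRing.isLinear.Build F {mpoly F[n]} W _ (b r) (b_r r).
pose br : {linear {mpoly F[n]} -> W} := HB.pack (b r) brL.
rewrite -[RHS]/(br _) (linear_sum br) (linear_sum ext_inr) mulr_sumr.
rewrite (linear_sum gG); apply: eq_bigr => m _.
rewrite (linearZ_LR br) (linearZ_LR ext_inr) -scalerAr (linearZ_LR gG) /=.
congr (_ *: _).
rewrite ext_pure (gwE (maxn (mdeg m).+1 (msize (r *: ('X_[m] : {mpoly R[n]})))));
  last by rewrite leq_maxr.
have lt_m : (mdeg m < maxn (mdeg m).+1 (msize (r *: ('X_[m] : {mpoly R[n]}))))%N.
  by rewrite leq_max leqnn.
rewrite (bigD1 (BMultinom lt_m)) //= mcoeffZ mcoeffX eqxx mulr1.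
rewrite big1 ?addr0 // => m' ne_m'; rewrite mcoeffZ mcoeffX.
case: (eqVneq m m') ne_m' => [eq_m|_ _]; last by rewrite mulr0 b0.
by rewrite -val_eqE /= -[X in X != _]eq_m eqxx.
Qed.

Definition mpoly_tensor : tensor_product R {mpoly F[n]} :=
  @TensorProduct F R {mpoly F[n]} mpoly_ext ext_inl ext_inr
    mpoly_ext_lift mpoly_ext_uniq.

End MpolyTensor.

(* Weighted degree of a monomial, the i-th variable having degree w`_i. *)
Definition wdeg (w : seq nat) (n : nat) (m : 'X_{1..n}) : nat :=
  (\sum_(i < n) nth 0 w i * m i)%N.

Lemma wdeg0 w n : wdeg w (0 : 'X_{1..n})%MM = 0%N.
Proof. by rewrite /wdeg big1 // => i _; rewrite mnm0E muln0. Qed.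

Lemma wdegD w n : {morph @wdeg w n : m1 m2 / (m1 + m2)%MM >-> (m1 + m2)%N}.
Proof.
move=> m1 m2; rewrite /wdeg -big_split; apply: eq_bigr => i _.
by rewrite mnmDE mulnDr.
Qed.

HB.instance Definition _ w n := isMeasure.Build n (@wdeg w n) (@wdeg0 w n)
  (@wdegD w n).

Section Hypersurface.
Variables (F : fieldType) (p : nat).

(* The variables x, y, z are 'X_0, 'X_1, 'X_2. *)
Definition hyp_poly : {mpoly F[3]} := 'X_0 ^+ 2 + 'X_1 ^+ 3 - 'X_2 ^+ p.

Definition hyp_ideal : {pred {mpoly F[3]}} :=
  fun f => `[< exists g, f = g * hyp_poly >].

Lemma hyp_idealr_closed : idealr_closed hyp_ideal.
Proof.
split=> [||a f g].
- by apply/asboolP; exists 0; rewrite mul0r.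
- apply/asboolP => -[g /(congr1 (meval (fun i => ((i != 1) : nat)%:R)))].
  rewrite mevalM meval1 mevalB mevalD !rmorphXn /= !mevalXU /= expr1n expr0n addr0.
  by rewrite expr1n subrr mulr0 => /eqP; rewrite oner_eq0.
- move=> /asboolP[f' ->] /asboolP[g' ->]; apply/asboolP.
  by exists (a * f' + g'); rewrite mulrDl mulrA.
Qed.

HB.instance Definition _ := isIdealr.Build {mpoly F[3]} hyp_ideal
  hyp_idealr_closed.

Definition hyp_ring : Type := {ideal_quot hyp_ideal}.

HB.instance Definition _ := GRing.ComNzRing.on hyp_ring.

Definition hyp_pi : {mpoly F[3]} -> hyp_ring := \pi_{ideal_quot hyp_ideal}.

Lemma hyp_pi_zmod : zmod_morphism hyp_pi.
Proof. by move=> f g; rewrite /hyp_pi raddfB. Qed.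

Lemma hyp_pi_monoid : monoid_morphism hyp_pi.
Proof. by split=> [|f g]; rewrite /hyp_pi ?rmorphM ?rmorph1. Qed.

HB.instance Definition _ :=
  GRing.isZmodMorphism.Build {mpoly F[3]} hyp_ring hyp_pi hyp_pi_zmod.
HB.instance Definition _ :=
  GRing.isMonoidMorphism.Build {mpoly F[3]} hyp_ring hyp_pi hyp_pi_monoid.

Definition hyp_scale (c : F) (r : hyp_ring) : hyp_ring := hyp_pi c%:MP * r.

Lemma hyp_scaleA c d r : hyp_scale c (hyp_scale d r) = hyp_scale (c * d) r.
Proof. by rewrite /hyp_scale mulrA -rmorphM mpolyCM. Qed.

Lemma hyp_scale1 : left_id 1 hyp_scale.
Proof. by move=> r; rewrite /hyp_scale mpolyC1 rmorph1 mul1r. Qed.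

Lemma hyp_scaleDr : right_distributive hyp_scale +%R.
Proof. by move=> c r s; rewrite /hyp_scale mulrDr. Qed.

Lemma hyp_scaleDl r : {morph hyp_scale^~ r : c d / c + d}.
Proof. by move=> c d; rewrite /hyp_scale mpolyCD rmorphD mulrDl. Qed.

HB.instance Definition _ := GRing.Zmodule_isLmodule.Build F hyp_ring
  hyp_scaleA hyp_scale1 hyp_scaleDr hyp_scaleDl.

Lemma hyp_scaleAl (c : F) (r s : hyp_ring) : c *: (r * s) = c *: r * s.
Proof. exact: mulrA. Qed.

HB.instance Definition _ :=
  GRing.Lmodule_isLalgebra.Build F hyp_ring hyp_scaleAl.
HB.instance Definition _ := GRing.Lalgebra_isComAlgebra.Build F hyp_ring.

Lemma hyp_pi_scalable : scalable hyp_pi.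
Proof. by move=> c f; rewrite -mul_mpolyC rmorphM. Qed.

HB.instance Definition _ :=
  GRing.isScalable.Build F {mpoly F[3]} hyp_ring _ hyp_pi hyp_pi_scalable.

Lemma hyp_pi_eq0 f : hyp_pi f = 0 <-> exists g, f = g * hyp_poly.
Proof.
have E : (hyp_pi f == hyp_pi 0) = (f - 0 \in hyp_ideal).
  by rewrite Quotient.idealrBE.
rewrite -[X in _ = X](rmorph0 hyp_pi); split=> [/eqP|fE].
  by rewrite E subr0 => /asboolP.
by apply/eqP; rewrite E subr0; apply/asboolP.
Qed.

Lemma hyp_pi_surj r : exists f, hyp_pi f = r.
Proof. by exists (repr (r : {ideal_quot hyp_ideal})); exact: reprK. Qed.

Definition hyp_wdeg : measure 3 := @wdeg [:: 3 * p; 2 * p; 6]%N 3.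

Lemma hyp_poly_homog : hyp_poly \is (6 * p).-homog for hyp_wdeg.
Proof.
have wX i d k : (k * nth 0 [:: 3 * p; 2 * p; 6] (val i) = d)%N ->
    ('X_i ^+ k : {mpoly F[3]}) \is d.-homog for hyp_wdeg.
  move=> <-; rewrite -[(k * _)%N]mulnC; apply: dhomogMn; rewrite dhomogX.
  rewrite /= /wdeg (bigD1 i) //= mnm1E eqxx muln1 big1 ?addn0 // => j ne_ji.
  by rewrite mnm1E eq_sym (negbTE ne_ji) muln0.
rewrite /hyp_poly; apply: rpredB; last by apply: wX => /=; rewrite mulnC.
by apply: rpredD; apply: wX; rewrite /= mulnA.
Qed.

Definition hyp_piece (d : nat) : set hyp_ring :=
  [set r | exists f, f \is d.-homog for hyp_wdeg /\ hyp_pi f = r].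

Lemma hyp_piece0 d : hyp_piece d 0.
Proof. by exists 0; rewrite rmorph0; split=> //; exact: dhomog0. Qed.

Lemma hyp_pieceP d (c : F) r s :
  hyp_piece d r -> hyp_piece d s -> hyp_piece d (c *: r + s).
Proof.
move=> [f [Gf <-]] [g [Gg <-]]; exists (c *: f + g); rewrite linearP.
by split=> //; apply: mpoly_pieceP.
Qed.

Lemma hyp_piece1 : hyp_piece 0 1.
Proof. by exists 1; rewrite rmorph1; split=> //; exact: dhomog1. Qed.

Lemma hyp_pieceM d e r s :
  hyp_piece d r -> hyp_piece e s -> hyp_piece (d + e) (r * s).
Proof.
move=> [f [Gf <-]] [g [Gg <-]]; exists (f * g); rewrite rmorphM.
by split=> //; exact: dhomogM.
Qed.

Lemma hyp_piece_sum r : exists n (h : nat -> hyp_ring),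
  (forall d, hyp_piece d (h d)) /\ r = \sum_(d < n) h d.
Proof.
have [f <-] := hyp_pi_surj r.
exists (mmeasure hyp_wdeg f), (fun d => hyp_pi (pihomog hyp_wdeg d f)).
split=> [d|]; first by eexists; split; [exact: pihomogP|].
by rewrite {1}(pihomog_partitionE (leqnn (mmeasure hyp_wdeg f))) rmorph_sum.
Qed.

Lemma hyp_piece_free n (h : nat -> hyp_ring) :
  (forall d, hyp_piece d (h d)) -> \sum_(d < n) h d = 0 ->
  forall d, (d < n)%N -> h d = 0.
Proof.
move=> /choice[k Gk]; rewrite (eq_bigr (fun d : 'I_n => hyp_pi (k d))); last first.
  by move=> d _; rewrite (Gk d).2.
rewrite -rmorph_sum => /hyp_pi_eq0[g kE] d lt_d; rewrite -(Gk d).2.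
apply/hyp_pi_eq0; have := congr1 (pihomog hyp_wdeg d) kE.
rewrite linear_sum (bigD1 (Ordinal lt_d)) //= (pihomog_dE (Gk d).1).
rewrite big1 ?addr0 => [->|i ne_i]; last by apply: pihomog_ne0 (Gk i).1.
rewrite {1}(pihomog_partitionE (leqnn (mmeasure hyp_wdeg g))).
rewrite mulr_suml linear_sum.
exists (\sum_(i < mmeasure hyp_wdeg g | (i + 6 * p == d)%N) pihomog hyp_wdeg i g).
rewrite mulr_suml [RHS]big_mkcond; apply: eq_bigr => i _ /=.
have Gi := dhomogM (pihomogP hyp_wdeg i g) hyp_poly_homog.
by case: eqP => [<-|/eqP ne]; [exact: pihomog_dE | exact: pihomog_ne0 Gi].
Qed.

Definition hyp_grading : grading hyp_ring :=
  @Grading F hyp_ring hyp_piece hyp_piece0 hyp_pieceP hyp_piece1 hyp_pieceM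
    hyp_piece_sum hyp_piece_free.

End Hypersurface.
Arguments hyp_pi : clear implicits.

Definition std_grading (F : fieldType) (n : nat) : grading {mpoly F[n]} :=
  mpoly_grading F (@mdeg n).

Section HypersurfaceSegre.
Variables (F : fieldType) (p : nat).

Definition hyp_segre : Type :=
  segre (hyp_grading F p) (std_grading F 2) (mpoly_tensor (hyp_ring F p) 2).

HB.instance Definition _ := GRing.ComAlgebra.on hyp_segre.

Definition hyp_segre_grading : grading hyp_segre :=
  segre_grading (hyp_grading F p) (std_grading F 2)
    (mpoly_tensor (hyp_ring F p) 2).

End HypersurfaceSegre.

(* Main.v *)
From HB Require Import structures.
Require Import Defs.
From mathcomp Require Import all_boot all_order all_algebra.
From mathcomp Require Import boolp classical_sets mpoly ring zify.

(* FFRT: raising to the power q identifies B^{1/q} with B, on which B acts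
   through q-th powers. Suppose that one graded B-module P with finite-dimensional
   pieces, generated in bounded degrees, is such that for every e > 0 this module
   is a graded direct summand of a finite sum of shifts of P. Fitting's lemma and
   Krull-Schmidt then show that every indecomposable summand of B^{1/q} is one of
   the finitely many indecomposable summands of P, or B itself (e = 0). For B = R, take
   P = A^{1/p} = F[X, Y]: as R is A-free on the powers of z, R^{1/q} is free over
   A^{1/q}, hence over A^{1/p}. For the Segre product, apply this in R[u, v] and
   keep only the span P of the monomials of A^{1/p}[u, v] whose degrees in (X, Y),
   weighted by (3, 2), and in (u, v) differ by a bounded amount.

   a-invariant: z^p = x^2 + y^3 makes z^{p-1} / (x y) a Cech class of degree p - 6
   for (x, y, z); it is nonzero, and nothing lives in higher degree, because R is
   A-free on 1, z, ..., z^{p-1}.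

   Not Cohen-Macaulay: B = R # S has a chain of four primes below its irrelevant
   ideal. Put w = z^{p-1} u^{p-6} in T = R[u, v]. Every f in the irrelevant ideal
   satisfies f w = y A_f + x B_f in T; this makes w a class of H^2_{(x,y)}(T)
   killed by the irrelevant ideal. If f, g, h were a regular sequence, then
   comparing the A's and B's of f, g and h would give w in (x, y) T, which is
   false since z^{p-1} is not in (x, y) R. *)

Set Implicit Arguments.
Unset Strict Implicit.
Unset Printing Implicit Defensive.

Import GRing.Theory Num.Theory.
Local Open Scope ring_scope.


(** * Submodules and graded projectors *)

(** Four obstacles shape the development. The modules are infinite-dimensional over F, so Fitting's
    lemma runs on one homogeneous piece at a time, with an exponent that depends on the degree.
    Degree m of P lands in degree q m + s of B once B acts through q-th powers, so Krull-Schmidt is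
    stated with an injective reindexing of degrees. For the Segre product, A^{1/p}[u, v] splits over
    B by the difference of the two degrees into infinitely many submodules and cannot serve as P;
    but the coordinates of elements of B have a difference that, divided by q, is bounded
    independently of q, and this uniformity gives a single finite list. Finally, a sequence regular
    on B need not be regular on T: relations found in T have to be carried back to B, which is done
    by multiplying with powers of u and, separately, of v. The exponent of u in w is the
    a-invariant: z^{p-1} has degree (p - 6) + deg x + deg y, and u^{p-6} brings A_f and B_f to the
    degrees of x and of y, so that it is the sign of a(R) that makes the argument possible. *)

Lemma inj_surj_bij (U V : Type) (f : U -> V) :
  injective f -> (forall v, exists u, f u = v) -> bijective f.
Proof.
move=> fI /choice[g fg]; exists g => // u.
by apply: fI; rewrite fg.
Qed.

Lemma bij_surj (U V : Type) (f : U -> V) :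
  bijective f -> forall v, exists u, f u = v.
Proof. by move=> [g _ fg] v; exists (g v). Qed.

Section Submodules.
Variables (B : comNzRingType) (V : lmodType B).

Record submod := Submod {
  submod_set :> V -> Prop;
  submod0 : submod_set 0;
  submodP : forall b u v, submod_set u -> submod_set v -> submod_set (b *: u + v)
}.

(** Submodules are cut out by arbitrary propositions; the classical truth value turns them into
    predicates, from which the subtype inherits its module structure. *)
Definition submod_pred (N : submod) : {pred V} := fun v => `[< N v >].

Lemma submod_pred_closed N : submod_closed (submod_pred N).
Proof.
split; first by apply/asboolP/submod0.
by move=> b u v /asboolP Nu /asboolP Nv; apply/asboolP/submodP.
Qed.

HB.instance Definition _ N :=
  GRing.isSubmodClosed.Build B V (submod_pred N) (submod_pred_closed N).

Record submod_type (N : submod) :=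
  SubmodType { submod_val : V; _ : submod_val \in submod_pred N }.

HB.instance Definition _ N := [isSub for @submod_val N].
HB.instance Definition _ N := [Choice of submod_type N by <:].
HB.instance Definition _ N := [SubChoice_isSubLmodule of submod_type N by <:].

Lemma submod_valP N (u : submod_type N) : N (val u).
Proof. by case: u => v /= /asboolP. Qed.

Definition submod_in (N : submod) v (Nv : N v) : submod_type N :=
  SubmodType (asboolT Nv : v \in submod_pred N).

Lemma submod_valD N (u v : submod_type N) : val (u + v) = val u + val v.
Proof. by []. Qed.

Lemma submod_valZ N b (u : submod_type N) : val (b *: u) = b *: val u.
Proof. by []. Qed.

End Submodules.

Section LinearTools.
Variable B : comNzRingType.

Definition mklin (U V : lmodType B) (f : U -> V) (fL : linear f) :
  {linear U -> V} := HB.pack f (GRing.isLinear.Build B U V _ f fL).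

Lemma linear_inv (U V : lmodType B) (f : {linear U -> V}) :
  bijective f -> exists g : {linear V -> U}, cancel f g /\ cancel g f.
Proof.
move=> [g fK gK]; have gL : linear g.
  by move=> b u v; apply: (can_inj fK); rewrite gK linearP !gK.
by exists (mklin gL).
Qed.

Lemma linear_iter (V : lmodType B) (f : {linear V -> V}) n : linear (iter n f).
Proof. by elim: n => [|n IH] b u v //=; rewrite IH linearP. Qed.

Lemma submod_lift (U V : lmodType B) (N : submod V) (f : {linear U -> V}) :
  (forall u, N (f u)) -> exists g : {linear U -> submod_type N},
  forall u, val (g u) = f u.
Proof.
move=> Nf; have gL : linear (fun u => submod_in (Nf u)).
  by move=> b u v; apply: val_inj; rewrite submod_valD submod_valZ /= linearP.
by exists (mklin gL).
Qed.

Lemma submod_inj (V : lmodType B) (N : submod V) :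
  exists g : {linear submod_type N -> V}, forall u, g u = val u.
Proof.
have gL : linear (fun u : submod_type N => val u) by move=> b u v.
by exists (mklin gL).
Qed.

(** Choice picks a component in [K] for each vector; since [K] meets [I] only in 0 this component is
    unique, hence linear in the vector. *)
Lemma projector_ex (V : lmodType B) (K I : submod V) :
    (forall v, K v -> I v -> v = 0) ->
    (forall v, exists k, K k /\ I (v - k)) ->
  exists e : {linear V -> V},
    [/\ forall v, K (v - e v), forall v, I (e v),
        forall v, I v -> e v = v & forall v, K v -> e v = 0].
Proof.
move=> KI0 /choice[k kP].
have KB u v : K u -> K v -> K (u - v).
  by move=> Ku Kv; rewrite addrC -scaleN1r; apply: submodP.
have IB u v : I u -> I v -> I (u - v).
  by move=> Ku Kv; rewrite addrC -scaleN1r; apply: submodP.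
have uniq v a : K a -> I (v - a) -> k v = a.
  case: (kP v) => Kk Ik Ka Ia; apply/eqP; rewrite -subr_eq0; apply/eqP.
  apply: KI0; first exact: KB.
  have -> : k v - a = (v - a) - (v - k v) by rewrite opprB [RHS]addrC addrA subrK.
  exact: IB.
have eL : linear (fun v => v - k v).
  move=> b u v.
  have -> : k (b *: u + v) = b *: k u + k v.
    case: (kP u) (kP v) => [Ku Iu] [Kv Iv].
    apply: uniq; first exact: submodP.
    by rewrite opprD addrACA -scalerBr; apply: submodP.
  by rewrite opprD addrACA -scalerBr.
exists (mklin eL); split=> v /=.
- by rewrite subKr; case: (kP v).
- by case: (kP v).
- by move=> Iv; rewrite (uniq v 0) ?subr0 //; apply: submod0.
- by move=> Kv; rewrite (uniq v v) ?subrr //; apply: submod0.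
Qed.

End LinearTools.

(** A grading is encoded by its projectors, so that gradedness of a map is an equation. Applying a
    projector of degree at least n to the last clause shows that it kills v. *)
Definition grading_proj (V : zmodType) (pr : nat -> V -> V) : Prop :=
  [/\ forall d u v, pr d (u - v) = pr d u - pr d v,
      forall d e v, pr d (pr e v) = if d == e then pr e v else 0
    & forall v, exists n, v = \sum_(d < n) pr d v].

Definition graded_map (U V : Type) (prU : nat -> U -> U) (prV : nat -> V -> V)
    (f : U -> V) : Prop := forall d u, f (prU d u) = prV d (f u).

Section GradingProj.
Variables (V : zmodType) (pr : nat -> V -> V).
Hypothesis prP : grading_proj pr.

Lemma grpr0 d : pr d 0 = 0.
Proof. by case: prP => prB _ _; rewrite -[in LHS](subrr 0) prB subrr. Qed.

Lemma grprB d u v : pr d (u - v) = pr d u - pr d v.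
Proof. by case: prP. Qed.

Lemma grprD d u v : pr d (u + v) = pr d u + pr d v.
Proof.
have prN w : pr d (- w) = - pr d w by rewrite -[- w]sub0r grprB grpr0 sub0r.
by rewrite -{1}[v]opprK grprB prN opprK.
Qed.

Lemma grpr_sum d (I : Type) (s : seq I) (P : pred I) (h : I -> V) :
  pr d (\sum_(i <- s | P i) h i) = \sum_(i <- s | P i) pr d (h i).
Proof. exact: (big_morph (pr d) (fun u v => grprD d u v) (grpr0 d)). Qed.

Lemma grpr_id d v : pr d (pr d v) = pr d v.
Proof. by case: prP => _ -> _; rewrite eqxx. Qed.

Lemma grprE d e v : pr d (pr e v) = if d == e then pr e v else 0.
Proof. by case: prP. Qed.

Lemma grpr_dec v : exists n, v = \sum_(d < n) pr d v.
Proof. by case: prP. Qed.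

Lemma grpr_eq0 v : (forall d, pr d v = 0) -> v = 0.
Proof. by move=> v0; have [n ->] := grpr_dec v; rewrite big1. Qed.

End GradingProj.

(** * Fitting's lemma and the Krull-Schmidt theorem *)

Section FieldSpan.
Variables (F : fieldType) (B : comAlgType F).

Definition fspan (V : lmodType B) (s : seq V) (v : V) : Prop :=
  exists c : nat -> F, v = \sum_(i < size s) (c i)%:A *: s`_i.

Definition fin_pieces (V : lmodType B) (pr : nat -> V -> V) : Prop :=
  forall d, exists s : seq V,
    (forall v, v \in s -> pr d v = v) /\ forall v, fspan s (pr d v).

Lemma algM (a b : F) : (a * b)%:A = a%:A * b%:A :> B.
Proof. exact: (rmorphM (GRing.in_alg B)). Qed.

Lemma algD (a b : F) : (a + b)%:A = a%:A + b%:A :> B.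
Proof. exact: (rmorphD (GRing.in_alg B)). Qed.

Variable V : lmodType B.
Implicit Types s t : seq V.

Lemma fspan0 s : fspan s 0.
Proof. by exists (fun=> 0); rewrite big1 // => i _; rewrite scale0r scale0r. Qed.

Lemma fspanP s (a : F) u v :
  fspan s u -> fspan s v -> fspan s (a%:A *: u + v).
Proof.
move=> [c ->] [d ->]; exists (fun i => a * c i + d i).
rewrite scaler_sumr -big_split; apply: eq_bigr => i _ /=.
by rewrite algD algM scalerDl scalerA.
Qed.

Lemma fspanD s u v : fspan s u -> fspan s v -> fspan s (u + v).
Proof. by move=> su sv; rewrite -[u]scale1r -[1]scale1r; apply: fspanP. Qed.

Lemma fspan_sum s (I : Type) (r : seq I) (h : I -> V) :
  (forall i, fspan s (h i)) -> fspan s (\sum_(i <- r) h i).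
Proof.
by move=> sh; elim/big_rec: _ => [|i x _]; [exact: fspan0 | exact: fspanD].
Qed.

Lemma fspan_sum_mem s (I : eqType) (r : seq I) (P : pred I) (h : I -> V) :
  (forall i, i \in r -> P i -> fspan s (h i)) -> fspan s (\sum_(i <- r | P i) h i).
Proof.
move=> sh; rewrite big_seq_cond; elim/big_rec: _ => [|i x /andP[ri Pi]].
  exact: fspan0.
by apply: fspanD; exact: sh.
Qed.

Lemma fspan_mem s v : v \in s -> fspan s v.
Proof.
move=> v_s; exists (fun i => (i == index v s)%:R).
have lt_v : (index v s < size s)%N by rewrite index_mem.
rewrite (bigD1 (Ordinal lt_v)) //= eqxx big1 => [|i /negbTE ne_i].
  by rewrite scale1r scale1r addr0 nth_index.
by rewrite -[_ == _]/(i == Ordinal lt_v) ne_i scale0r scale0r.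
Qed.

Lemma fspan_sub s t v :
  fspan s v -> (forall u, u \in s -> fspan t u) -> fspan t v.
Proof.
move=> [c ->] st; apply: fspan_sum => i.
by rewrite -[_ *: _]addr0; apply/fspanP/fspan0/st/mem_nth.
Qed.

Lemma fspan_map (W : lmodType B) (f : V -> W) s v :
    (forall a u v, f (a%:A *: u + v) = a%:A *: f u + f v) ->
  fspan s v -> fspan (map f s) (f v).
Proof.
move=> fP [c ->].
have f0 : f 0 = 0 by have := fP (-1) 0 0; rewrite scaler0 addr0 !scaleN1r addNr.
have fD u w : f (u + w) = f u + f w by have := fP 1 u w; rewrite !scale1r.
exists c; rewrite (big_morph f fD f0) size_map; apply: eq_bigr => i _.
by rewrite -[_ *: _]addr0 fP f0 addr0 (nth_map 0).
Qed.

(** The coefficients form a matrix with more rows than columns, so its left kernel contains a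
    nonzero row. *)
Lemma fspan_dep s n (v : 'I_n -> V) :
    (size s < n)%N -> (forall i, fspan s (v i)) ->
  exists2 u : 'I_n -> F, exists i, u i != 0 & \sum_i (u i)%:A *: v i = 0.
Proof.
move=> lt_sn /choice[c cE]; pose A := \matrix_(i < n, j < size s) c i j.
have /rowV0Pn[u /sub_kermxP uA u0] : kermx A != 0.
  rewrite -mxrank_eq0 mxrank_ker subn_eq0 -ltnNge.
  exact: leq_ltn_trans (rank_leq_col A) lt_sn.
exists (fun i => u 0 i); first exact/rV0Pn.
rewrite (eq_bigr (fun i => \sum_(j < size s) (u 0 i * c i j)%:A *: s`_j)) => [|i _].
  rewrite exchange_big big1 //= => j _; rewrite -scaler_suml.
  have := congr1 (fun M : 'M_(1, size s) => M 0 j) uA; rewrite !mxE => uAj.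
  rewrite -scaler_suml [X in X%:A](_ : _ = 0) ?scale0r ?scale0r //.
  by rewrite -[RHS]uAj; apply: eq_bigr => i _; rewrite !mxE.
by rewrite cE scaler_sumr; apply: eq_bigr => j _; rewrite algM scalerA.
Qed.

End FieldSpan.

Section Fitting.
Variables (F : fieldType) (B : comAlgType F) (V : lmodType B).
Variables (pr : nat -> V -> V) (f : {linear V -> V}).
Hypotheses (prP : grading_proj pr) (prF : fin_pieces pr).
Hypothesis f_gr : graded_map pr pr f.

Lemma iter_lin n b u v : iter n f (b *: u + v) = b *: iter n f u + iter n f v.
Proof. exact: (linear_iter f n). Qed.

Lemma iter_gr n : graded_map pr pr (iter n f).
Proof. by elim: n => [|n IH] d v //=; rewrite IH f_gr. Qed.

(* Cayley-Hamilton on the piece of degree d, after cancelling the powers of T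
   that divide the characteristic polynomial. *)
Lemma fitting_relation d : exists n m (c : nat -> F), forall v, pr d v = v ->
  iter n f v = \sum_(i < m) (c i)%:A *: iter (n.+1 + i) f v.
Proof.
(* Prepending 0 makes the spanning list nonempty, so that the square matrices of its size form a
   ring and Cayley-Hamilton applies. *)
have [s0 [s0d s0P]] := prF d; pose s := 0 :: s0.
have sd v : v \in s -> pr d v = v.
  by rewrite inE => /predU1P[->|/s0d //]; exact: grpr0.
have sP v : fspan s (pr d v).
  apply: fspan_sub (s0P v) _ => u us; apply: fspan_mem.
  by rewrite inE us orbT.
have /choice[a aE] : forall i : 'I_(size s), exists c : nat -> F,
    f s`_i = \sum_(j < size s) (c j)%:A *: s`_j.
  move=> i; rewrite -(sd s`_i) ?mem_nth // f_gr; exact: sP.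
pose N := size s0; pose A : 'M[F]_N.+1 := \matrix_(i, j) a i j.
(* The list need not be a basis: [A] is one choice of coefficients for f on the generators, and its
   powers are valid choices for the iterates. *)
have powA k (i : 'I_N.+1) : iter k f s`_i = \sum_(j < N.+1) ((A ^+ k) i j)%:A *: s`_j.
  elim: k => [|k IH] /=.
    rewrite expr0 (bigD1 i) //= mxE eqxx big1 => [|j ne_j].
      by rewrite addr0 scale1r scale1r.
    by rewrite mxE eq_sym (negbTE ne_j) scale0r scale0r.
  rewrite IH linear_sum.
  transitivity (\sum_(l < N.+1) \sum_(j < N.+1)
    ((A ^+ k) i l * A l j)%:A *: s`_j).
    apply: eq_bigr => l _; rewrite linearZ /= aE scaler_sumr.
    by apply: eq_bigr => j _; rewrite mxE algM scalerA.
  rewrite exchange_big; apply: eq_bigr => j _; rewrite -scaler_suml.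
  congr (_ *: _); rewrite exprSr -[_ * A]/(_ *m A) mxE.
  by rewrite scaler_suml.
pose X := char_poly A.
have XA v : pr d v = v -> \sum_(k < N.+2) (X`_k)%:A *: iter k f v = 0.
  move=> vd; have [c vE] := sP v; rewrite vd in vE.
  have iterE k : iter k f v = \sum_(i < N.+1) (c i)%:A *: iter k f s`_i.
    rewrite vE; have iD := iter_lin k 1.
    have i0 : iter k f 0 = 0.
      by have := iter_lin k (-1) 0 0; rewrite scaler0 addr0 !scaleN1r addNr.
    rewrite (big_morph (iter k f) (id1 := 0) (op1 := +%R)) //.
      by apply: eq_bigr => i _; rewrite -[_ *: _]addr0 iter_lin i0 addr0.
    by move=> x y; have := iter_lin k 1 x y; rewrite !scale1r.
  under eq_bigr => k _ do rewrite iterE scaler_sumr.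
  rewrite exchange_big big1 //= => i _.
  under eq_bigr => k _ do rewrite scalerA mulrC -scalerA powA scaler_sumr.
  rewrite -scaler_sumr exchange_big /=.
  rewrite [X in _ *: X]big1 ?scaler0 // => j _.
  transitivity ((\sum_(k < N.+2) X`_k * (A ^+ k) i j)%:A *: s`_j : V).
    rewrite !scaler_suml; apply: eq_bigr => k _.
    by rewrite /= algM scalerA.
  have := Cayley_Hamilton A; rewrite /horner_mx /horner_morph.
  rewrite (@horner_coef_wide _ N.+2); last first.
    by rewrite (leq_trans (size_poly _ _)) // size_char_poly.
  move=> /(congr1 (fun M : 'M_N.+1 => M i j)); rewrite summxE mxE => XAij.
  rewrite [X in X%:A](_ : _ = 0) ?scale0r ?scale0r // -[RHS]XAij.
  by apply: eq_bigr => k _; rewrite coef_map -[_ * _ ^+ _]/(_ *m _) mul_scalar_mx mxE.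
have exX : exists k, X`_k != 0.
  exists N.+1; have := monicP (char_poly_monic A).
  by rewrite /lead_coef size_char_poly => ->; rewrite oner_eq0.
pose n := ex_minn exX; have [Xn minX] : X`_n != 0 /\ forall k, (k < n)%N -> X`_k = 0.
  rewrite /n; case: ex_minnP => k Xk mink; split=> // l lt_l.
  by apply: contraTeq lt_l => /mink; rewrite -leqNgt.
have lt_n : (n < N.+2)%N.
  rewrite ltnNge; apply: contraNN Xn => le_n; rewrite nth_default //.
  by rewrite size_char_poly.
exists n, (N.+2 - n.+1)%N, (fun i => - (X`_n)^-1 * X`_(n.+1 + i)) => v vd.
have := XA v vd; rewrite -(big_mkord xpredT (fun k => (X`_k)%:A *: iter k f v)).
rewrite (big_cat_nat (n := n)) //=; last exact: ltnW.
rewrite big_nat big1 ?add0r => [|k /andP[_ /minX ->]]; last by rewrite !scale0r.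
rewrite big_ltn // -{1}[n.+1]add0n big_addn big_mkord => /eqP.
rewrite addr_eq0 => /eqP E.
have -> : iter n f v = ((X`_n)^-1)%:A *: ((X`_n)%:A *: iter n f v).
  by rewrite scalerA -algM mulVf // !scale1r.
rewrite E scalerN scaler_sumr -sumrN; apply: eq_bigr => i _.
by rewrite scalerA -algM addnC mulNr !scaleNr.
Qed.

End Fitting.

(** Stated through idempotent graded endomorphisms. The zero module satisfies it; being nonzero is a
    separate hypothesis below. *)
Definition indec (B : comNzRingType) (V : lmodType B) (pr : nat -> V -> V) :=
  forall e : {linear V -> V}, (forall v, e (e v) = e v) -> graded_map pr pr e ->
  (forall v, e v = 0) \/ (forall v, e v = v).

Lemma iter_comm (T : Type) (f g : T -> T) : (forall v, f (g v) = g (f v)) ->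
  forall a b v, iter a f (iter b g v) = iter b g (iter a f v).
Proof.
move=> fg; have fgb b v : f (iter b g v) = iter b g (f v).
  by elim: b => //= b IH; rewrite fg IH.
by move=> a b v; elim: a => //= a ->.
Qed.

Lemma projector_graded (B : comNzRingType) (V : lmodType B)
    (pr : nat -> V -> V) (K I : submod V) (e : {linear V -> V}) :
    grading_proj pr -> (forall v, K (v - e v)) -> (forall v, I (e v)) ->
    (forall v, I v -> e v = v) -> (forall v, K v -> e v = 0) ->
    (forall d v, K v -> K (pr d v)) -> (forall d v, I v -> I (pr d v)) ->
  graded_map pr pr e.
Proof.
move=> prP Ke Ie eI eK Kpr Ipr d v.
have -> : v = (v - e v) + e v by rewrite subrK.
rewrite (grprD prP) [LHS]linearD [e (v - _ + _)]linearD.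
rewrite (eK (pr d _)) ?(eI (pr d _)) ?(eK (v - _)) ?(eI (e v)) ?add0r //.
  exact: Ipr.
exact: Kpr.
Qed.

Section FittingLemma.
Variables (F : fieldType) (B : comAlgType F) (V : lmodType B).
Variables (pr : nat -> V -> V) (f : {linear V -> V}).
Hypotheses (prP : grading_proj pr) (prF : fin_pieces pr).
Hypothesis f_gr : graded_map pr pr f.

(** The relation on the piece of degree d reads f^n = f g f^n, where g is the polynomial in f with
    coefficients [c]; so g inverts f on the image of f^n in that piece. *)
Lemma fitting_eventual d : exists n (g : {linear V -> V}),
  (forall v, f (g v) = g (f v)) /\
  forall v, pr d v = v -> f (g (iter n f v)) = iter n f v.
Proof.
have [n [m [c fE]]] := fitting_relation prP prF f_gr d.
have gL : linear (fun v => \sum_(i < m) (c i)%:A *: iter i f v).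
  move=> b u v; rewrite scaler_sumr -big_split; apply: eq_bigr => i _ /=.
  by rewrite iter_lin scalerDr !scalerA mulrC.
have fg v : f (mklin gL v) = mklin gL (f v).
  rewrite /= linear_sum; apply: eq_bigr => i _.
  by rewrite linearZ /= -iterS iterSr.
exists n, (mklin gL); split=> // v vd; rewrite {2}fE //= linear_sum.
apply: eq_bigr => i _; rewrite linearZ /=.
by rewrite -iterD addnC.
Qed.

(** The exponent at which kernels and images stabilize varies with the degree, so the Fitting
    components are the union of all kernels and, in the next lemma, the intersection of all images
    of iterates. *)
Lemma kernel_submodP : exists K : submod V,
  forall v, K v <-> exists n, iter n f v = 0.
Proof.
have iter0 n : iter n f 0 = 0.
  by elim: n => //= n ->; rewrite linear0.
unshelve eexists (@Submod _ _ (fun v => exists n, iter n f v = 0) _ _) => //.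
  by exists 0%N.
move=> b u v [n un] [m vm]; exists (n + m)%N.
by rewrite iter_lin {1}addnC !iterD un vm !iter0 scaler0 addr0.
Qed.

Lemma image_submodP : exists I : submod V,
  forall v, I v <-> forall m, exists y, v = iter m f y.
Proof.
unshelve eexists (@Submod _ _ (fun v => forall m, exists y, v = iter m f y) _ _).
- by move=> m; exists 0; elim: m => //= m <-; rewrite linear0.
- move=> b u v uI vI m; have [x ->] := uI m; have [y ->] := vI m.
  by exists (b *: x + y); rewrite iter_lin.
by [].
Qed.

(** The module is the direct sum of [K], where f is locally nilpotent, and [I], where f is
    bijective. The projector onto [I] along [K] is a graded idempotent, so it is 0 or the
    identity. *)
Lemma fitting_indec : indec pr ->
  (forall v, exists n, iter n f v = 0) \/ bijective f.
Proof.
move=> V_indec; have [K KP] := kernel_submodP; have [I IP] := image_submodP.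
have fg_iter n (g : {linear V -> V}) v (w := iter n f v) :
    (forall v, f (g v) = g (f v)) -> f (g w) = w ->
    forall a, iter a f (iter a g w) = w.
  move=> fg fgw; elim=> //= a IH.
  by rewrite [iter a f (g _)](iter_comm fg a 1) /= IH.
have Kpr d v : K v -> K (pr d v).
  by move=> /KP[n vn]; apply/KP; exists n; rewrite iter_gr // vn grpr0.
have Ipr d v : I v -> I (pr d v).
  move=> /IP vI; apply/IP => m; have [y ->] := vI m.
  by exists (pr d y); rewrite iter_gr.
have KI0 v : K v -> I v -> v = 0.
  move=> Kv Iv; apply: (grpr_eq0 prP) => d.
  have [n [g [fg gP]]] := fitting_eventual d.
  move/IP: (Iv) => /(_ n)[y vE]; have {vE} vE : pr d v = iter n f (pr d y).
    by rewrite vE iter_gr.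
  have /KP[a] := Kpr d v Kv; rewrite vE => va.
  have fgy := fg_iter _ _ _ fg (gP (pr d y) (grpr_id prP d y)).
  rewrite -(fgy a) iter_comm // va.
  by elim: (a) => //= b ->; rewrite linear0.
(* It suffices to split a homogeneous component: g^m f^m of it lies in [I], and the rest is killed
   by f^m. *)
have KID v : exists k, K k /\ I (v - k).
  have [n ->] := grpr_dec prP v.
  elim/big_rec: _ => [|d u _ [k [Kk Ik]]].
    by exists 0; rewrite subr0; split; apply: submod0.
  have [m [g [fg gP]]] := fitting_eventual d.
  have fgw := fg_iter _ _ _ fg (gP (pr d v) (grpr_id prP d v)).
  set w := iter m f (pr d v) in fgw.
  have Iw : I (iter m g w).
    apply/IP => a; exists (iter m g (iter a g w)).
    by rewrite iter_comm // fgw.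
  have Kw : K (pr d v - iter m g w).
    apply/KP; exists m; have := iter_lin f m (-1) (iter m g w) (pr d v).
    by rewrite !scaleN1r addrC fgw => ->; rewrite -/w addNr.
  exists (pr d v - iter m g w + k); split.
    by have := submodP 1 Kw Kk; rewrite scale1r.
  have -> : pr d v + u - (pr d v - iter m g w + k) = 1 *: iter m g w + (u - k).
    by rewrite opprD addrACA subKr scale1r.
  exact: submodP.
have [e [Ke Ie eI eK]] := projector_ex KI0 KID.
have e_id v : e (e v) = e v by apply/eI.
have e_gr := projector_graded prP Ke Ie eI eK Kpr Ipr.
case: (V_indec e e_id e_gr) => eE; [left | right] => [v|].
  by apply/KP; have := Ke v; rewrite eE subr0.
apply: inj_surj_bij => [u v uv | v].
  apply/subr0_eq; rewrite -(eE (u - v)); apply/eK/KP; exists 1%N.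
  by rewrite /= (linearB f) uv subrr.
by have := Ie v; rewrite eE => /IP/(_ 1%N)[y ->]; exists y.
Qed.

End FittingLemma.

Section KrullSchmidt.
Variables (F : fieldType) (B : comAlgType F).

(** The inverse is the geometric series of f, which is a finite sum at each vector. *)
Lemma nilpotent_sub_bij (V : lmodType B) (f : {linear V -> V}) :
  (forall v, exists n, iter n f v = 0) -> bijective (fun v => v - f v).
Proof.
move=> f_nil; apply: inj_surj_bij => [u v uv | v].
  apply/subr0_eq; have [n] := f_nil (u - v).
  have fuv : f (u - v) = u - v.
    apply/eqP; rewrite eq_sym -subr_eq0 linearB opprD opprK addrACA uv.
    by rewrite addrACA subrr addNr addr0.
  suff -> : iter n f (u - v) = u - v by [].
  by elim: n => //= n ->.
have [n fn] := f_nil v; exists (\sum_(i < n) iter i f v).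
rewrite linear_sum -sumrB -(big_mkord xpredT (fun i => iter i f v - f (iter i f v))).
rewrite (eq_bigr (fun i => - (iter i.+1 f v - iter i f v))) => [|i _].
  by rewrite sumrN telescope_sumr //= fn sub0r opprK.
by rewrite opprB.
Qed.

(** The graded endomorphism ring is local. With u the whole sum and h = u^{-1} f_j, Fitting's lemma
    makes h bijective, and then so is f_j = u h, or locally nilpotent, and then u (1 - h), the sum
    of the remaining terms, is bijective. *)
Lemma sum_bijective (V : lmodType B) (pr : nat -> V -> V) (J : Type)
    (s : seq J) (f : J -> {linear V -> V}) :
    grading_proj pr -> fin_pieces pr -> indec pr -> (exists v : V, v != 0) ->
    (forall j, graded_map pr pr (f j)) ->
  bijective (fun v => \sum_(j <- s) f j v) -> exists j, bijective (f j).
Proof.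
move=> prP prF V_indec [v0 v0N] f_gr; elim: s => [|j s IH] u_bij.
  case: u_bij => g gK _; case/eqP: v0N.
    by have := gK v0; have := gK 0; rewrite /= !big_nil => -> ->.
have uL : linear (fun v => \sum_(j <- j :: s) f j v).
  move=> b u v; rewrite scaler_sumr -big_split; apply: eq_bigr => i _.
  by rewrite linearP.
have [g [gK Kg]] := linear_inv (u_bij : bijective (mklin uL)).
have u_gr : graded_map pr pr (mklin uL).
  move=> d v /=; rewrite (grpr_sum prP).
  by apply: eq_bigr => i _; rewrite f_gr.
have g_gr : graded_map pr pr g.
  by move=> d v; apply: (can_inj gK); rewrite u_gr !Kg.
pose h : {linear V -> V} := g \o f j.
have h_gr : graded_map pr pr h by move=> d v; rewrite /= f_gr g_gr.
have [h_nil|h_bij] := fitting_indec prP prF h_gr V_indec; last first.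
  exists j; exact: (eq_bij (bij_comp u_bij h_bij) (fun v => Kg (f j v))).
apply: IH; apply: (eq_bij (bij_comp u_bij (nilpotent_sub_bij h_nil))) => v.
have := (linearB (mklin uL) v (h v)); rewrite {1}/comp.
move=> /= ->; rewrite [X in _ - X](Kg (f j v)).
by rewrite big_cons addrC addKr.
Qed.

(** The identity of V is the sum of the composites b_j a_j, so one of them is bijective. Degree d of
    [M j] sits in degree [s j d] of V; the composites respect the grading of V because the other
    degrees never meet [M j]. *)
Lemma krull_schmidt (V : lmodType B) (pr : nat -> V -> V) (J : finType)
    (M : J -> lmodType B) (prM : forall j, nat -> M j -> M j)
    (s : J -> nat -> nat)
    (a : forall j, {linear V -> M j}) (b : forall j, {linear M j -> V}) :
    grading_proj pr -> fin_pieces pr -> indec pr -> (exists v : V, v != 0) ->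
    (forall j, grading_proj (@prM j)) ->
    (forall j, indec (@prM j)) ->
    (forall j, injective (s j)) ->
    (forall j d v, prM j d (a j v) = a j (pr (s j d) v)) ->
    (forall j d v, b j (prM j d v) = pr (s j d) (b j v)) ->
    (forall v, \sum_j b j (a j v) = v) ->
  exists j, bijective (b j).
Proof.
move=> prP prF V_indec V_n0 prMP M_indec sI a_gr b_gr ba.
have ba_gr j : graded_map pr pr (b j \o a j).
  have out d : (forall e, s j e != d) ->
      (forall v, pr d (b j v) = 0) /\ (forall v, a j (pr d v) = 0).
    move=> ne_d; split=> v.
      have [n ->] := grpr_dec (prMP j) v; rewrite linear_sum (grpr_sum prP) big1 // => i _.
      by rewrite b_gr (grprE prP) eq_sym (negbTE (ne_d i)).
    apply: (grpr_eq0 (prMP j)) => e.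
    by rewrite a_gr (grprE prP) (negbTE (ne_d e)) linear0.
  move=> d v /=; have [[e <-]|/forallNP ne_d] := EM (exists e, s j e = d).
    by rewrite -a_gr b_gr.
  have {}ne_d e : s j e != d by apply/eqP/ne_d.
  by have [-> ->] := out d ne_d; rewrite linear0.
have [|j baj] := @sum_bijective V pr J (index_enum J) (fun j => b j \o a j)
  prP prF V_indec V_n0 ba_gr.
  by exists id => v; rewrite -[RHS]ba.
exists j; have [g [gK Kg]] := linear_inv baj.
(* With g the inverse of b_j a_j, the map a_j g b_j is an idempotent of the indecomposable [M j]. It
   is not 0 because V is not, so it is the identity and a_j g inverts b_j. *)
pose e : {linear M j -> M j} := a j \o (g \o b j).
have bg v : b j (a j (g v)) = v by exact: Kg.
have e_id v : e (e v) = e v by rewrite /= bg.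
have g_gr : graded_map pr pr g.
  by move=> d v; apply: (can_inj gK); have := ba_gr j d (g v); rewrite /= !bg.
have e_gr : graded_map (@prM j) (@prM j) e.
  by move=> d v /=; rewrite b_gr g_gr a_gr.
case: (M_indec j e e_id e_gr) => eE.
  case: V_n0 => v /eqP[]; have := eE (a j v); rewrite /= [g _]gK => av.
  by rewrite -(gK v) /= av linear0 linear0.
exists (a j \o g) => v /=; first exact: eE.
exact: bg.
Qed.

End KrullSchmidt.

(** * Decomposition into indecomposable graded summands *)

Section IndecomposableDecomposition.
Variables (F : fieldType) (B : comAlgType F) (V : lmodType B).
Variable pr : nat -> V -> V.
Hypotheses (prP : grading_proj pr) (prF : fin_pieces pr).

(** Generation in degrees at most D is recorded through its effect on endomorphisms, which is the
    form that the bound on idempotents uses. *)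
Definition generated_upto (D : nat) : Prop := forall f : {linear V -> V},
  (forall m v, (m <= D)%N -> f (pr m v) = 0) -> forall v, f v = 0.

Definition idempotent_system (I : finType) (e : I -> {linear V -> V}) : Prop :=
  [/\ forall i, graded_map pr pr (e i),
      forall i j v, e i (e j v) = if i == j then e i v else 0,
      forall v, \sum_i e i v = v
    & forall i, exists v, e i v != 0].

Lemma fspan_upto D : exists s : seq V, forall m v, (m <= D)%N -> fspan s (pr m v).
Proof.
elim: D => [|D [s IH]].
  by have [s [_ sP]] := prF 0; exists s => m v; rewrite leqn0 => /eqP->.
have [t [_ tP]] := prF D.+1; exists (s ++ t) => m v.
have catP r w : {subset r <= s ++ t} -> fspan r w -> fspan (s ++ t) w.
  by move=> sub_r rw; apply: fspan_sub rw _ => u /sub_r; exact: fspan_mem.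
rewrite leq_eqVlt => /predU1P[->|lt_m].
  by apply: catP (tP _) => u; rewrite mem_cat orbC => ->.
by apply: catP (IH _ _ lt_m) => u; rewrite mem_cat => ->.
Qed.

(** Each e_i is nonzero on some element of degree at most D. The resulting images are linearly
    independent by orthogonality, and they lie in the finite-dimensional span of the pieces of
    degree at most D. *)
Lemma idempotent_system_bound D : generated_upto D ->
  exists K, forall I e, @idempotent_system I e -> (#|I| <= K)%N.
Proof.
move=> genD; have [s sP] := fspan_upto D; exists (size s) => I e [e_gr eM _ e_n0].
rewrite leqNgt; apply/negP => lt_s.
have /choice[w wP] : forall i, exists w, fspan s (e i w) /\ e i (e i w) != 0.
  move=> i; apply/not_existsP => w0; have [v /eqP[]] := e_n0 i.
  apply: genD => m u le_m; apply/eqP/negPn/negP => eu.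
  apply: (w0 (pr m u)); split; last by rewrite eM eqxx.
  by rewrite e_gr; apply: sP.
have [|u [i ui] u0] := @fspan_dep _ _ _ s #|I|
  (fun k => e (enum_val k) (w (enum_val k))) lt_s.
  by move=> k; case: (wP (enum_val k)).
have := congr1 (e (enum_val i)) u0; rewrite linear_sum linear0 (bigD1 i) //=.
rewrite big1 ?addr0 => [|j ne_j]; last first.
  rewrite linearZ /= eM ifN ?scaler0 //.
  by apply: contraNneq ne_j => /enum_val_inj ->.
rewrite linearZ /= => /(congr1 (fun v => (u i)^-1%:A *: v)).
rewrite scalerA -algM mulVf // scaler0 !scale1r => /eqP; apply/negP.
by case: (wP (enum_val i)).
Qed.

Lemma max_idempotent_system D : generated_upto D ->
  exists I e, @idempotent_system I e /\
    forall I' e', @idempotent_system I' e' -> (#|I'| <= #|I|)%N.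
Proof.
move=> genD; have [K KP] := idempotent_system_bound genD.
pose Q n := `[< exists I e, @idempotent_system I e /\ #|I| = n >].
have exQ : exists n, Q n.
  have [V0|/existsNP[v0 v0N]] := EM (forall v : V, v = 0).
    exists 0%N; apply/asboolP; exists void, (fun i : void => match i return {linear V -> V} with end).
    split; last exact: card_void.
    by split=> [[]|[]|v|[]]; rewrite [RHS]V0 [LHS]V0.
  exists 1%N; apply/asboolP; exists unit, (fun=> idfun).
  split; last exact: card_unit.
  split=> [||v|i] //.
    by rewrite (bigD1 tt) //= big1 ?addr0 // => -[].
  by exists v0; apply/eqP.
have QK n : Q n -> (n <= K)%N by move=> /asboolP[I [e [/KP leK <-]]].
case: (ex_maxnP exQ QK) => n /asboolP[I [e [eP <-]]] maxn; exists I, e.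
by split=> // I' e' e'P; apply: maxn; apply/asboolP; exists I', e'.
Qed.

(** The part e' keeps the index i and e'' takes the new one; the system grows by one element, which
    contradicts maximality later. *)
Lemma split_idempotent_system (I : finType) e (i : I) (e' e'' : {linear V -> V}) :
    @idempotent_system I e -> graded_map pr pr e' -> graded_map pr pr e'' ->
    (forall v, e' v + e'' v = e i v) ->
    (forall v, e' (e' v) = e' v) -> (forall v, e'' (e'' v) = e'' v) ->
    (forall v, e' (e'' v) = 0) -> (forall v, e'' (e' v) = 0) ->
    (exists v, e' v != 0) -> (exists v, e'' v != 0) ->
  exists f, @idempotent_system (I + unit)%type f.
Proof.
move=> [e_gr eM e1 e_n0] gr' gr'' eD id' id'' e'e'' e''e' n0' n0''.
pose f (k : I + unit) := if k is inl j then if j == i then e' else e j else e''.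
have e'i v : e' (e i v) = e' v by rewrite -eD linearD /= id' e'e'' addr0.
have e''i v : e'' (e i v) = e'' v by rewrite -eD linearD /= id'' e''e' add0r.
have ie' v : e i (e' v) = e' v by rewrite -eD id' e''e' addr0.
have ie'' v : e i (e'' v) = e'' v by rewrite -eD id'' e'e'' add0r.
exists f; split.
- by move=> [j|[]] //=; case: ifP.
- have ne0 j v : j != i -> e j (e i v) = 0 by move=> ne_j; rewrite eM ifN.
  have ne0' j v : j != i -> e i (e j v) = 0.
    by move=> ne_j; rewrite eM ifN // eq_sym.
  have inlE (j k : I) : (inl j == inl k :> I + unit) = (j == k) by [].
  move=> [j|[]] [k|[]] v //=; rewrite ?inlE.
  + case: (eqVneq j i) => [->|ne_j].
      by case: (eqVneq k i) => [_|ne_k]; rewrite ?id' // -e'i ne0' ?linear0.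
    case: (eqVneq k i) => [->|ne_k]; last by rewrite eM.
    by rewrite (negbTE ne_j) -ie' ne0.
  + by case: eqVneq => [//|ne_j]; rewrite -ie'' ne0.
  + by case: eqVneq => [//|ne_j]; rewrite -e''i ne0' ?linear0.
- move=> v; rewrite -[RHS]e1 big_sumType /=.
  rewrite [X in _ + X](bigD1 tt) //= [X in _ + (_ + X)]big1 ?addr0; last by case.
  rewrite (bigD1 i) //= [RHS](bigD1 i) //= eqxx addrAC eD; congr (_ + _).
  by apply: eq_bigr => j /negbTE ->.
by move=> [j|[]] //=; case: ifP.
Qed.

(** The summands are the images of a complete system of orthogonal idempotents of maximal size: a
    nontrivial idempotent on one of them would refine the system. *)
Lemma indec_decomposition D : generated_upto D ->
  exists (I : finType) (M : I -> lmodType B) (prM : forall i, nat -> M i -> M i)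
    (a : forall i, {linear V -> M i}) (b : forall i, {linear M i -> V}),
    [/\ forall i, grading_proj (@prM i), forall i, indec (@prM i),
        forall i, graded_map pr (@prM i) (a i),
        forall i, graded_map (@prM i) pr (b i)
      & forall v, \sum_i b i (a i v) = v].
Proof.
move=> genD; have [I [e [eP maxI]]] := max_idempotent_system genD.
have [e_gr eM e1 e_n0] := eP.
have e_id i v : e i (e i v) = e i v by rewrite eM eqxx.
have /choice[N NP] : forall i, exists N : submod V, forall v, N v <-> e i v = v.
  move=> i; unshelve eexists (@Submod _ _ (fun v => e i v = v) _ _) => //.
    by rewrite /= linear0.
  by move=> /= b u v uE vE; rewrite linearP uE vE.
pose M i : lmodType B := submod_type (N i).
have aP i : exists g : {linear V -> M i}, forall v, val (g v) = e i v.
  by apply: submod_lift => v; apply/NP/e_id.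
pose a i := projT1 (cid (aP i)).
have aE i v : val (a i v) = e i v := projT2 (cid (aP i)) v.
pose b i := projT1 (cid (submod_inj (N i))).
have bE i u : b i u = val u := projT2 (cid (submod_inj (N i))) u.
have valN i (u : M i) : e i (val u) = val u by apply/NP/submod_valP.
have ab i (u : M i) : a i (b i u) = u by apply: val_inj; rewrite aE bE valN.
pose prM i d (u : M i) : M i := a i (pr d (val u)).
have prME i d (u : M i) : val (prM i d u) = pr d (val u).
  by rewrite aE e_gr valN.
exists I, M, prM, a, b; split.
- move=> i; split.
  + move=> d u v; apply: val_inj; rewrite prME -[val (u - v)]/(val u - val v).
    by rewrite -[RHS]/(val (prM i d u) - val (prM i d v)) !prME (grprB prP).
  + move=> d k u; apply: val_inj; rewrite !prME (grprE prP).
    by case: ifP => _; rewrite ?prME // raddf0.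
  + move=> u; have [n uE] := grpr_dec prP (val u); exists n; apply: val_inj.
    rewrite -[RHS]bE linear_sum [LHS]uE; apply: eq_bigr => d _.
    by rewrite bE prME.
- move=> i f f_id f_gr.
  (* An idempotent of the i-th image extends by 0 to e' on V, and e_i = e' + e'' with orthogonal e'
     and e''. *)
  pose e' : {linear V -> V} := b i \o (f \o a i).
  have e''L : linear (fun v => e i v - e' v).
    by move=> c u v; rewrite (linearP (e i)) (linearP e') opprD addrACA -scalerBr.
  pose e'' := mklin e''L.
  have e'_id v : e' (e' v) = e' v by rewrite /= ab f_id.
  have ee' v : e i (e' v) = e' v by rewrite /= bE valN.
  have e'e v : e' (e i v) = e' v.
    by rewrite /=; congr (b i (f _)); apply: val_inj; rewrite !aE e_id.
  have e'_gr : graded_map pr pr e'.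
    have a_gr d v : a i (pr d v) = prM i d (a i v).
      by apply: val_inj; rewrite prME !aE e_gr.
    by move=> d v; rewrite /= a_gr f_gr bE prME -bE.
  have e''_gr : graded_map pr pr e''.
    by move=> d v; rewrite /= (grprB prP) e_gr -[b i _]/(e' _) e'_gr.
  have [e'0|/existsNP[v e'n0]] := EM (forall v, e' v = 0).
    left=> u; have := e'0 (b i u); rewrite /= ab => /(congr1 (a i)).
    by rewrite ab linear0.
  have [e''0|/existsNP[w e''n0]] := EM (forall v, e'' v = 0).
    right=> u; have := e''0 (b i u); rewrite /= ab bE valN => /subr0_eq.
    by rewrite bE => /val_inj.
  suff [g /maxI] : exists g, @idempotent_system (I + unit)%type g.
    by rewrite card_sum card_unit addn1 ltnn.
  have e''E u : e'' u = e i u - e' u by [].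
  have e'e'' u : e' (e'' u) = 0 by rewrite e''E (linearB e') e'e e'_id subrr.
  have e''e' u : e'' (e' u) = 0 by rewrite e''E ee' e'_id subrr.
  have e''_id u : e'' (e'' u) = e'' u.
    by rewrite [LHS]e''E e'e'' subr0 e''E (linearB (e i)) e_id ee'.
  have e_split u : e' u + e'' u = e i u by rewrite e''E addrC subrK.
  exact: (split_idempotent_system eP e'_gr e''_gr e_split e'_id e''_id e'e''
    e''e' (ex_intro _ v (introN eqP e'n0)) (ex_intro _ w (introN eqP e''n0))).
- by move=> i d v; apply: val_inj; rewrite prME !aE e_gr.
- by move=> i d v; rewrite !bE prME.
- by move=> v; rewrite -[RHS]e1; apply: eq_bigr => i _; rewrite bE aE.
Qed.

End IndecomposableDecomposition.

(** * A criterion for FFRT *)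

Section GradingProjectors.
Variables (F : fieldType) (B : comAlgType F) (G : grading B).

Definition gproj (d : nat) : {linear B -> B} := projT1 (cid (gproj_exists G d)).

Lemma gprojE d e a : G e a -> gproj d a = if e == d then a else 0.
Proof. exact: projT2 (cid (gproj_exists G d)) e a. Qed.

Lemma gproj_dec b : exists n, b = \sum_(d < n) gproj d b.
Proof.
have [n [h [Gh bE]]] := piece_sum G b; exists n.
rewrite {1}bE; apply: eq_bigr => d _; rewrite bE linear_sum (bigD1 d) //=.
rewrite (gprojE _ (Gh d)) eqxx big1 ?addr0 // => i ne_i.
by rewrite (gprojE _ (Gh i)) (inj_eq val_inj) (negbTE ne_i).
Qed.

Lemma gproj_piece d b : G d (gproj d b).
Proof.
have [n [h [Gh ->]]] := piece_sum G b; rewrite linear_sum.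
apply: piece_sum_closed => i; rewrite (gprojE _ (Gh i)).
by case: eqP => [<-//|_]; exact: piece0.
Qed.

Lemma gproj_id d b : G d b -> gproj d b = b.
Proof. by move=> Gb; rewrite (gprojE _ Gb) eqxx. Qed.

Lemma gproj_grading : grading_proj (fun d => gproj d).
Proof.
split=> [d u v|d e v|v]; first exact: linearB; last exact: gproj_dec.
by rewrite (gprojE _ (gproj_piece e v)) eq_sym.
Qed.

Lemma gproj_mull d k (r s : B) : G d r -> gproj (d + k) (r * s) = r * gproj k s.
Proof.
move=> Gr; have [n ->] := gproj_dec s.
rewrite mulr_sumr !linear_sum mulr_sumr; apply: eq_bigr => i _.
have Gs := gproj_piece i s.
rewrite (gprojE _ (pieceM Gr Gs)) (gprojE _ Gs) eqn_add2l.
by case: ifP; rewrite ?mulr0.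
Qed.

End GradingProjectors.

(** An alias of [C] that carries the action of B through [iota]. It serves for B^{1/q}, for A^{1/p}
    over R and for A^{1/p}[u, v] over the Segre product. *)
Definition root_mod (B C : comNzRingType) (iota : {rmorphism B -> C}) : Type := C.

Section RootModule.
Variables (B C : comNzRingType) (iota : {rmorphism B -> C}).
Local Notation V := (root_mod iota).

HB.instance Definition _ := GRing.Zmodule.copy V C.

Definition root_scale (b : B) (c : V) : V := iota b * (c : C).

Lemma root_scaleA a b c : root_scale a (root_scale b c) = root_scale (a * b) c.
Proof. by rewrite /root_scale rmorphM mulrA. Qed.

Lemma root_scale1 : left_id 1 root_scale.
Proof. by move=> c; rewrite /root_scale rmorph1 mul1r. Qed.

Lemma root_scaleDr : right_distributive root_scale +%R.
Proof. by move=> b c c'; rewrite /root_scale mulrDr. Qed.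

Lemma root_scaleDl c : {morph root_scale^~ c : a b / a + b}.
Proof. by move=> a b; rewrite /root_scale rmorphD mulrDl. Qed.

HB.instance Definition _ := GRing.Zmodule_isLmodule.Build B V
  root_scaleA root_scale1 root_scaleDr root_scaleDl.

End RootModule.

Section RootRing.
Variables (B C : comNzRingType) (iota : {rmorphism B -> C}) (p e : nat).
Hypotheses (pB : p \in [pchar B]) (rootC : is_root_ring (p ^ e) iota).
Local Notation q := (p ^ e)%N.

(** The map f sends c to the element of B whose image is c^q; it is additive because q is a power of
    the characteristic. It identifies B^{1/q} with B on which b acts as b^q. *)
Lemma root_ring_iso : exists f : C -> B, exists g : B -> C,
  [/\ cancel f g, cancel g f, forall c, iota (f c) = c ^+ q
    & forall b c c', f (iota b * c + c') = b ^+ q * f c + f c'].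
Proof.
have [iotaI iotaq iota_root] := rootC.
have pC : p \in [pchar C] by have := rmorph_pchar iota pB; exact.
have qC : [pchar C].-nat q by rewrite pnatX (pnatE _ (pcharf_prime pC)) pC.
have [f fE] := choice iotaq.
have /choice[g gE] : forall b, exists c, c ^+ q = iota b.
  by move=> b; have [c [cE _]] := iota_root b; exists c.
have fI : injective f.
  move=> c c' ff; have [d [_ dU]] := iota_root (f c).
  by rewrite -(dU c) ?fE // -(dU c') // ff fE.
have gK : cancel g f by move=> b; apply: iotaI; rewrite fE gE.
exists f, g; split=> // [c|b c c']; first by apply: fI; rewrite gK.
apply: iotaI; rewrite fE exprDn_pchar // exprMn rmorphD rmorphM rmorphXn.
by rewrite !fE.
Qed.

End RootRing.

Section Criterion.
Variables (F : fieldType) (B : comAlgType F) (G : grading B) (p : nat).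
Variables (P : lmodType B) (pr : nat -> P -> P).
Hypotheses (prP : grading_proj pr) (prF : fin_pieces pr).

(* B, as a module over itself through the q-th power map, is a finite sum of
   copies of direct summands of P: the composites mu_i \o pi_i have sum 1. *)
Definition frobenius_split (q : nat) : Prop :=
  exists (I : finType) (s : I -> nat) (mu : I -> P -> B) (pi : I -> B -> P),
  [/\ forall i b x y, mu i (b *: x + y) = b ^+ q * mu i x + mu i y,
      forall i b c c', pi i (b ^+ q * c + c') = b *: pi i c + pi i c',
      forall b, \sum_i mu i (pi i b) = b,
      forall i m x, G (q * m + s i)%N (mu i (pr m x))
    & forall i d m b, G d b ->
        pr m (pi i b) = if d == (q * m + s i)%N then pi i b else 0].

Section Summand.
Variables (e : nat) (C : comNzRingType) (iota : {rmorphism B -> C}).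
Hypotheses (pB : p \in [pchar B]) (rootC : is_root_ring (p ^ e) iota).
Local Notation q := (p ^ e)%N.
Variables (f : C -> B) (g : B -> C).
Hypotheses (fK : cancel f g) (gK : cancel g f).
Hypothesis fE : forall c, iota (f c) = c ^+ q.
Hypothesis fP : forall b c c', f (iota b * c + c') = b ^+ q * f c + f c'.
Local Notation V := (root_mod iota).

Lemma root_pieceE d c : root_piece G q iota d c <-> G d (f c).
Proof.
split=> [[b Gb bE]|Gc]; last by exists (f c); rewrite ?fE.
suff -> : f c = b by [].
by case: rootC => iotaI _ _; apply: iotaI; rewrite fE.
Qed.

Lemma fD c c' : f (c + c') = f c + f c'.
Proof. by have := fP 1 c c'; rewrite rmorph1 expr1n !mul1r. Qed.

Lemma f0 : f 0 = 0.
Proof. by apply: (addIr (f 0)); rewrite -fD !add0r. Qed.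

Lemma fB c c' : f (c - c') = f c - f c'.
Proof. by apply: (addIr (f c')); rewrite -fD !subrK. Qed.

Lemma f_sum (I : Type) (r : seq I) (h : I -> C) :
  f (\sum_(i <- r) h i) = \sum_(i <- r) f (h i).
Proof. exact: (big_morph f fD f0). Qed.

Definition root_proj d (c : V) : V := g (gproj G d (f c)).

Lemma root_projE d c : f (root_proj d c) = gproj G d (f c).
Proof. by rewrite /root_proj gK. Qed.

Lemma root_proj_grading : grading_proj root_proj.
Proof.
split=> [d u v|d k v|v].
- by apply: (can_inj fK); rewrite fB !root_projE fB linearB.
- apply: (can_inj fK); rewrite root_projE; case: ifP => dk.
    by rewrite !root_projE (grprE (gproj_grading G)) dk.
  by rewrite f0 root_projE (grprE (gproj_grading G)) dk.
- have [n vE] := gproj_dec G (f v); exists n; apply: (can_inj fK).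
  by rewrite vE f_sum; apply: eq_bigr => d _; rewrite root_projE.
Qed.

Lemma root_piece_proj d c : root_piece G q iota d c -> root_proj d c = c.
Proof. by move/root_pieceE => Gc; apply: (can_inj fK); rewrite root_projE gproj_id. Qed.

Lemma root_proj_piece d c : root_piece G q iota d (root_proj d c).
Proof. by apply/root_pieceE; rewrite root_projE; exact: gproj_piece. Qed.

Lemma graded_submodule_proj (N : set C) : is_graded_submodule G q iota N ->
  forall d c, N c -> N (root_proj d c).
Proof.
move=> [N0 _ _ Ngr] d c /Ngr[n [h [hd Nh ->]]].
have prV := root_proj_grading; rewrite (grpr_sum prV).
have [lt_d|le_n] := ltnP d n; last first.
  rewrite big1 // => i _; rewrite -(root_piece_proj (hd i)) (grprE prV).
  by rewrite gtn_eqF // (leq_trans (ltn_ord i)).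
rewrite (bigD1 (Ordinal lt_d)) //= root_piece_proj // big1 ?addr0 // => i ne_i.
rewrite -(root_piece_proj (hd i)) (grprE prV); case: eqP => // di.
by case/eqP: ne_i; apply: val_inj.
Qed.

Lemma graded_submoduleP (N : set C) : is_graded_submodule G q iota N <->
  exists N' : submod V, (forall c, N' c <-> N c) /\
    forall d c, N c -> N (root_proj d c).
Proof.
split=> [NP|[N' [NE Npr]]].
  have [N0 ND NZ _] := NP.
  unshelve eexists (@Submod _ V N N0 _); first by move=> b u v Nu Nv; apply/ND/Nv/NZ.
  by split=> //; exact: graded_submodule_proj.
split; first by apply/NE/submod0.
- move=> c c' /NE Nc /NE Nc'; apply/NE.
  by have := submodP 1 Nc Nc'; rewrite scale1r.
- move=> b c /NE Nc; apply/NE.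
  by have := submodP b Nc (submod0 N'); rewrite addr0.
move=> c Nc; have [n cE] := grpr_dec root_proj_grading c.
exists n, (fun d => root_proj d c).
by split=> // d; [exact: root_proj_piece | exact: Npr].
Qed.

End Summand.
End Criterion.

Section Criterion.
Variables (F : fieldType) (B : comAlgType F) (G : grading B) (p : nat).

Section Summand.
Variables (e : nat) (C : comNzRingType) (iota : {rmorphism B -> C}).
Hypothesis rootC : is_root_ring (p ^ e) iota.
Local Notation q := (p ^ e)%N.
Variables (f : C -> B) (g : B -> C).
Hypotheses (fK : cancel f g) (gK : cancel g f).
Hypothesis fE : forall c, iota (f c) = c ^+ q.
Hypothesis fP : forall b c c', f (iota b * c + c') = b ^+ q * f c + f c'.
Local Notation V := (root_mod iota).
Local Notation prV := (@root_proj F B G C iota f g).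

Lemma gP b c c' : g (b ^+ q * c + c') = iota b * g c + g c'.
Proof. by apply: (can_inj fK); rewrite fP !gK. Qed.

(** Indecomposability in terms of submodules yields it in terms of idempotents: the fixed points and
    the kernel of an idempotent are complementary graded submodules of N. *)
Lemma indec_submod_type (N : set C) (Ns : submod V) (rho : {linear V -> submod_type Ns}) :
    (forall c, Ns c <-> N c) -> (forall u, rho (val u) = u) ->
    (forall d c, N c -> N (prV d c)) ->
    is_indecomposable G q iota N ->
  indec (fun d (u : submod_type Ns) => rho (prV d (val u))).
Proof.
move=> NE rhoK Npr [Ngr N_n0 N_indec] h h_id h_gr.
have prVP := root_proj_grading G fK gK fP.
have valN (u : submod_type Ns) : N (val u) by apply/NE; exact: submod_valP.
have val_rho c : N c -> val (rho c) = c.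
  by move=> /NE Nc; rewrite -[c]/(val (submod_in Nc)) rhoK.
have sub (S : submod_type Ns -> Prop) : S 0 ->
    (forall b u v, S u -> S v -> S (b *: u + v)) ->
    (forall d u, S u -> S (rho (prV d (val u)))) ->
    is_graded_submodule G q iota (fun c => N c /\ S (rho c)).
  move=> S0 SP Sgr; apply/(graded_submoduleP G rootC fK gK fE fP).
  have [N0 ND NZ _] := Ngr.
  unshelve eexists (@Submod _ V (fun c => N c /\ S (rho c)) _ _).
  - by split=> //; rewrite linear0.
  - move=> b c c' [Nc Sc] [Nc' Sc']; split; first exact/ND/Nc'/NZ.
    by rewrite linearP; exact: SP.
  split=> // d c [Nc Sc]; split; first exact: Npr.
  by have := Sgr d _ Sc; rewrite val_rho.
pose S1 u := h u = u; pose S2 u := h u = 0.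
have gr1 : is_graded_submodule G q iota (fun c => N c /\ S1 (rho c)).
  apply: sub => [|b u v|d u]; rewrite /S1 ?linear0 //.
    by rewrite linearP => -> ->.
  by move=> uE; rewrite h_gr uE.
have gr2 : is_graded_submodule G q iota (fun c => N c /\ S2 (rho c)).
  apply: sub => [|b u v|d u]; rewrite /S2 ?linear0 //.
    by rewrite linearP => -> ->; rewrite scaler0 addr0.
  by move=> uE; rewrite h_gr uE -[val 0]/(0 : V) (grpr0 prVP) linear0.
have [|z|z] := N_indec (fun c => N c /\ S1 (rho c)) (fun c => N c /\ S2 (rho c)).
- split; [exact: gr1 | exact: gr2 | |].
    move=> c [Nc c1] [_ c2]; have : rho c = 0 by rewrite -c1.
    by move=> /(congr1 val); rewrite val_rho.
  move=> c; split=> [Nc | [c1 [c2 [[N1 _] [N2 _] ->]]]]; last first.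
    by case: Ngr => _ ND _ _; apply: ND.
  exists (val (h (rho c))), (val (rho c - h (rho c))).
  split; last by rewrite -[val (_ - _)]/(val (rho c) - val (h (rho c))) val_rho // addrC subrK.
  - by split=> //; rewrite rhoK; apply: h_id.
  - by split=> //; rewrite /S2 rhoK linearB h_id subrr.
- left=> u; apply: val_inj; rewrite (z (val (h u))) //.
  by split=> //; rewrite /S1 rhoK h_id.
right=> u; have u0 : val (u - h u) = 0.
  by apply: z; split=> //; rewrite /S2 rhoK linearB h_id subrr.
by apply/esym/subr0_eq/val_inj.
Qed.

Section Split.
Variables (P : lmodType B) (pr : nat -> P -> P).
Hypotheses (prP : grading_proj pr) (prF : fin_pieces pr) (q_gt0 : (0 < q)%N).

Variables (I : finType) (s : I -> nat) (mu : I -> P -> B) (pi : I -> B -> P).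
Hypothesis muP : forall i b x y, mu i (b *: x + y) = b ^+ q * mu i x + mu i y.
Hypothesis piP : forall i b c c', pi i (b ^+ q * c + c') = b *: pi i c + pi i c'.
Hypothesis mupi : forall b, \sum_i mu i (pi i b) = b.
Hypothesis mu_gr : forall i m x, G (q * m + s i)%N (mu i (pr m x)).
Hypothesis pi_gr : forall i d m b, G d b ->
  pr m (pi i b) = if d == (q * m + s i)%N then pi i b else 0.

Lemma split_shift_inj i : injective (fun m => (q * m + s i)%N).
Proof. move=> m n /= /eqP; rewrite eqn_add2r. by rewrite eqn_pmul2l // => /eqP. Qed.

Lemma pi0 i : pi i 0 = 0.
Proof. by have := piP i (-1) 0 0; rewrite mulr0 addr0 scaleN1r addNr. Qed.

Lemma pi_proj i m b : pr m (pi i b) = pi i (gproj G (q * m + s i) b).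
Proof.
have piD x y : pi i (x + y) = pi i x + pi i y.
  by have := piP i 1 x y; rewrite expr1n mul1r scale1r.
have [n ->] := gproj_dec G b.
rewrite linear_sum !(big_morph (pi i) piD (pi0 i)) (grpr_sum prP).
apply: eq_bigr => d _; have Gd := gproj_piece G d b.
by rewrite (pi_gr _ _ Gd) (gprojE _ Gd); case: ifP; rewrite ?pi0.
Qed.

Lemma muD i u w : mu i (u + w) = mu i u + mu i w.
Proof. by have := muP i 1 u w; rewrite expr1n mul1r scale1r. Qed.

Lemma mu0 i : mu i 0 = 0.
Proof. by apply: (addIr (mu i 0)); rewrite -muD !add0r. Qed.

Lemma mu_proj i m x : mu i (pr m x) = gproj G (q * m + s i) (mu i x).
Proof.
have [n ->] := grpr_dec prP x.
rewrite (grpr_sum prP) !(big_morph (mu i) (@muD i) (mu0 i)) linear_sum.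
apply: eq_bigr => d _; rewrite (grprE prP) (gprojE _ (mu_gr i d x)).
rewrite (inj_eq (split_shift_inj (i := i))).
by case: eqVneq => // _; rewrite mu0.
Qed.

Section Retract.
Variables (N : set C) (Ns : submod V).
Variables (rho : {linear V -> submod_type Ns}) (E : {linear V -> V}).
Hypotheses (rhoK : forall u, rho (val u) = u) (rhoE : forall c, val (rho c) = E c).
Hypothesis E_gr : graded_map prV prV E.
Local Notation prN := (fun d (u : submod_type Ns) => rho (prV d (val u))).

Lemma val_prN d u : val (prN d u) = prV d (val u).
Proof. by rewrite rhoE E_gr -rhoE rhoK. Qed.

Lemma prN_rho d c : prN d (rho c) = rho (prV d c).
Proof. by apply: val_inj; rewrite val_prN !rhoE E_gr. Qed.

Lemma prN_grading : grading_proj prN.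
Proof.
have prVP := root_proj_grading G fK gK fP.
split=> [d u v|d k u|u].
- by rewrite -[val (u - v)]/(val u - val v) (grprB prVP) linearB.
- by apply: val_inj; rewrite !val_prN (grprE prVP); case: ifP; rewrite ?val_prN.
have [n uE] := grpr_dec prVP (val u); exists n.
by rewrite -[LHS]rhoK {1}uE linear_sum.
Qed.

(** N is a retract of finitely many shifted copies of P, so its piece of degree d is spanned by the
    images of the spanning lists of one piece in each copy. *)
Lemma prN_fin : fin_pieces prN.
Proof.
have prVP := root_proj_grading G fK gK fP.
have /choice[S SP] := prF.
(* Only degree [m i] of the i-th copy can land in degree d. Subtraction and division are truncated,
   so the filter on d below discards the copies that miss d. *)
move=> d; pose m i := ((d - s i) %/ q)%N.
pose im i x := rho (g (mu i x)).
have imP i b x y : im i (b *: x + y) = b *: im i x + im i y.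
  by rewrite /im muP gP -[iota b * _ + _]/(b *: (g (mu i x) : V) + g (mu i y)) linearP.
pose L := flatten [seq [seq im i x | x <- S (m i)] | i <- enum I & d == (q * m i + s i)%N].
exists L; split=> [v|v].
  case/flattenP=> t /mapP[i]; rewrite mem_filter => /andP[/eqP dE _] -> /mapP[x xS ->].
  rewrite prN_rho; congr (rho _); apply: (can_inj fK).
  rewrite root_projE // gK gproj_id // dE -((SP (m i)).1 x xS).
  exact: mu_gr.
set c := prV d (val v).
have -> : rho c = \sum_i im i (pi i (f c)).
  rewrite -[in LHS](fK c) -[in LHS](mupi (f c)).
  rewrite (big_morph g (id1 := 0) (op1 := +%R)) ?linear_sum // => [x y|].
    by have := gP 1 x y; rewrite expr1n rmorph1 !mul1r.
  by apply: (can_inj fK); rewrite gK (f0 fP).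
apply: fspan_sum => i; case: (eqVneq d (q * m i + s i)%N) => [dE|ne_d].
  have xE : pi i (f c) = pr (m i) (pi i (f c)).
    by rewrite pi_proj -dE /c root_projE // (gproj_id (gproj_piece G d _)).
  have := fspan_map (fun a => imP i a%:A) ((SP (m i)).2 (pi i (f c))).
  rewrite -xE => /fspan_sub; apply=> u uS; apply: fspan_mem.
  apply/flattenP; exists [seq im i x | x <- S (m i)] => //.
  by apply/mapP; exists i; rewrite // mem_filter -dE eqxx mem_enum.
(* Any k with d = q k + s i would have to be [m i], so no component of this element survives. *)
suff -> : pi i (f c) = 0.
  have := imP i (-1) 0 0; rewrite scaler0 addr0 scaleN1r addNr => ->.
  exact: fspan0.
apply: (grpr_eq0 prP) => k; rewrite pi_proj /c root_projE //.
rewrite (grprE (gproj_grading G)); case: eqP => [kE|_]; last first.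
  exact: pi0.
by case/eqP: ne_d; rewrite /m -kE addnK mulKn.
Qed.

End Retract.
(** N is a retract of B^{1/q}, which is a retract of shifted copies of P, which is the sum of the
    [M j]. Composing gives a decomposition of the identity of N indexed by [I * J], to which
    Krull-Schmidt applies. *)
Lemma summand_iso (J : finType) (M : J -> lmodType B)
    (prM : forall j, nat -> M j -> M j)
    (a : forall j, {linear P -> M j}) (b : forall j, {linear M j -> P})
    (N : set C) :
    (forall j, grading_proj (@prM j)) -> (forall j, indec (@prM j)) ->
    (forall j, graded_map pr (@prM j) (a j)) ->
    (forall j, graded_map (@prM j) pr (b j)) ->
    (forall v, \sum_j b j (a j v) = v) ->
    is_summand G q iota N -> is_indecomposable G q iota N ->
  exists j, is_module_iso iota (M j) N.
Proof.
move=> prMP M_indec a_gr b_gr ba [N' [Ngr N'gr NN0 Ndec]] N_indec.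
have prVP := root_proj_grading G fK gK fP.
have [Ns [NsE Npr]] := (graded_submoduleP G rootC fK gK fE fP N).1 Ngr.
have [N's [N'sE N'pr]] := (graded_submoduleP G rootC fK gK fE fP N').1 N'gr.
have [|v|E [KE IE EI EK]] := @projector_ex _ V N's Ns.
- by move=> v /N'sE N'v /NsE Nv; exact: NN0.
- have [c1 [c2 [N1 N2 ->]]] := (Ndec v).1 Logic.I.
  by exists c2; rewrite addrK; split; [exact/N'sE | exact/NsE].
have E_gr : graded_map prV prV E.
  apply: (projector_graded prVP KE IE EI EK) => d v.
    by move=> /N'sE N'v; apply/N'sE/N'pr.
  by move=> /NsE Nv; apply/NsE/Npr.
have [rho rhoE] := submod_lift IE.
have rhoK u : rho (val u) = u.
  by apply: val_inj; rewrite rhoE EI //; exact: submod_valP.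
have Nt_indec := indec_submod_type NsE rhoK Npr N_indec.
have Nt_gr := prN_grading rhoK rhoE E_gr.
have Nt_fin := prN_fin rhoK rhoE E_gr.
have Nt_n0 : exists u : submod_type Ns, u != 0.
  case: N_indec => _ /existsNP[c /not_implyP[Nc /eqP c0]] _.
  exists (submod_in ((NsE c).2 Nc)); apply: contraNneq c0 => u0.
  by rewrite -[c]/(val (submod_in ((NsE c).2 Nc))) u0.
have AL (k : I * J) : linear (fun u : submod_type Ns => a k.2 (pi k.1 (f (val u)))).
  move=> c u v; rewrite -[val (c *: u + v)]/(iota c * val u + val v).
  by rewrite fP piP linearP.
have BL (k : I * J) : linear (fun x : M k.2 => rho (g (mu k.1 (b k.2 x)))).
  move=> c x y; rewrite linearP muP gP.
  by rewrite -[iota c * _ + _]/(c *: (g (mu k.1 (b k.2 x)) : V) + g (mu k.1 (b k.2 y))) linearP.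
have gD : {morph g : x y / x + y}.
  by move=> x y; have := gP 1 x y; rewrite expr1n rmorph1 !mul1r.
have g0 : g 0 = 0 by apply: (can_inj fK); rewrite gK (f0 fP).
have [|||k] := krull_schmidt (s := fun k m => (q * m + s k.1)%N)
   (prM := fun k : I * J => @prM k.2)
   (a := fun k => mklin (AL k)) (b := fun k => mklin (BL k))
   Nt_gr Nt_fin Nt_indec Nt_n0 (fun k => prMP k.2) (fun k => M_indec k.2)
   (fun k => @split_shift_inj k.1).
- move=> k d u /=; rewrite rhoE EI; last first.
    by apply/NsE/Npr/NsE; exact: submod_valP.
  by rewrite root_projE // -pi_proj a_gr.
- move=> k d x /=; rewrite b_gr mu_proj (prN_rho rhoK rhoE E_gr).
  by rewrite /root_proj gK.
- move=> u; rewrite -[RHS]rhoK -[in RHS](fK (val u)) -[in RHS](mupi (f (val u))).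
  rewrite (big_morph g gD g0) linear_sum.
  rewrite -(pair_bigA _ (fun i j => rho (g (mu i (b j (a j (pi i (f (val u))))))))).
  apply: eq_bigr => i _; rewrite -[X in _ = rho (g (mu i X))]ba.
  by rewrite (big_morph (mu i) (@muD i) (mu0 i)) (big_morph g gD g0) linear_sum.
move=> Bbij; exists k.2.
have hL : linear_for (iota \; *%R) (fun x : M k.2 => val (rho (g (mu k.1 (b k.2 x)))) : C).
  by move=> c x y; rewrite (BL k).
pose hm := GRing.isLinear.Build B (M k.2) C _ _ hL.
pose h : {linear M k.2 -> C | iota \; *%R} := HB.pack (fun x : M k.2 => val (rho (g (mu k.1 (b k.2 x)))) : C) hm.
exists h; split.
  by move=> x y /val_inj; apply: (bij_inj Bbij).
move=> c; split=> [/NsE Nc | [x <-]]; last first.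
  by apply/NsE; exact: submod_valP.
have [x xE] := bij_surj Bbij (submod_in Nc); exists x.
by rewrite /h /= -[rho _]/(mklin (BL k) x) xE.
Qed.

End Split.

End Summand.
End Criterion.

(** For q = 1 the two summands correspond to ideals of a domain with zero product. Since 1 is a sum
    of elements of both, one of them is 0, and N is everything. *)
Lemma root1_summand (F : fieldType) (B : comAlgType F) (G : grading B)
    (C : comNzRingType) (iota : {rmorphism B -> C}) (N : set C) :
    (forall a b : B, a * b = 0 -> a = 0 \/ b = 0) ->
    is_root_ring 1 iota -> is_summand G 1 iota N -> is_indecomposable G 1 iota N ->
  is_module_iso iota B^o N.
Proof.
move=> domB [iotaI iota_surj _] [N' [Ngr N'gr NN0 Ndec]] [_ N_n0 _].
have surj c : exists b, iota b = c.
  by have [b bE] := iota_surj c; exists b; rewrite bE expr1.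
have NT c : N c.
  have [n [n' [Nn N'n' oneE]]] := (Ndec 1).1 Logic.I.
  have [_ _ NZ _] := Ngr; have [_ _ N'Z _] := N'gr.
  have [b bE] := surj n; have [b' b'E] := surj n'.
  have nn' : n * n' = 0.
    apply: NN0; first by rewrite mulrC -b'E; exact: NZ.
    by rewrite -bE; exact: N'Z.
  have [|b0|b0] := domB b b'.
  - by apply: iotaI; rewrite rmorphM bE b'E rmorph0.
  - case: N_n0 => x Nx; have [y yE] := surj x; apply: NN0 => //.
    have -> : x = iota y * n' by rewrite -[LHS]mulr1 oneE -bE b0 rmorph0 add0r yE.
    exact: N'Z.
  have [y <-] := surj c.
  have -> : iota y = iota y * n by rewrite -[LHS]mulr1 oneE -b'E b0 rmorph0 addr0.
  exact: NZ.
have hL : linear_for (iota \; *%R) (iota : B^o -> C).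
  by move=> b u v; rewrite rmorphD rmorphM.
exists (HB.pack (iota : B^o -> C) (GRing.isLinear.Build B B^o C _ _ hL)
  : {linear B^o -> C | iota \; *%R}).
by split=> [|c]; [exact: iotaI | split=> // _; exact: surj].
Qed.

(** That B is a domain gives reducedness and settles e = 0. *)
Theorem FFRT_criterion (F : fieldType) (B : comAlgType F) (G : grading B)
    (p D : nat) (P : lmodType B) (pr : nat -> P -> P) :
    p \in [pchar F] -> connected G ->
    (forall a b : B, a * b = 0 -> a = 0 \/ b = 0) ->
    grading_proj pr -> fin_pieces pr -> generated_upto pr D ->
    (forall e, frobenius_split G pr (p ^ e.+1)) ->
  FFRT G p.
Proof.
move=> pF conG domB prP prF genD split.
have pB : p \in [pchar B] by rewrite (pchar_lalg B).
split=> // [b n|].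
  elim: n => [|n IH]; first by rewrite expr0 => /eqP; rewrite oner_eq0.
  by rewrite exprS => /domB[].
have [J [M [prM [a [b [prMP M_indec a_gr b_gr ba]]]]]] :=
  indec_decomposition prP prF genD.
(* The entry at [ord0] is B itself, for e = 0; the lifted indices enumerate the summands of P. *)
pose L (k : 'I_#|J|.+1) : lmodType B :=
  if unlift ord0 k is Some i then M (enum_val i) else B^o.
exists #|J|.+1, L => -[|e] C iota rootC N N_sum N_indec.
  exists ord0; rewrite /L unlift_none.
  exact: root1_summand N_sum N_indec.
have [f [g [fK gK fE fP]]] := root_ring_iso pB rootC.
have [I [s [mu [pi [muP piP mupi mu_gr pi_gr]]]]] := split e.
have q_gt0 : (0 < p ^ e.+1)%N by rewrite expn_gt0 prime_gt0 ?(pcharf_prime pF).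
have [j Nj] := summand_iso rootC fK gK fE fP prP prF q_gt0 muP piP mupi mu_gr
  pi_gr prMP M_indec a_gr b_gr ba N_sum N_indec.
by exists (lift ord0 (enum_rank j)); rewrite /L liftK enum_rankK.
Qed.

(** * Freeness along a ring map *)

Section MpolyTools.
Variables (n : nat) (R : comNzRingType).

(** Only additivity is assumed, so that the lemma covers maps such as q-th powers, which are not
    linear over the coefficients. *)
Lemma mpoly_add_ext (V : zmodType) (f g : {mpoly R[n]} -> V) :
    {morph f : a b / a + b} -> {morph g : a b / a + b} ->
    (forall c m, f (c *: 'X_[m]) = g (c *: 'X_[m])) -> f =1 g.
Proof.
move=> fD gD fgX a; have f0 : f 0 = 0 by apply: (addIr (f 0)); rewrite -fD !add0r.
have g0 : g 0 = 0 by apply: (addIr (g 0)); rewrite -gD !add0r.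
rewrite [a]mpolyE (big_morph f fD f0) (big_morph g gD g0).
by apply: eq_bigr => m _; apply: fgX.
Qed.

Lemma mpoly_of_coef (h : 'X_{1..n} -> R) (k : nat) :
    (forall m, (k <= mdeg m)%N -> h m = 0) ->
  exists f : {mpoly R[n]}, forall m, f@_m = h m.
Proof.
move=> h0; exists (\sum_(m : 'X_{1..n < k}) h m *: 'X_[m]) => m.
rewrite raddf_sum /=; have [lt_m|le_m] := ltnP (mdeg m) k; last first.
  rewrite h0 // big1 // => i _; rewrite mcoeffZ mcoeffX.
  case: eqP => [im|]; last by rewrite mulr0.
  by have := bmdeg i; rewrite im ltnNge le_m.
rewrite (bigD1 (BMultinom lt_m)) //= mcoeffZ mcoeffX eqxx mulr1 big1 ?addr0 //.
move=> i ne_i; rewrite mcoeffZ mcoeffX.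
by rewrite -[_ == m]/(i == BMultinom lt_m) (negbTE ne_i) mulr0.
Qed.

Lemma mcoeff_eq0_mdeg (f : {mpoly R[n]}) m : (msize f <= mdeg m)%N -> f@_m = 0.
Proof. by move/msize_mdeg_ge; apply: memN_msupp_eq0. Qed.

End MpolyTools.

Lemma map_mpoly_inj (R S : comNzRingType) (f : {rmorphism R -> S}) n :
  injective f -> injective (map_mpoly f : {mpoly R[n]} -> {mpoly S[n]}).
Proof.
move=> fI s t st; apply/mpolyP => m; apply: fI.
by rewrite -!mcoeff_map_mpoly st.
Qed.

Lemma map_mpoly_domain (R : comNzRingType) (S : idomainType)
    (f : {rmorphism R -> S}) n (s t : {mpoly R[n]}) :
  injective f -> s * t = 0 -> s = 0 \/ t = 0.
Proof.
move=> /(map_mpoly_inj (n := n)) fI /(congr1 (map_mpoly f))/eqP.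
rewrite rmorphM rmorph0 mulf_eq0.
by case/orP => /eqP E; [left | right]; apply: fI; rewrite rmorph0.
Qed.

Lemma sum_pairE (V : nmodType) (I J : finType) (h : I * J -> V) :
  \sum_k h k = \sum_i \sum_j h (i, j).
Proof. by rewrite pair_bigA; apply: eq_bigr => -[]. Qed.

Definition free_along (E T : comNzRingType) (th : E -> T) (I : finType)
    (e : I -> T) : Prop :=
  (forall f : I -> E, \sum_i th (f i) * e i = 0 -> forall i, f i = 0) /\
  (forall t, exists f : I -> E, t = \sum_i th (f i) * e i).

Lemma free_along_comp (E T U : comNzRingType) (th : {rmorphism E -> T})
    (th' : {rmorphism T -> U}) (I J : finType) (e : I -> T) (e' : J -> U) :
    free_along th e -> free_along th' e' ->
  free_along (th' \o th) (fun k : I * J => th' (e k.1) * e' k.2).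
Proof.
move=> [e0 eE] [e'0 e'E]; split=> [f|u].
  rewrite sum_pairE exchange_big /= => f0 [i j].
  apply: (e0 (fun i => f (i, j))) i.
  apply: (e'0 (fun j => \sum_i th (f (i, j)) * e i)) j.
  rewrite -[RHS]f0; apply: eq_bigr => j _; rewrite rmorph_sum mulr_suml.
  by apply: eq_bigr => i _; rewrite rmorphM mulrA.
have [f ->] := e'E u; have /choice[g fE] := fun j => eE (f j).
exists (fun k => g k.2 k.1).
rewrite sum_pairE exchange_big /=; apply: eq_bigr => j _.
rewrite fE rmorph_sum mulr_suml.
by apply: eq_bigr => i _; rewrite rmorphM mulrA.
Qed.

Section MpolyFree.
Variables (E T : comNzRingType) (th : {rmorphism E -> T}) (n N : nat).

(** With [th] the identity this is the substitution of X_i^N for X_i; with [th] inducing q-th powers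
    and N = q it induces q-th powers of polynomials. *)
Definition mpoly_pow : {mpoly E[n]} -> {mpoly T[n]} :=
  mmap (@mpolyC n T \o th) (fun i => 'X_i ^+ N).

HB.instance Definition _ := GRing.RMorphism.on mpoly_pow.

Lemma mpoly_powX c m : mpoly_pow (c *: 'X_[m]) = th c *: 'X_[m *+ N].
Proof.
rewrite /mpoly_pow mmapZ /= mul_mpolyC mmapX; congr (_ *: _).
rewrite /mmap1 mpolyXE_id; apply: eq_bigr => i _.
by rewrite mulmnE mulnC exprM.
Qed.

Lemma mpoly_powXi i : mpoly_pow 'X_i = 'X_i ^+ N.
Proof. by rewrite /mpoly_pow mmapX mmap1U. Qed.

Lemma mpoly_powC c : mpoly_pow c%:MP = (th c)%:MP.
Proof. by rewrite /mpoly_pow mmapC. Qed.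

Definition mnm_ffun (nu : {ffun 'I_n -> 'I_N}) : 'X_{1..n} := [multinom (nu i : nat) | i < n].

Lemma mnm_divmod_inj m m' nu nu' :
  (m *+ N + mnm_ffun nu == m' *+ N + mnm_ffun nu')%MM = (m == m') && (nu == nu').
Proof.
apply/eqP/andP => [/mnmP mE | [/eqP-> /eqP->] //].
have iE i : (m i = m' i) /\ (nu i = nu' i :> nat).
  have := mE i; rewrite !mnmDE !mulmnE !mnmE => E0.
  have N_gt0 : (0 < N)%N by apply: leq_ltn_trans (ltn_ord (nu i)).
  have := congr1 (divn^~ N) E0; rewrite !divnMDl // !divn_small // !addn0.
  by have := congr1 (modn^~ N) E0; rewrite !modnMDl !modn_small.
split; first by apply/eqP/mnmP => i; case: (iE i).
by apply/eqP/ffunP => i; apply: val_inj; case: (iE i).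
Qed.

Lemma mnm_divmod m : (0 < N)%N -> exists m' nu, m = (m' *+ N + mnm_ffun nu)%MM.
Proof.
move=> N_gt0; exists [multinom (m i %/ N)%N | i < n].
exists [ffun i => Ordinal (ltn_pmod (m i) N_gt0)].
by apply/mnmP => i; rewrite mnmDE mulmnE !mnmE ffunE -divn_eq.
Qed.

Lemma mcoeff_mpoly_pow f nu e m nu' :
  (mpoly_pow f * (e *: 'X_[mnm_ffun nu]))@_(m *+ N + mnm_ffun nu') =
  if nu == nu' then th f@_m * e else 0.
Proof.
have E0 : (fun f => (mpoly_pow f * (e *: 'X_[mnm_ffun nu]))@_(m *+ N + mnm_ffun nu'))
   =1 (fun f => if nu == nu' then th f@_m * e else 0).
  apply: mpoly_add_ext => [a b|a b|c m'].
  - by rewrite rmorphD mulrDl mcoeffD.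
  - by case: ifP => _; rewrite ?addr0 // mcoeffD rmorphD mulrDl.
  rewrite mpoly_powX -scalerAl -scalerAr -mpolyXD scalerA !mcoeffZ !mcoeffX.
  rewrite mnm_divmod_inj; case: (nu == nu'); rewrite ?andbF ?mulr0 // andbT.
  by rewrite rmorphM /= rmorph_nat mulrAC.
exact: E0.
Qed.

Variables (I : finType) (e : I -> T).

Definition mpoly_basis (k : I * {ffun 'I_n -> 'I_N}) : {mpoly T[n]} :=
  e k.1 *: 'X_[mnm_ffun k.2].

Lemma mcoeff_mpoly_basis (f : I * {ffun 'I_n -> 'I_N} -> {mpoly E[n]}) m nu :
  (\sum_k mpoly_pow (f k) * mpoly_basis k)@_(m *+ N + mnm_ffun nu) =
  \sum_i th (f (i, nu))@_m * e i.
Proof.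
rewrite raddf_sum sum_pairE /=.
apply: eq_bigr => i _; rewrite (bigD1 nu) //= big1 ?addr0 => [|nu' ne_nu].
  by rewrite mcoeff_mpoly_pow eqxx.
by rewrite mcoeff_mpoly_pow (negbTE ne_nu).
Qed.

(** Euclidean division of exponents by N sorts the coefficients of a polynomial by remainder [nu],
    and each coefficient is then expanded along [e]. *)
Lemma free_along_mpoly : (0 < N)%N -> free_along th e ->
  free_along mpoly_pow mpoly_basis.
Proof.
move=> N_gt0 [e0 eE]; split=> [f f0 [i nu]|t].
  apply/mpolyP => m; rewrite mcoeff0.
  apply: (e0 (fun i => (f (i, nu))@_m)) i.
  by rewrite -mcoeff_mpoly_basis f0 mcoeff0.
have /choice[g0 g0E] := eE.
(* Forcing zero coordinates at 0 makes the families of coordinates finitely supported, hence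
   coefficients of polynomials. *)
pose g u := if u == 0 then fun=> 0 else g0 u.
have gE u : u = \sum_i th (g u i) * e i.
  rewrite /g; case: eqP => [->|_]; last exact: g0E.
  by rewrite big1 // => i _; rewrite rmorph0 mul0r.
have fP (k : I * {ffun 'I_n -> 'I_N}) : exists f : {mpoly E[n]},
    forall m, f@_m = g t@_(m *+ N + mnm_ffun k.2) k.1.
  apply: (@mpoly_of_coef _ _ _ (msize t)) => m le_m.
  rewrite mcoeff_eq0_mdeg ?/g ?eqxx //; apply: leq_trans le_m _.
  by rewrite mdegD mdegMn; apply: leq_trans (leq_addr _ _); rewrite leq_pmulr.
have /choice[f fE] := fP; exists f; apply/mpolyP => k.
have [m [nu ->]] := mnm_divmod k N_gt0; rewrite mcoeff_mpoly_basis.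
by rewrite [LHS]gE; apply: eq_bigr => i _; rewrite fE.
Qed.

End MpolyFree.

Section FreeCoordinates.
Variables (E T : comNzRingType) (th : {rmorphism E -> T}) (I : finType).
Variables (e : I -> T).
Hypothesis eF : free_along th e.

Definition coords (t : T) : I -> E := projT1 (cid (eF.2 t)).

Lemma coordsE t : t = \sum_i th (coords t i) * e i.
Proof. exact: projT2 (cid (eF.2 t)). Qed.

Lemma coords_unique (f : I -> E) i : coords (\sum_i th (f i) * e i) i = f i.
Proof.
apply/subr0_eq; apply: (eF.1 (fun i => coords (\sum_i th (f i) * e i) i - f i)) i.
under eq_bigr => i _ do rewrite rmorphB mulrBl.
by rewrite sumrB -coordsE subrr.
Qed.

Lemma coordsM a t t' i : coords (th a * t + t') i = a * coords t i + coords t' i.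
Proof.
rewrite -[RHS](coords_unique (fun i => a * coords t i + coords t' i)).
congr (coords _ i); under eq_bigr => j _ do rewrite rmorphD rmorphM mulrDl -mulrA.
by rewrite big_split -mulr_sumr -!coordsE.
Qed.

Lemma coordsD t t' i : coords (t + t') i = coords t i + coords t' i.
Proof. by have := coordsM 1 t t' i; rewrite rmorph1 !mul1r. Qed.

Lemma coords0 i : coords 0 i = 0.
Proof. by apply: (addIr (coords 0 i)); rewrite -coordsD !add0r. Qed.

End FreeCoordinates.

(** * The hypersurface and its embedding in F[X, Y] *)

Section HypersurfaceStructure.
Variables (F : fieldType) (p : nat).
Hypotheses (charFp : p \in [pchar F]) (p_gt2 : (2 < p)%N).
Local Notation A := {mpoly F[2]}.
Local Notation R := (hyp_ring F p).
Local Notation hpi := (hyp_pi F p).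

Lemma p_gt0 : (0 < p)%N. Proof. exact: ltn_trans p_gt2. Qed.

Definition hyp_incl : A -> R := hpi \o comp_mpoly [tuple 'X_0; 'X_1].

HB.instance Definition _ := GRing.LRMorphism.on hyp_incl.

Lemma hyp_inclC c : hyp_incl c%:MP = c%:A.
Proof. by rewrite /hyp_incl /= comp_mpolyC -[c%:MP]mulr1 mul_mpolyC linearZ rmorph1. Qed.

Lemma hyp_incl0 : hyp_incl 'X_0 = hpi 'X_0.
Proof. by rewrite /hyp_incl /= comp_mpolyXU. Qed.

Lemma hyp_incl1 : hyp_incl 'X_1 = hpi 'X_1.
Proof. by rewrite /hyp_incl /= comp_mpolyXU. Qed.

Definition hyp_w : A := 'X_0 ^+ 2 + 'X_1 ^+ 3.

Lemma hyp_zp : hpi 'X_2 ^+ p = hyp_incl hyp_w.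
Proof.
have : hpi (hyp_poly F p) = 0 by apply/hyp_pi_eq0; exists 1; rewrite mul1r.
rewrite /hyp_poly rmorphB rmorphD !rmorphXn /= => /subr0_eq <-.
by rewrite /hyp_w rmorphD !rmorphXn /= hyp_incl0 hyp_incl1.
Qed.

Lemma mpolyX2E (m : 'X_{1..2}) : 'X_[m] = 'X_0 ^+ m 0 * 'X_1 ^+ m 1 :> A.
Proof.
rewrite mpolyXE_id !big_ord_recl big_ord0 mulr1.
have -> : ord0 = 0 :> 'I_2 by apply: val_inj.
by have -> : lift ord0 ord0 = 1 :> 'I_2 by apply: val_inj.
Qed.

Lemma mpolyX3E (m : 'X_{1..3}) :
  'X_[m] = 'X_0 ^+ m 0 * 'X_1 ^+ m 1 * 'X_2 ^+ m 2 :> {mpoly F[3]}.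
Proof.
rewrite mpolyXE_id !big_ord_recl big_ord0 mulr1 mulrA.
have -> : lift ord0 (lift ord0 ord0) = 2 :> 'I_3 by apply: val_inj.
have -> : lift ord0 ord0 = 1 :> 'I_3 by apply: val_inj.
by have -> : ord0 = 0 :> 'I_3 by apply: val_inj.
Qed.

Definition hyp_z (k : 'I_p) : R := hpi 'X_2 ^+ k.

(** In each monomial z^p is replaced by x^2 + y^3: the exponent of z leaves its remainder modulo p,
    and its quotient becomes a power of [hyp_w]. *)
Lemma hyp_span r : exists a : 'I_p -> A, r = \sum_k hyp_incl (a k) * hyp_z k.
Proof.
have [f <-] := hyp_pi_surj r; rewrite [f]mpolyE rmorph_sum /=.
elim/big_rec: _ => [|m _ _ [a ->]].
  by exists (fun=> 0); rewrite big1 // => k _; rewrite rmorph0 mul0r.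
pose k0 := Ordinal (ltn_pmod (m 2) p_gt0).
pose b : A := f@_m *: ('X_0 ^+ m 0 * 'X_1 ^+ m 1 * hyp_w ^+ (m 2 %/ p)).
exists (fun k => (if k == k0 then b else 0) + a k).
under [RHS]eq_bigr => k _ do rewrite rmorphD mulrDl.
rewrite big_split /=; congr (_ + _); rewrite (bigD1 k0) //= eqxx.
rewrite big1 ?addr0 => [|k /negbTE ->]; last by rewrite rmorph0 mul0r.
rewrite /b !linearZ /= -scalerAl mpolyX3E; congr (_ *: _).
rewrite !rmorphM !rmorphXn. rewrite /= hyp_incl0 hyp_incl1 -hyp_zp -!mulrA; congr (_ * (_ * _)).
by rewrite -exprM mulnC -exprD -divn_eq.
Qed.

(** The target variables stand for x^{1/p} and y^{1/p}, and z is the p-th root x^{2/p} + y^{3/p} of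
    x^2 + y^3. *)
Definition hyp_emb_poly : {mpoly F[3]} -> A :=
  comp_mpoly [tuple 'X_0 ^+ p; 'X_1 ^+ p; hyp_w].

HB.instance Definition _ := GRing.LRMorphism.on hyp_emb_poly.

Lemma hyp_emb_polyX i :
  hyp_emb_poly 'X_i = [tuple 'X_0 ^+ p; 'X_1 ^+ p; hyp_w]`_i.
Proof. exact: comp_mpolyXU. Qed.

Lemma mpoly_pchar n (S : comNzRingType) : p \in [pchar S] -> p \in [pchar {mpoly S[n]}].
Proof. by move=> pS; apply: (rmorph_pchar (@mpolyC n S)). Qed.

Lemma expDp (S : comNzRingType) (a b : S) e : p \in [pchar S] ->
  (a + b) ^+ (p ^ e) = a ^+ (p ^ e) + b ^+ (p ^ e).
Proof.
move=> pS; apply: exprDn_pchar.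
by rewrite pnatX (pnatE _ (pcharf_prime pS)) pS.
Qed.

Lemma hyp_emb_poly0 : hyp_emb_poly (hyp_poly F p) = 0.
Proof.
rewrite /hyp_poly rmorphB rmorphD !rmorphXn /= !hyp_emb_polyX /=.
have := expDp ('X_0 ^+ 2) ('X_1 ^+ 3) 1 (mpoly_pchar 2 charFp).
rewrite expn1 /hyp_w => ->; rewrite -!exprM [(2 * p)%N]mulnC [(3 * p)%N]mulnC.
by rewrite subrr.
Qed.

Lemma hyp_emb_ex : exists j : {lrmorphism R -> A}, forall f, j (hpi f) = hyp_emb_poly f.
Proof.
have /choice[j0 j0E] := @hyp_pi_surj F p.
pose j r := hyp_emb_poly (j0 r).
have jE f : j (hpi f) = hyp_emb_poly f.
  apply/subr0_eq; rewrite /j -rmorphB.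
  have /hyp_pi_eq0[g ->] : hpi (j0 (hpi f) - f) = 0 by rewrite rmorphB /= j0E subrr.
  by rewrite rmorphM /= hyp_emb_poly0 mulr0.
have jL : linear j.
  move=> c r s; have [f <-] := hyp_pi_surj r; have [g <-] := hyp_pi_surj s.
  by rewrite -linearP !jE linearP.
have jM : monoid_morphism j.
  split=> [|r s]; first by rewrite -(rmorph1 hpi) jE rmorph1.
  have [f <-] := hyp_pi_surj r; have [g <-] := hyp_pi_surj s.
  by rewrite -rmorphM !jE rmorphM.
pose jLin := GRing.isLinear.Build F R A _ j jL.
pose jMul := GRing.isMonoidMorphism.Build R A j jM.
by exists (HB.pack j jLin jMul : {lrmorphism R -> A}).
Qed.

Definition hyp_emb : {lrmorphism R -> A} := projT1 (cid hyp_emb_ex).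

Lemma hyp_embE f : hyp_emb (hpi f) = hyp_emb_poly f.
Proof. exact: projT2 (cid hyp_emb_ex) f. Qed.

Lemma hyp_emb_x : hyp_emb (hpi 'X_0) = 'X_0 ^+ p.
Proof. by rewrite hyp_embE hyp_emb_polyX. Qed.

Lemma hyp_emb_y : hyp_emb (hpi 'X_1) = 'X_1 ^+ p.
Proof. by rewrite hyp_embE hyp_emb_polyX. Qed.

Lemma hyp_emb_z : hyp_emb (hpi 'X_2) = hyp_w.
Proof. by rewrite hyp_embE hyp_emb_polyX. Qed.

Local Notation frobX := (mpoly_pow (idfun : {rmorphism F -> F}) p).

Lemma hyp_emb_incl a : hyp_emb (hyp_incl a) = frobX a.
Proof.
apply: (mpoly_add_ext (f := fun a => hyp_emb (hyp_incl a))) => [b c|b c|c m].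
- by rewrite !rmorphD.
- by rewrite !rmorphD.
rewrite !linearZ /= mpoly_powX /=; congr (_ *: _).
rewrite (mpolyX2E m) (mpolyX2E (m *+ p)) !rmorphM !rmorphXn /= hyp_incl0 hyp_incl1 hyp_emb_x hyp_emb_y.
by rewrite !mulmnE -!exprM ![(p * _)%N]mulnC.
Qed.

Lemma mpoly_pow_inj (E T : comNzRingType) (th : {rmorphism E -> T}) n N :
  (0 < N)%N -> injective th -> injective (@mpoly_pow E T th n N).
Proof.
move=> N_gt0 thI f g fg; apply/mpolyP => m; apply: thI.
have := congr1 (fun f => (f * (1 *: 'X_[mnm_ffun [ffun=> Ordinal N_gt0]]))@_
  (m *+ N + mnm_ffun [ffun=> Ordinal N_gt0])) fg.
by rewrite !mcoeff_mpoly_pow eqxx !mulr1.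
Qed.

Lemma mderiv_frobX a (i : 'I_2) : mderiv i (frobX a) = 0.
Proof.
have p0 : (p%:R = 0 :> A) by exact: pcharf0 (mpoly_pchar 2 charFp).
apply: (mpoly_add_ext (f := fun a => mderiv i (frobX a)) (g := fun=> 0)) => [b c|b c|c m].
- by rewrite rmorphD linearD.
- by rewrite addr0.
rewrite mpoly_powX linearZ /= mderivX mulmnE natrM (pcharf0 charFp) mulr0.
by rewrite scale0r scaler0.
Qed.

(* The derivation d/dX kills the p-th powers and multiplies w^k by 2 k X / w. *)
Lemma hyp_w_free n (a : nat -> A) : (n <= p)%N ->
  \sum_(k < n) frobX (a k) * hyp_w ^+ k = 0 -> forall k, (k < n)%N -> a k = 0.
Proof.
elim: n a => // n IH a le_n.
have derw : mderiv (0 : 'I_2) hyp_w = 2%:R * 'X_0.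
  rewrite /hyp_w mderivD !mpolyXn !mderivX !mulmnE !mnm1E /= scaler_nat.
  have -> : (U_(0%R) *+ 2 - U_(0%R) = U_(0%R) :> 'X_{1..2})%MM.
    by apply/mnmP => i; rewrite mnmBE mulmnE muln2 -addnn addnK.
  by rewrite mul0n scale0r addr0 mulr_natl.
have derX k : mderiv (0 : 'I_2) (hyp_w ^+ k.+1) = k.+1%:R * hyp_w ^+ k * (2%:R * 'X_0).
  elim: k => [|k IHk]; first by rewrite expr1 expr0 !mul1r.
  rewrite exprS mderivM IHk derw exprS -[k.+2%:R]natr1; ring.
move=> /[dup] sum0 /(congr1 (mderiv (0 : 'I_2))); rewrite raddf0 raddf_sum big_ord_recl /=.
rewrite mderivM mderiv_frobX mul0r add0r expr0 -mpolyC1 mderivC mulr0 add0r.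
under eq_bigr => k _ do rewrite mderivM mderiv_frobX mul0r add0r derX !mulrA.
rewrite -!mulr_suml => /eqP; rewrite !mulf_eq0.
(* The factor 2 X produced by the derivation is cancelled; it is nonzero because p > 2. *)
have two_n0 : (2%:R != 0 :> A).
  rewrite -(dvdn_pcharf (mpoly_pchar 2 charFp)); apply/negP => /dvdn_leq.
  by move=> /(_ isT); rewrite leqNgt p_gt2.
have X0_n0 : ('X_0 != 0 :> A).
  apply/eqP => /(congr1 (mcoeff U_(0))); rewrite mcoeffX eqxx mcoeff0 => /eqP.
  by rewrite oner_eq0.
rewrite (negbTE two_n0) (negbTE X0_n0) !orbF => /eqP S0.
(* What remains is a shorter relation with coefficients (k+1) a_{k+1}, and k + 1 < p is invertible
   in F. *)
have S1 : \sum_(k < n) frobX (k.+1%:R * a k.+1) * hyp_w ^+ k = 0.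
  rewrite -[RHS]S0; apply: eq_bigr => k _; rewrite rmorphM rmorph_nat.
  by rewrite /= /bump /= add1n; congr (_ * _); rewrite mulrC.
have aS k : (k < n)%N -> a k.+1 = 0.
  move=> lt_k; have /eqP := IH (fun k => k.+1%:R * a k.+1) (ltnW le_n) S1 k lt_k.
  rewrite mulf_eq0 => /orP[|/eqP//].
  rewrite -(dvdn_pcharf (mpoly_pchar 2 charFp)) => /dvdn_leq => /(_ isT).
  by rewrite leqNgt (leq_trans _ le_n).
move: sum0; rewrite big_ord_recl expr0 mulr1 big1 ?addr0 => [a0|k _]; last first.
  by rewrite aS // rmorph0 mul0r.
case=> [_|k]; last exact: aS.
by apply: (mpoly_pow_inj p_gt0 (th := idfun)) => //; rewrite a0 rmorph0.
Qed.

Lemma hyp_emb_sum (a : 'I_p -> A) :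
  hyp_emb (\sum_k hyp_incl (a k) * hyp_z k) = \sum_(k < p) frobX (a k) * hyp_w ^+ k.
Proof.
rewrite rmorph_sum; apply: eq_bigr => k _.
by rewrite rmorphM /= hyp_emb_incl /hyp_z rmorphXn /= hyp_emb_z.
Qed.

Lemma hyp_emb_sum_eq0 (a : 'I_p -> A) :
  hyp_emb (\sum_k hyp_incl (a k) * hyp_z k) = 0 -> forall k, a k = 0.
Proof.
rewrite hyp_emb_sum => a0 k; pose b (k : nat) := if insub k is Some i then a i else 0.
have ab (i : 'I_p) : b i = a i by rewrite /b valK.
rewrite -ab; apply: (hyp_w_free (n := p)) => //.
by rewrite -[RHS]a0; apply: eq_bigr => i _; rewrite ab.
Qed.

(** Independence is read in F[X, Y], where z becomes [hyp_w], whose powers below p are independent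
    over F[X^p, Y^p]. *)
Lemma hyp_free : free_along hyp_incl hyp_z.
Proof.
split=> [a a0|r]; last exact: hyp_span.
by apply: hyp_emb_sum_eq0; rewrite a0 rmorph0.
Qed.

Lemma hyp_emb_inj : injective hyp_emb.
Proof.
move=> r s rs; apply/subr0_eq; have [a E] := hyp_span (r - s).
rewrite E big1 // => k _; rewrite (hyp_emb_sum_eq0 (a := a)) ?rmorph0 ?mul0r //.
by rewrite -E rmorphB /= rs subrr.
Qed.

Lemma hyp_incl_inj : injective hyp_incl.
Proof.
move=> a b /(congr1 hyp_emb); rewrite !hyp_emb_incl.
by apply: mpoly_pow_inj => //; exact: p_gt0.
Qed.

Lemma hyp_domain (r s : R) : r * s = 0 -> r = 0 \/ s = 0.
Proof.
move=> /(congr1 hyp_emb)/eqP; rewrite rmorphM rmorph0 mulf_eq0.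
by case/orP=> /eqP E; [left | right]; apply: hyp_emb_inj; rewrite rmorph0.
Qed.

Hypothesis perfF : perfect_field p F.

Lemma perfect_root e (c : F) : exists d, d ^+ (p ^ e) = c.
Proof.
elim: e c => [|e IH] c; first by exists c.
have [d <-] := IH c; have [d' <-] := perfF d.
by exists d'; rewrite expnS exprM.
Qed.

(** The composite fixes the coefficients and sends X_i to X_i^p. A p-th root of an image therefore
    needs p-th roots of coefficients, which exist because F is perfect. *)
Lemma hyp_root_ring : is_root_ring p (fun a => hyp_emb (hyp_incl a)).
Proof.
have p1 : p = (p ^ 1)%N by rewrite expn1.
have AP := mpoly_pchar 2 charFp.
have pI : injective (fun c : A => c ^+ p).
  move=> b c /eqP; rewrite -subr_eq0 => E; apply/subr0_eq.
  have /eqP : (b - c) ^+ p = 0.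
    have := expDp (b - c) c 1 AP; rewrite expn1 subrK => bE.
    by apply/eqP; move: E; rewrite bE addrK.
  by rewrite expf_eq0 p_gt0 => /eqP.
have frobE (b : A) : exists c : A, c ^+ p = frobX b.
  elim/mpolyind: b => [|c m b _ _ [d dE]]; first by exists 0; rewrite rmorph0 expr0n gtn_eqF ?p_gt0.
  have [c' c'E] := perfF c; exists (c' *: 'X_[m] + d).
  have := expDp (c' *: 'X_[m]) d 1 AP; rewrite expn1 => ->.
  by rewrite dE rmorphD /= mpoly_powX exprZn c'E mpolyXn.
split.
- move=> a b; rewrite !hyp_emb_incl; apply: mpoly_pow_inj => //; exact: p_gt0.
- move=> c; elim/mpolyind: c => [|c m b _ _ [d dE]].
    by exists 0; rewrite !rmorph0 expr0n gtn_eqF ?p_gt0.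
  exists (c ^+ p *: 'X_[m] + d).
  have := expDp (c *: 'X_[m]) b 1 AP; rewrite expn1 => ->.
  by rewrite !rmorphD /= dE hyp_emb_incl mpoly_powX exprZn mpolyXn.
move=> b; have [c cE] := frobE b; exists c; rewrite hyp_emb_incl; split=> // c'.
by rewrite -cE => /pI.
Qed.

End HypersurfaceStructure.

Lemma frobenius_ex (S : comNzRingType) p e : p \in [pchar S] ->
  exists phi : {rmorphism S -> S}, forall x, phi x = x ^+ (p ^ e).
Proof.
move=> pS; pose phi (x : S) := x ^+ (p ^ e).
have phiB : zmod_morphism phi.
  by move=> a b; apply/eqP; rewrite eq_sym subr_eq -expDp // subrK.
have phiM : monoid_morphism phi.
  by split; [exact: expr1n | move=> a b; exact: exprMn].
pose phiA := GRing.isZmodMorphism.Build S S phi phiB.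
pose phiR := GRing.isMonoidMorphism.Build S S phi phiM.
by exists (HB.pack phi phiA phiR : {rmorphism S -> S}).
Qed.

Lemma mpoly_pow_emb (R A : comNzRingType) (j : {rmorphism R -> A})
    (th : {rmorphism A -> R}) n p e :
    p \in [pchar R] -> (forall r, th (j r) = r ^+ (p ^ e)) ->
  forall t : {mpoly R[n]}, mpoly_pow th (p ^ e) (map_mpoly j t) = t ^+ (p ^ e).
Proof.
move=> pR thj; have pT := mpoly_pchar n pR.
apply: (mpoly_add_ext (f := fun t => mpoly_pow th (p ^ e) (map_mpoly j t))
  (g := fun t => t ^+ (p ^ e))).
- by move=> a b; rewrite !rmorphD.
- by move=> a b; rewrite (expDp _ _ _ pT).
move=> r m; rewrite exprZn -thj.
have -> : map_mpoly j (r *: 'X_[m]) = j r *: 'X_[m].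
  by apply/mpolyP => k; rewrite mcoeff_map_mpoly !mcoeffZ !mcoeffX; case: eqP; rewrite ?mulr1 ?mulr0 ?raddf0.
by rewrite mpoly_powX mpolyXn.
Qed.

(** The degrees of x^{1/p} and y^{1/p}, namely 3p / p and 2p / p. *)
Definition wt2 : measure 2 := @wdeg [:: 3; 2]%N 2.

Lemma wt2E m : wt2 m = (3 * m 0%R + 2 * m 1%R)%N.
Proof.
rewrite /wt2 /= /wdeg !big_ord_recl big_ord0 /= addn0.
by congr (_ * m _ + _ * m _)%N; apply: val_inj.
Qed.

Lemma mdeg2E (m : 'X_{1..2}) : mdeg m = (m 0%R + m 1%R)%N.
Proof.
rewrite mdegE !big_ord_recl big_ord0 /= addn0.
by congr (m _ + m _)%N; apply: val_inj.
Qed.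

Lemma mnm_wt2_bounded d : exists s : seq 'X_{1..2}, forall m, wt2 m = d -> m \in s.
Proof.
exists [seq val m | m : 'X_{1..2 < d.+1}] => m; rewrite wt2E => mE.
have lt_m : (mdeg m < d.+1)%N by rewrite mdeg2E; lia.
by apply/mapP; exists (BMultinom lt_m); rewrite ?mem_enum.
Qed.

Section PihomogGrading.
Variables (F : comNzRingType) (n : nat) (w : measure n).

Lemma pihomog_grading : grading_proj (fun d => @pihomog n F w d).
Proof.
split=> [d u v|d e v|v]; first exact: linearB.
  case: eqP => [->|/eqP ne_de]; first by rewrite pihomog_dE ?pihomogP.
  by rewrite (pihomog_ne0 _ (pihomogP w e v)) // eq_sym.
by exists (mmeasure w v); apply: pihomog_partitionE.
Qed.

Lemma mcoeff_pihomog d (f : {mpoly F[n]}) m :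
  (pihomog w d f)@_m = if w m == d then f@_m else 0.
Proof.
rewrite pihomogE raddf_sum /=; case: ifP => [wm|wm].
  rewrite big_mkcond /= [f in RHS]mpolyE raddf_sum /=; apply: eq_bigr => k _.
  rewrite mcoeffZ mcoeffX; case: (eqVneq k m) => [->|_]; first by rewrite wm.
  by rewrite mulr0 if_same.
rewrite big1 // => k /eqP wk; rewrite mcoeffZ mcoeffX.
by case: (eqVneq k m) wm => [<-|_ _]; rewrite ?mulr0 // wk eqxx.
Qed.

Lemma pihomogZX d c m : pihomog w d (c *: 'X_[m] : {mpoly F[n]}) =
  if w m == d then c *: 'X_[m] else 0.
Proof. by rewrite linearZ /= pihomogX; case: ifP => _; rewrite ?scaler0. Qed.

End PihomogGrading.

Section FreeGraded.
Variables (F : fieldType) (E : comNzRingType) (T : comAlgType F) (G : grading T).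
Variables (th : {rmorphism E -> T}) (I : finType) (e : I -> T).
Variables (prE : nat -> E -> E) (q : nat) (s : I -> nat).
Hypotheses (eF : free_along th e) (prP : grading_proj prE) (q_gt0 : (0 < q)%N).
Hypothesis thG : forall i m x, G (q * m + s i)%N (th (prE m x) * e i).

(** Projecting the expansion of a homogeneous element to its own degree gives another expansion of
    it, and coordinates are unique. *)
Lemma coords_graded i d m t : G d t ->
  prE m (coords eF t i) = if d == (q * m + s i)%N then coords eF t i else 0.
Proof.
move=> Gt; pose f i := coords eF t i; pose k i := ((d - s i) %/ q)%N.
have kE j m' : (q * m' + s j == d)%N = (d == q * k j + s j)%N && (m' == k j).
  apply/eqP/andP => [dE|[/eqP -> /eqP -> //]].
  by have -> : k j = m'; [rewrite /k -dE addnK mulKn | rewrite dE !eqxx].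
(* This is the part of the i-th coordinate that [th] and [e i] send to degree d; it is 0 when d is
   not of the form q k + s i. *)
pose g i := if d == (q * k i + s i)%N then prE (k i) (f i) else 0.
have gE j : gproj G d (th (f j) * e j) = th (g j) * e j.
  have [n fE] := grpr_dec prP (f j); rewrite {1}fE rmorph_sum mulr_suml linear_sum.
  under eq_bigr => m' _ do rewrite (gprojE _ (thG j m' _)) kE.
  rewrite /g; case: ifP => dk /=; last by rewrite big1 // rmorph0 mul0r.
  have [lt_k|le_n] := ltnP (k j) n.
    by rewrite (bigD1 (Ordinal lt_k)) //= eqxx big1 ?addr0 // => l; rewrite -val_eqE /= => /negbTE ->.
  rewrite big1 => [|l _]; last by rewrite ltn_eqF // (leq_trans (ltn_ord l)).
  rewrite fE (grpr_sum prP) big1 ?rmorph0 ?mul0r // => l _.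
  by rewrite (grprE prP) gtn_eqF // (leq_trans (ltn_ord l)).
have fg j : f j = g j.
  rewrite -(coords_unique eF g) /f; congr (coords _ _ _).
  rewrite -{1}(gproj_id Gt) {1}(coordsE eF t) linear_sum.
  by apply: eq_bigr => l _; rewrite -gE.
rewrite -[coords eF t i]/(f i) fg /g; case: eqP => [dk|_]; last by rewrite (grpr0 prP) if_same.
by rewrite (grprE prP) {1}dk eqn_add2r eqn_pmul2l // eq_sym.
Qed.

End FreeGraded.

(** * FFRT of the hypersurface *)

Section HypersurfaceFFRT.
Variables (F : fieldType) (p : nat).
Hypotheses (charFp : p \in [pchar F]) (p_gt2 : (2 < p)%N).
Hypothesis perfF : perfect_field p F.
Local Notation A := {mpoly F[2]}.
Local Notation R := (hyp_ring F p).
Local Notation hpi := (hyp_pi F p).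
Local Notation G := (hyp_grading F p).
Local Notation j := (hyp_emb charFp).

Lemma hyp_alg c : hpi c%:MP = c%:A.
Proof. by rewrite -[c%:MP]mulr1 mul_mpolyC linearZ rmorph1. Qed.

Lemma hyp_wdegE m : hyp_wdeg p m = (3 * p * m 0%R + 2 * p * m 1%R + 6 * m 2%R)%N.
Proof.
rewrite /hyp_wdeg /= /wdeg !big_ord_recl big_ord0 /= addn0 addnA.
by congr (_ * m _ + _ * m _ + _ * m _)%N; apply: val_inj.
Qed.

Lemma hyp_connected : connected G.
Proof.
move=> b [f [/dhomogP f0 <-]]; exists f@_0%MM; rewrite -hyp_alg; congr (hpi _).
apply/mpolyP => m; rewrite mcoeffC; case: (eqVneq m 0%MM) => [->|m0].
  by rewrite mulr1.
rewrite mulr0; apply: memN_msupp_eq0; apply: contraNN m0 => /f0.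
rewrite -[X in X = _]/(hyp_wdeg p m) hyp_wdegE => mE; apply/eqP/mnmP => i.
rewrite mnm0E; have p0 := p_gt0 p_gt2.
have : (m 0%R + m 1%R + m 2%R = 0)%N by nia.
case: i => [[|[|[|i]]] lt_i] //=.
- rewrite (_ : Ordinal lt_i = 0%R); last exact: val_inj.
  by lia.
- rewrite (_ : Ordinal lt_i = 1%R); last exact: val_inj.
  by lia.
rewrite (_ : Ordinal lt_i = 2%R); last exact: val_inj.
by lia.
Qed.

Lemma hyp_piece_x k : G (3 * p * k)%N (hpi 'X_0 ^+ k).
Proof.
exists ('X_0 ^+ k); split; last by rewrite rmorphXn.
rewrite mpolyXn dhomogX hyp_wdegE !mulmnE !mnm1E /=.
by apply/eqP; lia.
Qed.

Lemma hyp_piece_y k : G (2 * p * k)%N (hpi 'X_1 ^+ k).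
Proof.
exists ('X_1 ^+ k); split; last by rewrite rmorphXn.
rewrite mpolyXn dhomogX hyp_wdegE !mulmnE !mnm1E /=.
by apply/eqP; lia.
Qed.

Lemma hyp_piece_z k : G (6 * k)%N (hpi 'X_2 ^+ k).
Proof.
exists ('X_2 ^+ k); split; last by rewrite rmorphXn.
rewrite mpolyXn dhomogX hyp_wdegE !mulmnE !mnm1E /=.
by apply/eqP; lia.
Qed.

Lemma hyp_inclX m : hyp_incl p 'X_[m] = hpi 'X_0 ^+ m 0 * hpi 'X_1 ^+ m 1.
Proof. by rewrite mpolyX2E rmorphM !rmorphXn /= hyp_incl0 hyp_incl1. Qed.

Lemma hyp_piece_incl m : G (p * wt2 m)%N (hyp_incl p 'X_[m]).
Proof.
have -> : (p * wt2 m = 3 * p * m 0%R + 2 * p * m 1%R)%N by rewrite wt2E; lia.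
by rewrite hyp_inclX; apply: pieceM; [exact: hyp_piece_x | exact: hyp_piece_y].
Qed.

Definition frob e : {rmorphism F -> F} := projT1 (cid (frobenius_ex e charFp)).

Lemma frobE e c : frob e c = c ^+ (p ^ e).
Proof. exact: projT2 (cid (frobenius_ex e charFp)) c. Qed.

Lemma frob_free e : free_along (frob e) (fun _ : unit => 1).
Proof.
split=> [f|c].
  rewrite (bigD1 tt) //= big1 ?addr0 => [|[]//]; rewrite mulr1 => f0 [].
  by apply: (fmorph_inj (frob e)); rewrite f0 rmorph0.
have [d dE] := perfect_root perfF e c; exists (fun=> d).
by rewrite (bigD1 tt) //= big1 ?addr0 => [|[]//]; rewrite mulr1 frobE.
Qed.

Section Level.
Variable e : nat.
Local Notation q := (p ^ e.+1)%N.
Local Notation N := (p ^ e)%N.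

Lemma N_gt0 : (0 < N)%N. Proof. by rewrite expn_gt0 p_gt0. Qed.

(** The q-th power map on A^{1/p}: the q-th power of x^{1/p} is x^{p^e}, which already lies in R. *)
Definition theta : A -> R := hyp_incl p \o mpoly_pow (frob e.+1) N.
HB.instance Definition _ := GRing.RMorphism.on theta.

(** The products x^i y^j z^k with i, j < p^e and k < p. The monomials in x and y form a basis of A
    over the image of [mpoly_pow], and the powers of z one of R over A. *)
Definition theta_basis (k : (unit * {ffun 'I_2 -> 'I_N}) * 'I_p) : R :=
  hyp_incl p (mpoly_basis (fun=> 1) k.1) * hyp_z F k.2.

Lemma theta_free : free_along theta theta_basis.
Proof.
exact: free_along_comp (free_along_mpoly _ N_gt0 (frob_free e.+1))
  (hyp_free charFp p_gt2).
Qed.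

Definition theta_deg (k : (unit * {ffun 'I_2 -> 'I_N}) * 'I_p) : nat :=
  (p * wt2 (mnm_ffun k.1.2) + 6 * k.2)%N.

Lemma theta_basis_piece k : G (theta_deg k) (theta_basis k).
Proof.
apply: pieceM; last exact: hyp_piece_z.
by rewrite /mpoly_basis scale1r; exact: hyp_piece_incl.
Qed.

Lemma thetaX c m : theta (c *: 'X_[m]) = c ^+ q *: hyp_incl p 'X_[m *+ N].
Proof. by rewrite /theta /= mpoly_powX linearZ /= frobE. Qed.

Lemma theta_graded k m f :
  G (q * m + theta_deg k)%N (theta (pihomog wt2 m f) * theta_basis k).
Proof.
apply: pieceM (theta_basis_piece k); rewrite [f]mpolyE linear_sum (rmorph_sum theta).
apply: piece_sum_closed => m' /=; rewrite pihomogZX.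
case: eqP => [wm|_]; last by rewrite rmorph0; exact: (piece0 G).
rewrite thetaX; apply: (@pieceZ _ _ G).
have -> : (q * m = p * wt2 (m' *+ N)%MM)%N.
  by rewrite -wm !wt2E !mulmnE expnS; lia.
exact: hyp_piece_incl.
Qed.

Lemma R_pchar : p \in [pchar R].
Proof. by rewrite (pchar_lalg (R : lalgType F)). Qed.

Lemma theta_emb r : theta (j r) = r ^+ q.
Proof.
have [f <-] := hyp_pi_surj r; rewrite hyp_embE.
apply: (mpoly_add_ext (f := fun f => theta (hyp_emb_poly p f))
  (g := fun f => hpi f ^+ q)) => [a b|a b|c m].
- by rewrite !rmorphD.
- by rewrite rmorphD (expDp _ _ _ R_pchar).
have thC b : theta b%:MP = (b ^+ q)%:A.
  by rewrite /theta /= mpoly_powC frobE hyp_inclC.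
have thX i : theta 'X_i = hyp_incl p 'X_i ^+ N.
  by rewrite /theta /= mpoly_powXi rmorphXn.
have thw : theta (hyp_w F) = hpi 'X_2 ^+ q.
  rewrite expnS exprM hyp_zp // /hyp_w !rmorphD !rmorphXn /= !thX.
  by rewrite (expDp _ _ _ R_pchar) -!exprM ![(N * _)%N]mulnC.
rewrite -mul_mpolyC mpolyX3E !rmorphM !rmorphXn /= !hyp_emb_polyX /= hyp_alg.
rewrite !rmorphXn /= thw !thX hyp_incl0 hyp_incl1 /hyp_emb_poly comp_mpolyC thC.
rewrite !exprMn_comm ?mulrA; try exact: mulrC.
rewrite -!exprM hyp_alg exprZn !expr1n mulr1.
have qE a : (N * (p * a) = a * q)%N by rewrite expnS [RHS]mulnC mulnCA mulnA.
by rewrite !qE [(q * _)%N]mulnC.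
Qed.

End Level.

Local Notation P := (root_mod (j : {rmorphism R -> A})).

Lemma hyp_emb_alg c : j c%:A = c%:MP.
Proof. by rewrite linearZ /= rmorph1 -mul_mpolyC mulr1. Qed.

Lemma hyp_fin_pieces : fin_pieces (fun d (f : P) => pihomog wt2 d f : P).
Proof.
move=> d; have [s sP] := mnm_wt2_bounded d.
exists [seq ('X_[m] : P) | m <- s & wt2 m == d]; split=> [v|v].
  case/mapP=> m; rewrite mem_filter => /andP[/eqP wm _] ->.
  by have := pihomogZX wt2 d (1 : F) m; rewrite !scale1r wm eqxx.
rewrite pihomogE; apply: fspan_sum_mem => m _ /eqP wm.
have -> : v@_m *: 'X_[m] = (v@_m)%:A *: ('X_[m] : P) :> P.
  by rewrite -[RHS]/(j (v@_m)%:A * 'X_[m]) hyp_emb_alg mul_mpolyC.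
rewrite -[X in fspan _ X]addr0; apply/fspanP/fspan0/fspan_mem/mapP.
by exists m => //; rewrite mem_filter wm eqxx sP.
Qed.

Lemma mnm_wt2_reduce (m : 'X_{1..2}) a b : (a <= m 0%R)%N -> (b <= m 1%R)%N ->
  exists m', [/\ 'X_[m] = 'X_0 ^+ a * 'X_1 ^+ b * 'X_[m'] :> A,
    m' 0%R = (m 0%R - a)%N & m' 1%R = (m 1%R - b)%N].
Proof.
move=> le_a le_b.
exists [multinom (if i == 0%R then m 0%R - a else m 1%R - b)%N | i < 2].
rewrite !mnmE /=; split=> //.
rewrite (mpolyX2E _ m) (mpolyX2E _ [multinom _ | _ < _]) !mnmE /=.
by rewrite mulrACA -!exprD !subnKC.
Qed.

(** Over F[X^p, Y^p] the monomials with both exponents below p generate, and their weight is less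
    than 3p + 2p. *)
Lemma hyp_generated : generated_upto (fun d (f : P) => pihomog wt2 d f : P) (5 * p).
Proof.
move=> f f0; have p0 := p_gt0 p_gt2.
have fX m : f 'X_[m] = 0.
  move: {2}(mdeg m).+1 (ltnSn (mdeg m)) => n; elim: n m => // n IH m lt_m.
  have [le_a|lt_a] := leqP p (m 0%R).
    have [m' [-> a b]] := mnm_wt2_reduce le_a (leq0n _).
    rewrite expr0 mulr1 -(hyp_emb_x charFp).
    rewrite -[j _ * _]/((hpi 'X_0 : R) *: ('X_[m'] : P)) linearZ /= IH ?scaler0 //.
    by move: lt_m; rewrite !mdeg2E; lia.
  have [le_b|lt_b] := leqP p (m 1%R).
    have [m' [-> a b]] := mnm_wt2_reduce (leq0n _) le_b.
    rewrite expr0 mul1r -(hyp_emb_y charFp).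
    rewrite -[j _ * _]/((hpi 'X_1 : R) *: ('X_[m'] : P)) linearZ /= IH ?scaler0 //.
    by move: lt_m; rewrite !mdeg2E; lia.
  have := f0 (wt2 m) 'X_[m]; rewrite pihomogX eqxx; apply.
  by rewrite wt2E; lia.
move=> v; rewrite [v](mpolyE (v : A)) linear_sum big1 // => m _.
have -> : v@_m *: 'X_[m] = (v@_m)%:A *: ('X_[m] : P) :> P.
  by rewrite -[RHS]/(j (v@_m)%:A * 'X_[m]) hyp_emb_alg mul_mpolyC.
by rewrite linearZ /= fX scaler0.
Qed.

Lemma hyp_frobenius_split e :
  frobenius_split G (fun d (f : P) => pihomog wt2 d f : P) (p ^ e.+1).
Proof.
have q0 : (0 < p ^ e.+1)%N by rewrite expn_gt0 p_gt0.
exists _, (@theta_deg e), (fun k (f : P) => theta e f * theta_basis k),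
  (fun k b => coords (theta_free e) b k).
split.
- move=> k b x y; rewrite -[b *: x + y]/(j b * x + y : A).
  by rewrite rmorphD rmorphM /= theta_emb mulrDl -mulrA.
- by move=> k b c c'; rewrite -theta_emb coordsM.
- by move=> b; rewrite -(coordsE (theta_free e)).
- by move=> k m x; apply: theta_graded.
move=> k d m b Gb.
exact: (coords_graded (theta_free e) (pihomog_grading F wt2) q0 (@theta_graded e) k m Gb).
Qed.

Theorem hyp_FFRT : FFRT G p.
Proof.
apply: (@FFRT_criterion _ _ G p (5 * p) P (fun d f => pihomog wt2 d f)).
- exact: charFp.
- exact: hyp_connected.
- exact: hyp_domain charFp p_gt2.
- exact: pihomog_grading.
- exact: hyp_fin_pieces.
- exact: hyp_generated.
exact: hyp_frobenius_split.
Qed.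

End HypersurfaceFFRT.

(** * The Segre product *)

Section SegreStructure.
Variables (F : fieldType) (p : nat).
Hypotheses (charFp : p \in [pchar F]) (p_gt2 : (2 < p)%N).
Local Notation A := {mpoly F[2]}.
Local Notation R := (hyp_ring F p).
Local Notation hpi := (hyp_pi F p).
Local Notation G := (hyp_grading F p).
Local Notation j := (hyp_emb charFp).
Local Notation B := (hyp_segre F p).
Local Notation GB := (hyp_segre_grading F p).
Local Notation TT := (mpoly_tensor R 2).
Local Notation T := {mpoly R[2]}.

Lemma piece_mulA d r (c : F) : G d r -> G d (r * c%:A).
Proof. by move=> Gr; rewrite -scalerAr mulr1; apply: (@pieceZ _ _ G). Qed.

(** In the model R[u, v] of the tensor product, the elements of R_d tensor S_d are the forms of
    degree d in u and v with coefficients in R_d. *)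
Lemma segre_pieceE d (t : T) :
  segre_piece G (std_grading F 2) d (t : TT) <->
  forall m, G d t@_m /\ (mdeg m != d -> t@_m = 0).
Proof.
split=> [[s [sG ->]] m|tG].
  elim: s sG => [|[r f] s IH] sG.
    by rewrite big_nil mcoeff0; split=> //; exact: (piece0 G).
  rewrite big_cons mcoeffD; have [|Gs s0] := IH.
    by move=> rs rss; apply: sG; rewrite inE rss orbT.
  have [/= Gr /dhomogP Gf] := sG (r, f) (mem_head _ _).
  have E0 : (tinl TT r * tinr TT f : T)@_m = r * (f@_m)%:A.
    by rewrite /= /ext_inl /ext_inr mcoeffCM mcoeff_map_mpoly.
  rewrite E0; split=> [|ne_d].
    by apply: (@pieceD _ _ G) => //; exact: piece_mulA.
  rewrite s0 // addr0 (_ : f@_m = 0) ?scale0r ?mulr0 //.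
  by apply: memN_msupp_eq0; apply: contraNN ne_d => /Gf ->.
exists [seq (t@_m, 'X_[m]) | m <- msupp t & mdeg m == d]; split=> [rs|].
  case/mapP => m; rewrite mem_filter => /andP[/eqP dm _] -> /=; split.
    by case: (tG m).
  by rewrite /mpoly_piece /= dhomogX; apply/eqP.
rewrite big_map big_filter [LHS]mpolyE [RHS]big_mkcond /=.
apply: eq_bigr => m _; rewrite [RHS](_ : _ = t@_m *: ('X_[m] : T)) //.
case: eqP => [_|/eqP ne_d]; first exact: ext_pure.
by rewrite (tG m).2 // scale0r.
Qed.

Lemma segre_predE (t : T) :
  ((t : TT) \in segre_pred G (std_grading F 2) (T := TT)) <->
  forall m, G (mdeg m) t@_m.
Proof.
split=> [/asboolP[n [h [hP ->]]] m|tG].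
  rewrite raddf_sum; apply: (@piece_sum_closed _ _ G) => d.
  have [Gh h0] := (segre_pieceE d (h d)).1 (hP d) m.
  have hG : G (mdeg m) (h d : T)@_m.
    by have [->|/h0 ->] := eqVneq (mdeg m) d; [exact: Gh | exact: (piece0 G)].
  exact: hG.
apply/asboolP; exists (msize t), (fun d => pihomog mdeg d t).
split=> [d|]; last exact: pihomog_partitionE.
apply/segre_pieceE => m; rewrite mcoeff_pihomog.
case: eqP => [<-|_]; split=> //; last exact: (piece0 G).
exact: tG.
Qed.

Definition segre_vl (b : B) : T := segre_val b.

Lemma segre_ex (t : T) : (forall m, G (mdeg m) t@_m) -> exists b : B, segre_vl b = t.
Proof. by move=> /segre_predE tB; exists (Segre tB). Qed.

Lemma segre_valP (b : B) m : G (mdeg m) (segre_vl b)@_m.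
Proof. exact: ((segre_predE (val b)).1 (valP b) m). Qed.

Lemma segre_gradingE d (b : B) :
  GB d b <-> forall m, mdeg m != d -> (segre_vl b)@_m = 0.
Proof.
split=> [/segre_pieceE bP m|b0]; first by case: (bP m).
apply/segre_pieceE => m; split; last exact: b0.
have [<-|ne_d] := eqVneq (mdeg m) d; first exact: segre_valP.
by rewrite b0 //; exact: (piece0 G).
Qed.

Lemma segre_vlB a b : segre_vl (a - b) = segre_vl a - segre_vl b.
Proof. by []. Qed.

Lemma segre_vl1 : segre_vl 1 = 1.
Proof. by []. Qed.

Lemma segre_vlM a b : segre_vl (a * b) = segre_vl a * segre_vl b.
Proof. by []. Qed.

Lemma segre_vl_zmod : zmod_morphism segre_vl.
Proof. exact: segre_vlB. Qed.

Lemma segre_vl_monoid : monoid_morphism segre_vl.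
Proof. by split; [exact: segre_vl1 | exact: segre_vlM]. Qed.

HB.instance Definition _ := GRing.isZmodMorphism.Build B T segre_vl segre_vl_zmod.
HB.instance Definition _ :=
  GRing.isMonoidMorphism.Build B T segre_vl segre_vl_monoid.

Definition segre_emb (b : B) : {mpoly A[2]} := map_mpoly j (segre_vl b).

Lemma segre_emb_zmod : zmod_morphism segre_emb.
Proof. by move=> a b; rewrite /segre_emb segre_vlB rmorphB. Qed.

Lemma segre_emb_monoid : monoid_morphism segre_emb.
Proof. by split=> [|a b]; rewrite /segre_emb ?segre_vl1 ?segre_vlM ?rmorph1 ?rmorphM. Qed.

HB.instance Definition _ :=
  GRing.isZmodMorphism.Build B {mpoly A[2]} segre_emb segre_emb_zmod.
HB.instance Definition _ :=
  GRing.isMonoidMorphism.Build B {mpoly A[2]} segre_emb segre_emb_monoid.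

Lemma T_domain (s t : T) : s * t = 0 -> s = 0 \/ t = 0.
Proof. exact: (map_mpoly_domain (hyp_emb_inj (charFp := charFp) p_gt2)). Qed.

Lemma segre_vl_inj : injective segre_vl.
Proof. exact: (@val_inj _ _ B). Qed.

Lemma segre_vl0 : segre_vl 0 = 0.
Proof. by []. Qed.

Lemma segre_domain (a b : B) : a * b = 0 -> a = 0 \/ b = 0.
Proof.
move=> ab; have E : segre_vl a * segre_vl b = 0 by rewrite -segre_vlM ab segre_vl0.
case: (T_domain E) => {}E; [left | right]; apply: segre_vl_inj; rewrite segre_vl0; exact: E.
Qed.

Lemma segre_alg (c : F) : segre_vl c%:A = (c%:A : R)%:MP.
Proof. by rewrite -[LHS]/((c%:A : R) *: (1 : T)) -mul_mpolyC mulr1. Qed.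

Lemma segre_connected : connected GB.
Proof.
move=> b /segre_gradingE b0.
have G0 := segre_valP b 0%MM; rewrite mdeg0 in G0.
have [c cE] := hyp_connected charFp p_gt2 G0.
exists c; apply: segre_vl_inj; rewrite segre_alg; apply/mpolyP => m.
rewrite mcoeffC; have [->|m0] := eqVneq m 0%MM; first by rewrite mulr1.
by rewrite mulr0 b0 // mdeg_eq0.
Qed.

End SegreStructure.

(** * The module spanned by monomials near the diagonal, for the Segre product *)

Lemma mcoeffM_neq0 n (R : comNzRingType) (f g : {mpoly R[n]}) m :
  (f * g)@_m != 0 -> exists m1 m2, m = (m1 + m2)%MM /\ f@_m1 * g@_m2 != 0.
Proof.
rewrite mcoeffM => fg; apply/not_existsP => fg0; case/eqP: fg.
apply: big1 => k /eqP mE; apply/eqP/negPn/negP => fgk.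
by case: (fg0 k.1); exists k.2.
Qed.

Lemma mcoeffMM_neq0 n n' (R : comNzRingType) (f g : {mpoly {mpoly R[n]}[n']}) m' m :
    (f * g)@_m'@_m != 0 -> exists m1' m2' m1 m2,
  [/\ m' = (m1' + m2')%MM, m = (m1 + m2)%MM & f@_m1'@_m1 * g@_m2'@_m2 != 0].
Proof.
rewrite mcoeffM raddf_sum /= => fg; apply/not_existsP => fg0; case/eqP: fg.
apply: big1 => k /eqP mE; apply/eqP/negPn/negP => /mcoeffM_neq0[m1 [m2 [mE' fgm]]].
by case: (fg0 k.1); exists k.2, m1, m2.
Qed.

Section SegreFFRT.
Variables (F : fieldType) (p : nat).
Hypotheses (charFp : p \in [pchar F]) (p_gt2 : (2 < p)%N).
Hypothesis perfF : perfect_field p F.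
Local Notation A := {mpoly F[2]}.
Local Notation R := (hyp_ring F p).
Local Notation hpi := (hyp_pi F p).
Local Notation G := (hyp_grading F p).
Local Notation j := (hyp_emb charFp).
Local Notation B := (hyp_segre F p).
Local Notation GB := (hyp_segre_grading F p).
Local Notation T := {mpoly R[2]}.
Local Notation E := {mpoly A[2]}.
Local Notation J := (segre_emb charFp : {rmorphism B -> E}).

Lemma hyp_w_homog : hyp_w F \is 6.-homog for wt2.
Proof.
rewrite /hyp_w !mpolyXn; apply: rpredD; rewrite dhomogX wt2E !mulmnE !mnm1E /=.
  by [].
by [].
Qed.

Lemma hyp_emb_homog d r m : G d r -> (j r)@_m != 0 -> wt2 m = d.
Proof.
case=> f [/dhomogP fd <-]; rewrite hyp_embE -mcoeff_msupp.
suff /dhomogP H : hyp_emb_poly p f \is d.-homog for wt2 by move/H.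
rewrite [f]mpolyE linear_sum big_seq; apply: rpred_sum => k /fd kd.
rewrite linearZ; apply: rpredZ; rewrite /= mpolyX3E !rmorphM !rmorphXn /= !hyp_emb_polyX /=.
rewrite -kd hyp_wdegE.
have h0 : ('X_0 ^+ p : A) \is (3 * p).-homog for wt2.
  by rewrite mpolyXn dhomogX wt2E !mulmnE !mnm1E /=; apply/eqP; lia.
have h1 : ('X_1 ^+ p : A) \is (2 * p).-homog for wt2.
  by rewrite mpolyXn dhomogX wt2E !mulmnE !mnm1E /=; apply/eqP; lia.
by do 2?[apply: dhomogM]; apply: dhomogMn => //; exact: hyp_w_homog.
Qed.

(* For b in B the coordinate of b along x^i y^j z^k u^i' v^j' only has terms
   with q wt2 m + p (3 i + 2 j) + 6 k = q |m'| + i' + j', where i, j < q / p,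
   k < p and i', j' < q; the bounds below hold for every q. *)
Definition near_diag (m m' : 'X_{1..2}) : bool :=
  (wt2 m <= mdeg m' + 1)%N && (mdeg m' <= wt2 m + 10)%N.

Definition near_diag_set (f : root_mod J) : Prop :=
  forall m m', (f : E)@_m'@_m != 0 -> near_diag m m'.

Lemma segre_emb_coef b m m' : (J b)@_m'@_m != 0 -> wt2 m = mdeg m'.
Proof.
rewrite /= /segre_emb mcoeff_map_mpoly; apply: hyp_emb_homog.
exact: segre_valP.
Qed.

(** Every monomial occurring in [J b] has equal degrees in (X, Y) and in (u, v), so multiplication
    by it preserves the difference of the two degrees. *)
Lemma near_diag_setP b u v :
  near_diag_set u -> near_diag_set v -> near_diag_set (b *: u + v).
Proof.
move=> uP vP m m'; rewrite -[b *: u + v]/(J b * u + v : E) !mcoeffD.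
have [->|/mcoeffMM_neq0[m1' [m2' [m1 [m2 [-> -> bu]]]]] _] :=
  eqVneq ((J b * (u : E))@_m'@_m) 0; first by rewrite add0r => /vP.
have b0 : (J b)@_m1'@_m1 != 0 by apply: contraNneq bu => ->; rewrite mul0r.
have u0 : (u : E)@_m2'@_m2 != 0 by apply: contraNneq bu => ->; rewrite mulr0.
have := uP _ _ u0; have := segre_emb_coef b0.
rewrite /near_diag !wt2E !mdegD !mnmDE; lia.
Qed.

Lemma near_diag_set0 : near_diag_set 0.
Proof. by move=> m m'; rewrite !mcoeff0 eqxx. Qed.

Definition near_diag_submod := Submod near_diag_set0 near_diag_setP.
Local Notation P := (submod_type near_diag_submod).

Definition P_val (u : P) : E := val u.

Lemma P_valP u m m' : (P_val u)@_m'@_m != 0 -> near_diag m m'.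
Proof. exact: (submod_valP u). Qed.

Lemma P_val_inj : injective P_val.
Proof. exact: (@val_inj _ _ P). Qed.

Lemma P_valD u v : P_val (u + v) = P_val u + P_val v.
Proof. by []. Qed.

Lemma P_valB u v : P_val (u - v) = P_val u - P_val v.
Proof. by []. Qed.

Lemma P_valZ b u : P_val (b *: u) = J b * P_val u.
Proof. by []. Qed.

Lemma P_val0 : P_val 0 = 0.
Proof. by []. Qed.

Lemma P_val_sum (I : Type) (r : seq I) (Q : pred I) (h : I -> P) :
  P_val (\sum_(i <- r | Q i) h i) = \sum_(i <- r | Q i) P_val (h i).
Proof. exact: (big_morph P_val P_valD P_val0). Qed.

Lemma P_ex (f : E) : (forall m m', f@_m'@_m != 0 -> near_diag m m') ->
  exists u : P, P_val u = f.
Proof. by move=> fP; exists (submod_in (fP : near_diag_submod f)). Qed.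

Lemma P_proj_ex d : exists pr : P -> P,
  forall u, P_val (pr u) = map_mpoly (pihomog wt2 d) (P_val u).
Proof.
suff /choice[f fP] : forall u, exists v, P_val v = map_mpoly (pihomog wt2 d) (P_val u).
  by exists f.
move=> u; apply: P_ex => m m'; rewrite mcoeff_map_mpoly mcoeff_pihomog.
by case: ifP => _; [exact: P_valP | rewrite eqxx].
Qed.

Definition P_proj d : P -> P := projT1 (cid (P_proj_ex d)).

Lemma P_projE d u m' : (P_val (P_proj d u))@_m' = pihomog wt2 d (P_val u)@_m'.
Proof.
have -> : P_val (P_proj d u) = map_mpoly (pihomog wt2 d) (P_val u).
  exact: projT2 (cid (P_proj_ex d)) u.
exact: mcoeff_map_mpoly.
Qed.

Lemma P_grading : grading_proj P_proj.
Proof.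
split=> [d u v|d e u|u].
- apply: P_val_inj; rewrite P_valB; apply/mpolyP => m'.
  by rewrite mcoeffB !P_projE P_valB mcoeffB linearB.
- apply: P_val_inj; apply/mpolyP => m'; rewrite !P_projE (grprE (pihomog_grading F wt2)).
  by case: ifP => _; rewrite ?P_projE // P_val0 mcoeff0.
exists (msize (P_val u)).+1; apply: P_val_inj; rewrite P_val_sum.
apply/mpolyP => m'; apply/mpolyP => m; rewrite !raddf_sum /=.
under eq_bigr => d _ do rewrite P_projE mcoeff_pihomog.
rewrite -big_mkcond /=; have [u0|u0] := eqVneq ((P_val u)@_m'@_m) 0.
  by rewrite u0 big1.
have /andP[wt_m _] := P_valP u0.
have lt_m : (wt2 m < (msize (P_val u)).+1)%N.
  rewrite ltnS (leq_trans wt_m) // addn1; apply: msize_mdeg_lt.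
  by rewrite mcoeff_msupp; apply: contraNneq u0 => ->; rewrite mcoeff0.
rewrite (bigD1 (Ordinal lt_m)) //= big1 ?addr0 // => d /andP[/eqP md /eqP[]].
exact/val_inj.
Qed.

(** Outside the band the default value is 0, which keeps the family total; its lemmas assume
    [near_diag]. *)
Definition P_mono (m m' : 'X_{1..2}) : P :=
  insubd (0 : P) (('X_[m] : A) *: ('X_[m'] : E) : root_mod J).

Lemma P_monoE m m' : near_diag m m' -> P_val (P_mono m m') = 'X_[m] *: 'X_[m'].
Proof.
move=> mm'; rewrite /P_mono /P_val insubdK //; apply/asboolP => k k'.
rewrite mcoeffZ mcoeffX.
have [<-|_] := eqVneq m' k'; last by rewrite mulr0 mcoeff0 eqxx.
rewrite mulr1 mcoeffX; have [<-//|_] := eqVneq m k.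
by rewrite eqxx.
Qed.

Lemma P_alg c u : P_val (c%:A *: u) = c%:MP%:MP * P_val u.
Proof.
rewrite P_valZ /= /segre_emb segre_alg map_mpolyC; congr (_%:MP * _).
exact: hyp_emb_alg.
Qed.

Lemma P_span (u : P) :
  u = \sum_(m' <- msupp (P_val u)) \sum_(m <- msupp (P_val u)@_m')
        ((P_val u)@_m'@_m)%:A *: P_mono m m'.
Proof.
apply: P_val_inj; rewrite P_val_sum [LHS]mpolyE !big_seq.
apply: eq_bigr => m' _; rewrite P_val_sum [X in X *: _]mpolyE scaler_suml !big_seq.
apply: eq_bigr => m; rewrite mcoeff_msupp => u0.
rewrite P_alg P_monoE; last exact: P_valP u0.
by rewrite mul_mpolyC scalerA mul_mpolyC.
Qed.

Lemma P_proj_mono d m m' : near_diag m m' ->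
  P_proj d (P_mono m m') = if wt2 m == d then P_mono m m' else 0.
Proof.
move=> mm'; apply: P_val_inj; apply/mpolyP => k'; rewrite P_projE P_monoE //.
rewrite mcoeffZ mcoeffX; have [E'|ne] := eqVneq m' k'.
  rewrite mulr1 pihomogX; case: ifP => _; rewrite ?P_val0 ?mcoeff0 // P_monoE //.
  by rewrite mcoeffZ mcoeffX E' eqxx mulr1.
rewrite mulr0 linear0; case: ifP => _; rewrite ?P_val0 ?mcoeff0 // P_monoE //.
by rewrite mcoeffZ mcoeffX (negbTE ne) mulr0.
Qed.

Lemma P_fin_pieces : fin_pieces P_proj.
Proof.
move=> d; have [s sP] := mnm_wt2_bounded d.
(* Inside the band, weight d in (X, Y) bounds the degree in (u, v) by d + 10. *)
pose s' := [seq val m | m : 'X_{1..2 < (d + 11)%N}].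
exists [seq P_mono k.1 k.2 | k <- [seq (m, m') | m <- s, m' <- s'] & (wt2 k.1 == d) && near_diag k.1 k.2].
split=> [v|v].
  case/mapP => [[m m']]; rewrite mem_filter => /andP[/andP[/= /eqP wm mm'] _] ->.
  by rewrite P_proj_mono // ifT //; apply/eqP.
rewrite [X in fspan _ X]P_span; apply: fspan_sum_mem => m' _ _.
apply: fspan_sum_mem => m; rewrite mcoeff_msupp => v0 _.
have mm' := P_valP v0; move: v0; rewrite P_projE mcoeff_pihomog.
case: ifP => [/eqP wm _|_]; last by rewrite eqxx.
rewrite -[X in fspan _ X]addr0; apply/fspanP/fspan0/fspan_mem/mapP.
exists (m, m') => //; rewrite mem_filter; apply/andP; split.
  by rewrite mm' andbT; apply/eqP.
apply/allpairsP; exists (m, m'); split=> //=; first exact: sP.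
have lt_m' : (mdeg m' < d + 11)%N by move: mm'; rewrite /near_diag; lia.
by apply/mapP; exists (BMultinom lt_m'); rewrite ?mem_enum.
Qed.

End SegreFFRT.

Lemma mnm2_split (m : 'X_{1..2}) d : (d <= mdeg m)%N ->
  exists c k, m = (c + k)%MM /\ mdeg c = d.
Proof.
rewrite mdeg2E => le_d; pose a := minn d (m 0%R).
pose c := [multinom (if i == 0%R then a else d - a)%N | i < 2].
have c0 : c 0%R = a by rewrite mnmE.
have c1 : c 1%R = (d - a)%N by rewrite mnmE.
have le_c : (c <= m)%MM.
  apply/mnm_lepP => i; have [->|] := eqVneq i 0%R; first by rewrite c0 geq_minr.
  case: i => [[|[|i]]] // lt_i _; rewrite (_ : Ordinal lt_i = 1%R); last exact: val_inj.
  by rewrite c1 /a; lia.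
exists c, (m - c)%MM; rewrite addmC submK //; split=> //.
by rewrite mdeg2E c0 c1 /a; lia.
Qed.

Lemma mnm_U_split n (m : 'X_{1..n}) (i : 'I_n) a : (a <= m i)%N ->
  exists k, m = (U_(i) *+ a + k)%MM.
Proof.
move=> le_a; exists (m - U_(i) *+ a)%MM; rewrite addmC submK //.
apply/mnm_lepP => k; rewrite mulmnE mnm1E; case: eqP => [<-|_]; last by rewrite mul0n.
by rewrite mul1n.
Qed.

Section SegreFFRT.
Variables (F : fieldType) (p : nat).
Hypotheses (charFp : p \in [pchar F]) (p_gt2 : (2 < p)%N).
Hypothesis perfF : perfect_field p F.
Local Notation A := {mpoly F[2]}.
Local Notation R := (hyp_ring F p).
Local Notation hpi := (hyp_pi F p).
Local Notation G := (hyp_grading F p).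
Local Notation j := (hyp_emb charFp).
Local Notation B := (hyp_segre F p).
Local Notation GB := (hyp_segre_grading F p).
Local Notation T := {mpoly R[2]}.
Local Notation E := {mpoly A[2]}.
Local Notation J := (segre_emb charFp).
Local Notation P := (submod_type (near_diag_submod charFp p_gt2)).
Local Notation mono := (P_mono charFp p_gt2).
Local Notation prP := (@P_proj F p charFp p_gt2).

(** The scalar is r times the monomial c in u and v. It lies in the Segre product because the degree
    of r is that of c, and dividing by it stays in the band. *)
Lemma P_mono_step (r : R) (a c m m' : 'X_{1..2}) :
    G (mdeg c) r -> j r = 'X_[a] -> wt2 a = mdeg c ->
    near_diag (a + m)%MM (c + m')%MM ->
  exists b : B, mono (a + m)%MM (c + m')%MM = b *: mono m m'.
Proof.
move=> Gr jr wa mm'.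
have [b bE] : exists b : B, segre_vl b = r *: 'X_[c].
  apply: segre_ex => k; rewrite mcoeffZ mcoeffX.
  by have [<-|_] := eqVneq c k; rewrite ?mulr1 // mulr0; exact: (piece0 G).
have mm : near_diag m m'.
  by move: mm' wa; rewrite /near_diag !wt2E !mdegD !mnmDE; lia.
exists b; apply: P_val_inj; rewrite P_valZ !P_monoE //.
rewrite [X in X * _](_ : _ = map_mpoly j (segre_vl b)) // bE.
rewrite -[r *: _]mul_mpolyC rmorphM /= map_mpolyC map_mpolyX.
rewrite [X in X%:MP_[2] * _](_ : _ = 'X_[a]); last exact: jr.
by rewrite mul_mpolyC -scalerAl -scalerAr scalerA -!mpolyXD.
Qed.

Lemma P_generated : generated_upto prP (5 * p).
Proof.
move=> f f0; have p0 := p_gt0 p_gt2.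
have fX m m' : near_diag m m' -> f (mono m m') = 0.
  move: {2}(mdeg m).+1 (ltnSn (mdeg m)) => n; elim: n m m' => // n IH m m' lt_m mm'.
  have step (r : R) (i : 'I_2) d : G d r -> j r = 'X_[U_(i) *+ p] ->
      wt2 (U_(i) *+ p)%MM = d -> (p <= m i)%N -> (d <= mdeg m')%N -> f (mono m m') = 0.
    move=> Gr jr wd le_p le_d.
    have [k mE] := mnm_U_split le_p; have [c [k' [m'E cd]]] := mnm2_split le_d.
    rewrite -cd in Gr wd; rewrite mE m'E in mm' *.
    have [b ->] := P_mono_step Gr jr wd mm'; rewrite linearZ /= IH ?scaler0 //.
      by move: lt_m; rewrite mE mdegD mdegMn mdeg1; lia.
    by move: mm' wd; rewrite /near_diag !wt2E !mdegD !mnmDE; lia.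
  (* The threshold is p + 1 rather than p: weight at least 3 (p + 1) forces degree at least 3p + 2
     in (u, v) despite the slack 1 of the band, so there is room for the 3p factors that accompany
     x. Likewise for y; the monomials left have exponents at most p, hence weight at most 5p. *)
  have [le_a|lt_a] := leqP (p + 1) (m 0%R).
    apply: (step (hpi 'X_0) 0%R (3 * p)%N).
    - by have := hyp_piece_x charFp p_gt2 1; rewrite muln1 expr1.
    - by rewrite hyp_emb_x mpolyXn.
    - by rewrite wt2E !mulmnE !mnm1E /=; lia.
    - by lia.
    by move: mm'; rewrite /near_diag !wt2E; lia.
  have [le_b|lt_b] := leqP (p + 1) (m 1%R).
    apply: (step (hpi 'X_1) 1%R (2 * p)%N).
    - by have := hyp_piece_y charFp p_gt2 1; rewrite muln1 expr1.
    - by rewrite hyp_emb_y mpolyXn.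
    - by rewrite wt2E !mulmnE !mnm1E /=; lia.
    - by lia.
    by move: mm'; rewrite /near_diag !wt2E; lia.
  have := f0 (wt2 m) (mono m m'); rewrite P_proj_mono // eqxx; apply.
  by rewrite wt2E; lia.
move=> v; rewrite (P_span v) linear_sum big_seq big1 // => m' _.
rewrite linear_sum big_seq big1 // => m; rewrite mcoeff_msupp => v0.
by rewrite linearZ /= fX ?scaler0 //; exact: P_valP v0.
Qed.

End SegreFFRT.

(* B is a retract of T, and T is free over E along [th]; [th] restricts on the
   image of B to the q-th power map. *)
Lemma frobenius_split_of_free (F : fieldType) (B : comAlgType F) (GB : grading B)
    (P : lmodType B) (pr : nat -> P -> P) (E T : comNzRingType)
    (vl : {rmorphism B -> T}) (J : {rmorphism B -> E}) (Pv : P -> E)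
    (th : {rmorphism E -> T}) (I : finType) (e : I -> T) (eF : free_along th e)
    (q : nat) (h : T -> B) (s : I -> nat) :
    injective Pv -> (forall b u v, Pv (b *: u + v) = J b * Pv u + Pv v) ->
    (forall b, th (J b) = vl b ^+ q) ->
    (forall b x y, h (vl b * x + y) = b * h x + h y) -> (forall b, h (vl b) = b) ->
    (forall k b, exists u, Pv u = coords eF (vl b) k) ->
    (forall k m u, GB (q * m + s k)%N (h (th (Pv (pr m u)) * e k))) ->
    (forall k d m b u, GB d b -> Pv u = coords eF (vl b) k ->
       pr m u = if d == (q * m + s k)%N then u else 0) ->
  frobenius_split GB pr q.
Proof.
move=> PvI PvP thJ hP hK Pex mu_gr pi_gr.
have /choice[pi0 piE] : forall kb : I * B, exists u, Pv u = coords eF (vl kb.2) kb.1.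
  by move=> [k b]; apply: Pex.
pose pi k b := pi0 (k, b); have {}piE k b : Pv (pi k b) = coords eF (vl b) k.
  exact: (piE (k, b)).
have hD x y : h (x + y) = h x + h y by have := hP 1 x y; rewrite rmorph1 !mul1r.
have h0 : h 0 = 0 by apply: (addIr (h 0)); rewrite -hD !add0r.
exists I, s, (fun k u => h (th (Pv u) * e k)), pi; split.
- by move=> k b x y; rewrite PvP rmorphD rmorphM thJ mulrDl -mulrA -hP rmorphXn.
- move=> k b c c'; apply: PvI.
  by rewrite PvP !piE rmorphD rmorphM rmorphXn -thJ coordsM.
- move=> b; rewrite -[RHS]hK (coordsE eF (vl b)) (big_morph h hD h0).
  by apply: eq_bigr => k _; rewrite piE.
- exact: mu_gr.
by move=> k d m b /pi_gr; apply; exact: piE.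
Qed.

(** * Frobenius splitting of the Segre product *)

Section SegreFrobenius.
Variables (F : fieldType) (p : nat).
Hypotheses (charFp : p \in [pchar F]) (p_gt2 : (2 < p)%N).
Hypothesis perfF : perfect_field p F.
Local Notation A := {mpoly F[2]}.
Local Notation R := (hyp_ring F p).
Local Notation G := (hyp_grading F p).
Local Notation j := (hyp_emb charFp).
Local Notation B := (hyp_segre F p).
Local Notation GB := (hyp_segre_grading F p).
Local Notation T := {mpoly R[2]}.
Local Notation E := {mpoly A[2]}.
Local Notation P := (submod_type (near_diag_submod charFp p_gt2)).
Local Notation prP := (@P_proj F p charFp p_gt2).

(** The retraction of R[u, v] onto the Segre product keeps, at each monomial in u and v, the part of
    the coefficient whose degree matches. *)
Lemma retr_ex : exists h : T -> B, forall t m,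
  (segre_vl (h t))@_m = gproj G (mdeg m) t@_m.
Proof.
suff /choice[h hP] : forall t : T, exists b : B, forall m,
    (segre_vl b)@_m = gproj G (mdeg m) t@_m by exists h.
move=> t; have [t' t'E] : exists t' : T, forall m, t'@_m = gproj G (mdeg m) t@_m.
  apply: (@mpoly_of_coef _ _ _ (msize t)) => m le_m.
  by rewrite mcoeff_eq0_mdeg // linear0.
have [|b bE] := @segre_ex F p t'; first by move=> m; rewrite t'E; exact: gproj_piece.
by exists b => m; rewrite bE.
Qed.

Definition retr : T -> B := projT1 (cid retr_ex).

Lemma retrE t m : (segre_vl (retr t))@_m = gproj G (mdeg m) t@_m.
Proof. exact: projT2 (cid retr_ex) t m. Qed.

Lemma segre_vlD (a b : B) : segre_vl (a + b) = segre_vl a + segre_vl b.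
Proof. by []. Qed.

(** The coefficients of [segre_vl b] are homogeneous of the degree of their monomial, so multiplying
    by them commutes with the projections. *)
Lemma retrMD b s t : retr (segre_vl b * s + t) = b * retr s + retr t.
Proof.
apply: segre_vl_inj; rewrite segre_vlD segre_vlM; apply/mpolyP => m.
rewrite mcoeffD !retrE mcoeffD linearD; congr (_ + _).
rewrite !mcoeffM linear_sum; apply: eq_bigr => -[[k1 lt1] [k2 lt2]] /= /eqP mE.
by rewrite mE mdegD gproj_mull ?retrE //; exact: segre_valP.
Qed.

Lemma retrK b : retr (segre_vl b) = b.
Proof.
apply: segre_vl_inj; apply/mpolyP => m; rewrite retrE gproj_id //.
exact: segre_valP.
Qed.

Section Level.
Variable e : nat.
Local Notation q := (p ^ e.+1)%N.
Local Notation th := (theta charFp e : {rmorphism A -> R}).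
Local Notation Th := (@mpoly_pow _ _ th 2 q : {rmorphism E -> T}).
Local Notation idx := ((unit * {ffun 'I_2 -> 'I_(p ^ e)}) * 'I_p)%type.
Local Notation tb := (@theta_basis F p e).
Local Notation Tb := (@mpoly_basis R 2 q idx tb).

Lemma q_gt0 : (0 < q)%N. Proof. by rewrite expn_gt0 p_gt0. Qed.

Definition th_free : free_along th tb := theta_free charFp p_gt2 perfF e.

Definition Th_free : free_along Th Tb := free_along_mpoly 2 q_gt0 th_free.

Lemma Th_emb (t : T) : Th (map_mpoly j t) = t ^+ q.
Proof. exact: (mpoly_pow_emb (R_pchar charFp) (theta_emb charFp e) t). Qed.

Lemma coords_Th (t : T) k m' :
  (coords Th_free t k)@_m' = coords th_free t@_(m' *+ q + mnm_ffun k.2) k.1.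
Proof.
case: k => k nu /=; rewrite {2}(coordsE Th_free t) mcoeff_mpoly_basis.
by rewrite (coords_unique th_free (fun i => (coords Th_free t (i, nu))@_m')).
Qed.

(** With i, j < p^e the part p (3 i + 2 j) is below 5 q, and 6 k < 6 p is at most 6 q. Division by q
    turns this into the constant 10 of the band. *)
Lemma theta_deg_lt (k : idx) : (theta_deg k < 11 * q)%N.
Proof.
have N0 : (0 < p ^ e)%N := N_gt0 p_gt2 e.
rewrite /theta_deg wt2E !mnmE expnS.
have := ltn_ord (k.1.2 0%R); have := ltn_ord (k.1.2 1%R); have := ltn_ord k.2.
set a := nat_of_ord _; set b := nat_of_ord _; set c := nat_of_ord _.
move: (p ^ e)%N N0 => N N0 aN bN cp; nia.
Qed.

Lemma mdeg_ffun_lt (nu : {ffun 'I_2 -> 'I_q}) : (mdeg (mnm_ffun nu) < 2 * q)%N.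
Proof.
rewrite mdeg2E !mnmE; case: (nu 0%R) (nu 1%R) => a /= aq [b /= bq].
by move: (p ^ e.+1)%N aq bq => Q; lia.
Qed.

Lemma coords_near_diag (b : B) k m m' :
  (coords Th_free (segre_vl b) k)@_m'@_m != 0 -> near_diag m m'.
Proof.
rewrite coords_Th => c0; have Gb := segre_valP b (m' *+ q + mnm_ffun k.2)%MM.
have := coords_graded th_free (pihomog_grading F wt2) q_gt0
  (@theta_graded F p charFp p_gt2 e) k.1 (wt2 m) Gb.
move=> /(congr1 (mcoeff m)); rewrite mcoeff_pihomog eqxx.
case: eqP => [dE _|_ /eqP]; last by rewrite mcoeff0 (negbTE c0).
have := mdeg_ffun_lt k.2; have := theta_deg_lt k.1.
move: dE; rewrite mdegD mdegMn /near_diag.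
move: q (theta_deg _) (mdeg (mnm_ffun _)) => Q s t dE.
by move=> sQ tQ; apply/andP; split; nia.
Qed.

End Level.
End SegreFrobenius.

Section SegreFrobenius.
Variables (F : fieldType) (p : nat).
Hypotheses (charFp : p \in [pchar F]) (p_gt2 : (2 < p)%N).
Hypothesis perfF : perfect_field p F.
Local Notation A := {mpoly F[2]}.
Local Notation R := (hyp_ring F p).
Local Notation G := (hyp_grading F p).
Local Notation j := (hyp_emb charFp).
Local Notation B := (hyp_segre F p).
Local Notation GB := (hyp_segre_grading F p).
Local Notation T := {mpoly R[2]}.
Local Notation E := {mpoly A[2]}.
Local Notation P := (submod_type (near_diag_submod charFp p_gt2)).
Local Notation prP := (@P_proj F p charFp p_gt2).

Section Level.
Variable e : nat.
Local Notation q := (p ^ e.+1)%N.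
Local Notation th := (theta charFp e : {rmorphism A -> R}).
Local Notation Th := (@mpoly_pow _ _ th 2 q : {rmorphism E -> T}).
Local Notation idx := ((unit * {ffun 'I_2 -> 'I_(p ^ e)}) * 'I_p)%type.
Local Notation tb := (@theta_basis F p e).
Local Notation q_gt0 := (q_gt0 p_gt2 e).
Local Notation th_free := (th_free charFp p_gt2 perfF e).
Local Notation Th_free := (Th_free charFp p_gt2 perfF e).
Local Notation Tb := (@mpoly_basis R 2 q idx tb).

(** Before the retraction all coefficients are homogeneous of degree q m + [theta_deg k.1], so the
    retraction keeps exactly the monomials in u and v of that degree. *)
Lemma seg_mu_gr k m u : GB (q * m + theta_deg k.1)%N (retr (Th (P_val (prP m u)) * Tb k)).
Proof.
apply/segre_gradingE => n ne_n; rewrite retrE.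
have [m' [nu nE]] := mnm_divmod n q_gt0.
have -> : (Th (P_val (prP m u)) * Tb k)@_n =
    if k.2 == nu then th (pihomog wt2 m (P_val u)@_m') * tb k.1 else 0.
  by rewrite nE mcoeff_mpoly_pow P_projE.
case: ifP => _; last by rewrite linear0.
rewrite (gprojE _ (theta_graded charFp p_gt2 k.1 m _)).
by rewrite eq_sym (negbTE ne_n).
Qed.

Lemma seg_pi_gr k d m b (u : P) : GB d b ->
  P_val u = coords Th_free (segre_vl b) k ->
  prP m u = if d == (q * m + theta_deg k.1)%N then u else 0.
Proof.
move=> /segre_gradingE b0 uE; apply: P_val_inj; apply/mpolyP => m'.
rewrite P_projE uE coords_Th.
set n := (m' *+ q + mnm_ffun k.2)%MM.
have Gb : G d (segre_vl b)@_n.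
  by have [<-|ne_d] := eqVneq (mdeg n) d; [exact: segre_valP | rewrite b0 //; exact: (piece0 G)].
have -> := coords_graded th_free (pihomog_grading F wt2) q_gt0
  (@theta_graded F p charFp p_gt2 e) k.1 m Gb.
by case: ifP => _; rewrite ?P_val0 ?mcoeff0 // uE coords_Th.
Qed.

Lemma segre_frobenius_split : frobenius_split GB prP q.
Proof.
apply: (@frobenius_split_of_free _ B GB P prP _ _ (@segre_vl F p) (segre_emb charFp)
  (@P_val F p charFp p_gt2) Th _ Tb Th_free q (@retr F p) (fun k => theta_deg k.1)).
- exact: P_val_inj.
- by [].
- by move=> b; exact: Th_emb.
- exact: retrMD.
- exact: retrK.
- by move=> k b; apply: P_ex => m m'; exact: coords_near_diag.
- exact: seg_mu_gr.
exact: seg_pi_gr.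
Qed.

End Level.

Theorem segre_FFRT : FFRT GB p.
Proof.
apply: (@FFRT_criterion _ _ GB p (5 * p) P prP).
- exact: charFp.
- exact: segre_connected charFp p_gt2.
- exact: segre_domain charFp p_gt2.
- exact: P_grading.
- exact: P_fin_pieces.
- exact: P_generated.
exact: segre_frobenius_split.
Qed.

End SegreFrobenius.

(** * Krull dimension *)

Lemma kernel_prime (B : comNzRingType) (D : idomainType) (f : {rmorphism B -> D}) :
  is_prime_ideal [set b | f b = 0].
Proof.
split=> [|/=|a b /=].
- split=> [/=|a b /= a0 b0|c a /= a0]; first exact: rmorph0.
    by rewrite rmorphD a0 b0 addr0.
  by rewrite rmorphM a0 mulr0.
- by rewrite rmorph1 => /eqP; rewrite oner_eq0.
by rewrite rmorphM => /eqP; rewrite mulf_eq0 => /orP[]/eqP; [left | right].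
Qed.

Lemma preimage_prime (B C : comNzRingType) (f : {rmorphism B -> C}) (P : set C) :
  is_prime_ideal P -> is_prime_ideal [set b | P (f b)].
Proof.
move=> [[P0 PD PM] P1 Pprime]; split=> [|/=|a b /=].
- split=> [/=|a b /=|c a /=]; first by rewrite rmorph0.
    by rewrite rmorphD; exact: PD.
  by rewrite rmorphM; exact: PM.
- by rewrite rmorph1.
by rewrite rmorphM; exact: Pprime.
Qed.

Lemma prime_expn (B : comNzRingType) (P : set B) b n :
  is_prime_ideal P -> P (b ^+ n) -> P b.
Proof.
move=> [_ P1 Pprime]; elim: n => [|n IH]; first by rewrite expr0.
by rewrite exprS => /Pprime[].
Qed.

(** Powers of x cancel modulo [Pa], since x is not in this prime, so the sum may start at its first
    marked index; its other terms are multiples of x, which is in [Pb]. The predicate [nz] marks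
    formally nonzero coefficients, whose value may still be 0. *)
Lemma lowest_coef (D : comNzRingType) (Pa Pb : set D) (x : D) :
    is_prime_ideal Pa -> is_prime_ideal Pb -> (forall b, Pa b -> Pb b) ->
    Pb x -> ~ Pa x ->
  forall n (a : nat -> D) (nz : nat -> Prop),
    (forall i, ~ nz i -> a i = 0) -> (exists2 i, (i < n)%N & nz i) ->
    Pa (\sum_(i < n) a i * x ^+ i) ->
  exists i, [/\ (i < n)%N, nz i & Pb (a i)].
Proof.
move=> [_ _ Pa_prime] [[_ PbD PbM] _ _] Pab Pbx Pax; elim=> [|n IH] a nz a0.
  by case.
move=> [i lt_i nzi]; rewrite big_ord_recl /= expr0 mulr1.
have -> : \sum_(i < n) a (bump 0 i) * x ^+ bump 0 i =
    x * \sum_(i < n) a i.+1 * x ^+ i.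
  rewrite mulr_sumr; apply: eq_bigr => k _.
  by rewrite /bump add1n exprS mulrCA.
have [nz0|nz0] := EM (nz 0%N) => Pa0.
  exists 0%N; split=> //; set t := \sum_(i < n) _ in Pa0.
  have -> : a 0%N = (a 0%N + x * t) + (- t) * x by rewrite mulNr mulrC addrK.
  by apply: PbD (Pab _ Pa0) (PbM _ _ Pbx).
move: Pa0; rewrite a0 // add0r => /Pa_prime[//|] /(IH (fun i => a i.+1) (fun i => nz i.+1))[||k [lt_k nzk Pbk]].
- by move=> k; apply: a0.
- by case: i lt_i nzi => // i lt_i nzi; exists i.
by exists k.+1.
Qed.

(** * Chains of primes in F[X, Y] *)

Section AlgebraicDependence.
Variable F : fieldType.
Local Notation A := {mpoly F[2]}.

Definition mdeg_le (f : A) (d : nat) : Prop := forall m, f@_m != 0 -> (mdeg m <= d)%N.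

Lemma mdeg_leM f g d e : mdeg_le f d -> mdeg_le g e -> mdeg_le (f * g) (d + e).
Proof.
move=> fd ge m /mcoeffM_neq0[m1 [m2 [-> fg]]]; rewrite mdegD leq_add //.
  by apply: fd; apply: contraNneq fg => ->; rewrite mul0r.
by apply: ge; apply: contraNneq fg => ->; rewrite mulr0.
Qed.

Lemma mdeg_leX f d n : mdeg_le f d -> mdeg_le (f ^+ n) (n * d).
Proof.
move=> fd; elim: n => [|n IH]; last by rewrite exprS mulSn; exact: mdeg_leM.
by move=> m; rewrite expr0 mcoeff1; have [->|_] := eqVneq m 0%MM; rewrite ?mdeg0 // eqxx.
Qed.

Definition mnm2 (a b : nat) : 'X_{1..2} := [multinom (if i == 0%R then a else b) | i < 2].

Lemma mnm2K (m : 'X_{1..2}) : mnm2 (m 0%R) (m 1%R) = m.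
Proof.
apply/mnmP => i; rewrite mnmE; have [->//|] := eqVneq i 0%R.
by case: i => [[|[|i]]] // lt_i _; congr (m _); apply: val_inj.
Qed.

Definition box (d : nat) : seq A^o :=
  [seq ('X_[mnm2 a b] : A^o) | a <- iota 0 d, b <- iota 0 d].

Lemma box_span d (f : A) : mdeg_le f d -> fspan (box d.+1) (f : A^o).
Proof.
move=> fd; rewrite [f]mpolyE; apply: fspan_sum_mem => m.
rewrite mcoeff_msupp => /fd le_d _.
have -> : f@_m *: 'X_[m] = (f@_m)%:A *: ('X_[m] : A^o) + 0 :> A^o.
  by rewrite addr0 -[RHS]/((f@_m)%:A * 'X_[m]) -scalerAl mul1r.
apply/fspanP/fspan0/fspan_mem/allpairsP; exists (m 0%R, m 1%R).
move: le_d; rewrite mdeg2E => le_d.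
by split; rewrite ?mem_iota ?mnm2K //= add0n ltnS; lia.
Qed.

(** A count: N^3 products of powers against at most (3 N e + 1)^2 monomials in two variables. The
    sum is nested so that lowest coefficients can be taken one variable at a time. *)
Lemma algebraic_dependence (x0 x1 x2 : A) :
  exists N (c : nat -> nat -> nat -> F),
    [/\ (exists i j l, [/\ (i < N)%N, (j < N)%N, (l < N)%N & c i j l != 0])
      & \sum_(i < N) (\sum_(j < N) (\sum_(l < N) (c i j l)%:A * x2 ^+ l)
          * x1 ^+ j) * x0 ^+ i = 0].
Proof.
pose e := maxn (msize x0) (maxn (msize x1) (msize x2)).
have le_e x : x \in [:: x0; x1; x2] -> mdeg_le x e.
  move=> xx m; rewrite -mcoeff_msupp => /msize_mdeg_lt/ltnW/leq_trans; apply.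
  by move: xx; rewrite !inE => /or3P[]/eqP->; rewrite /e !leq_max leqnn ?orbT.
(* With t = 3 e + 1 the degrees are at most 3 e N < t N, and N > t^2 gives (3 e N + 1)^2 <= t^2 N^2
   < N^3. *)
pose N := ((3 * e + 1) ^ 2).+1; pose d := (N * e + N * e + N * e)%N.
pose I := ('I_N * ('I_N * 'I_N))%type.
pose v (k : I) : A := x2 ^+ k.2.2 * x1 ^+ k.2.1 * x0 ^+ k.1.
have vd k : mdeg_le (v k) d.
  have mono (i : 'I_N) : (i * e <= N * e)%N by rewrite leq_mul2r ltnW ?orbT.
  have le_le f a b : (a <= b)%N -> mdeg_le f a -> mdeg_le f b.
    by move=> le_ab fa m /fa /leq_trans; apply.
  apply: mdeg_leM; first apply: mdeg_leM; apply: le_le (mono _) _; apply: mdeg_leX;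
    by apply: le_e; rewrite !inE eqxx ?orbT.
have size_box : (size (box d.+1) < #|{: I}|)%N.
  rewrite size_allpairs size_iota !card_prod !card_ord.
  have key t n D : (D < t * n -> t * t < n -> D.+1 * D.+1 < n * (n * n))%N.
    move=> Dtn ttn; have n0 : (0 < n)%N by apply: leq_ltn_trans ttn.
    apply: leq_ltn_trans (leq_mul Dtn Dtn) _.
    by rewrite mulnACA ltn_pmul2r // muln_gt0 n0.
  by apply: (key (3 * e + 1)%N); rewrite /d /N; lia.
have [|u [k uk] u0] := @fspan_dep F A A^o (box d.+1) #|{: I}| (fun k => v (enum_val k)) size_box.
  by move=> i; apply: box_span; exact: vd.
pose c i j l : F := if insub i is Some i' then if insub j is Some j' then
  if insub l is Some l' then u (enum_rank ((i', (j', l')) : I)) else 0 else 0 else 0.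
have cE (k' : I) : c k'.1 k'.2.1 k'.2.2 = u (enum_rank k').
  by case: k' => i [j l]; rewrite /c /= !valK.
exists N, c; split.
  exists (enum_val k).1, (enum_val k).2.1, (enum_val k).2.2.
  by rewrite cE enum_valK; split.
rewrite -[RHS]u0 (reindex (fun k : I => enum_rank k)) /=; last first.
  by exists enum_val => k' _; [exact: enum_rankK | exact: enum_valK].
rewrite sum_pairE; apply: eq_bigr => i _.
rewrite sum_pairE mulr_suml; apply: eq_bigr => i' _.
rewrite !mulr_suml; apply: eq_bigr => l _.
rewrite enum_rankK -(cE (i, (i', l))) /v /=.
by rewrite -[RHS]/((c i i' l)%:A * (x2 ^+ l * x1 ^+ i' * x0 ^+ i)) !mulrA.
Qed.

(** Given four primes, let x_i lie in the (i+1)-st but not in the i-th. In a polynomial relation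
    among x_0, x_1, x_2, successive lowest coefficients lie in the second, third and fourth prime;
    the last one is a nonzero constant. *)
Lemma mpoly2_chain (n : nat) (Q : nat -> set A) : prime_chain n Q -> (n <= 2)%N.
Proof.
move=> [Qp QS]; rewrite leqNgt; apply/negP => lt2n.
have lt_n i : (i <= 3)%N -> (i <= n)%N by move=> le_i; apply: leq_trans lt2n.
have step i : (i < 3)%N -> exists x, Q i.+1 x /\ ~ Q i x.
  move=> lt_i; have [_ /existsNP[x /not_implyP[Qx nQx]]] := QS i (lt_n _ lt_i).
  by exists x.
have sub i : (i < 3)%N -> forall x, Q i x -> Q i.+1 x.
  by move=> lt_i; have [] := QS i (lt_n _ lt_i).
have [x0 [Q1x0 Q0x0]] := step 0%N isT; have [x1 [Q2x1 Q1x1]] := step 1%N isT.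
have [x2 [Q3x2 Q2x2]] := step 2%N isT.
have P0 := Qp _ (lt_n 0%N isT); have P1 := Qp _ (lt_n 1%N isT).
have P2 := Qp _ (lt_n 2%N isT); have P3 := Qp _ (lt_n 3%N isT).
have [N [c [[i [j [l [lt_i lt_j lt_l cn0]]]] sum0]]] := algebraic_dependence x0 x1 x2.
pose q2 i j l : A := (c i j l)%:A.
pose q1 i j := \sum_(l < N) q2 i j l * x2 ^+ l.
pose q0 i := \sum_(j < N) q1 i j * x1 ^+ j.
pose nz2 i j l := (l < N)%N /\ c i j l != 0.
pose nz1 i j := (j < N)%N /\ exists l, nz2 i j l.
pose nz0 i := exists j, nz1 i j.
have q1_0 i' j' : (j' < N)%N -> ~ nz1 i' j' -> q1 i' j' = 0.
  move=> lt_j' nz; rewrite /q1 big1 // => l' _; rewrite /q2.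
  have [->|c0] := eqVneq (c i' j' l') 0; first by rewrite scale0r mul0r.
  by case: nz; split=> //; exists l'; split.
have [|||i' [_ [j' [lt_j' [l' [lt_l' c']]]] Q1q]] :=
  lowest_coef P0 P1 (sub 0%N isT) Q1x0 Q0x0 (n := N) (a := q0) (nz := nz0).
- move=> i' nz; rewrite /q0 big1 // => j' _.
  by rewrite q1_0 ?mul0r // => nz'; case: nz; exists j'.
- by exists i => //; exists j; split=> //; exists l; split.
- by rewrite [X in Q 0%N X]sum0; case: P0 => -[].
have [|||j'' [lt_j'' [_ [l'' [lt_l'' c'']]] Q2q]] :=
  lowest_coef P1 P2 (sub 1%N isT) Q2x1 Q1x1 (n := N)
   (a := fun j => if (j < N)%N then q1 i' j else 0) (nz := nz1 i').
- by move=> k nz; case: ifP => // lt_k; exact: q1_0.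
- by exists j' => //; split=> //; exists l'; split.
- by move: Q1q; rewrite /q0; congr (Q _ _); apply: eq_bigr => k _; rewrite ltn_ord.
rewrite lt_j'' in Q2q.
have [|||l3 [lt_l3 [_ c3] Q3q]] :=
  lowest_coef P2 P3 (sub 2%N isT) Q3x2 Q2x2 (n := N)
   (a := fun l => if (l < N)%N then q2 i' j'' l else 0) (nz := nz2 i' j'').
- move=> k nz; case: ifP => // lt_k; rewrite /q2.
  have [->|c0] := eqVneq (c i' j'' k) 0; first by rewrite scale0r.
  by case: nz; split.
- by exists l'' => //; split.
- by move: Q2q; rewrite /q1; congr (Q _ _); apply: eq_bigr => k _; rewrite ltn_ord.
have [[Q30 _ Q3M] Q31 _] := P3; apply: Q31.
move: Q3q; rewrite lt_l3 => /(Q3M (c i' j'' l3)^-1%:A).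
by rewrite /q2 -algM mulVf // scale1r.
Qed.

End AlgebraicDependence.

Section HypersurfaceDimension.
Variables (F : fieldType) (p : nat).
Hypotheses (charFp : p \in [pchar F]) (p_gt2 : (2 < p)%N).
Local Notation A := {mpoly F[2]}.
Local Notation R := (hyp_ring F p).
Local Notation hpi := (hyp_pi F p).
Local Notation j := (hyp_emb charFp).

Definition eval_y0 : A -> A := comp_mpoly [tuple 'X_0; 0].
HB.instance Definition _ := GRing.RMorphism.on eval_y0.

Definition eval_00 : A -> F := meval (fun=> 0).
HB.instance Definition _ := GRing.RMorphism.on eval_00.

Lemma eval_y0_x : eval_y0 'X_0 = 'X_0.
Proof. by rewrite /eval_y0 comp_mpolyXU. Qed.

Lemma eval_y0_y : eval_y0 'X_1 = 0.
Proof. by rewrite /eval_y0 comp_mpolyXU. Qed.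

Lemma eval_00_X i : eval_00 'X_i = 0.
Proof. by rewrite /eval_00 mevalXU. Qed.

Lemma eval_00_y0 f : eval_00 (eval_y0 f) = eval_00 f.
Proof.
rewrite /eval_00 /eval_y0 comp_mpoly_meval; apply: meval_eq => i.
by rewrite (tnth_nth 0); case: i => [[|[|]]] //= _; rewrite ?mevalXU ?meval0.
Qed.

Lemma mpolyX_neq0 n (S : comNzRingType) i : ('X_i : {mpoly S[n]}) != 0.
Proof.
apply/eqP => /(congr1 (mcoeff U_(i))); rewrite mcoeffX eqxx mcoeff0 => /eqP.
by rewrite oner_eq0.
Qed.

(** The chain of length 2 pulls back zero, Y = 0 and the origin along the embedding in F[X, Y]. The
    upper bound pulls chains back along [theta charFp 0], which sends the image of r to r^p; as
    primes contain r with r^p, inclusions stay strict. *)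
Lemma hyp_krull_dim : is_krull_dim R 2.
Proof.
have p0 := p_gt0 p_gt2; split.
  pose f1 : R -> A := eval_y0 \o j; pose f2 : R -> F := eval_00 \o j.
  pose Q (i : nat) : set R :=
    if i is 0%N then [set r | j r = 0]%classic
    else if i is 1%N then [set r | f1 r = 0]%classic
    else [set r | f2 r = 0]%classic.
  exists Q; split=> [[|[|i]] _ /=|[|[|//]] _].
  - exact: kernel_prime.
  - exact: (kernel_prime (eval_y0 \o j)).
  - exact: (kernel_prime (eval_00 \o j)).
  - split=> [r /= r0|/(_ (hpi 'X_1))]; first by rewrite /f1 /= r0 rmorph0.
    rewrite /Q /f1 /= hyp_emb_y rmorphXn /= eval_y0_y expr0n gtn_eqF // => /(_ erefl).
    by move/eqP; rewrite expf_eq0 p0 (negbTE (mpolyX_neq0 _ _)).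
  split=> [r /= r0|/(_ (hpi 'X_0))].
    by rewrite /f2 /= -eval_00_y0 -[eval_y0 _]/(f1 r) r0 rmorph0.
  rewrite /Q /f2 /f1 /= hyp_emb_x !rmorphXn /= eval_00_X eval_y0_x expr0n gtn_eqF // => /(_ erefl).
  by move/eqP; rewrite expf_eq0 p0 (negbTE (mpolyX_neq0 _ _)).
move=> n Q [Qp QS]; pose th := theta charFp 0.
apply: (@mpoly2_chain F n (fun i => [set f | Q i (th f)]%classic)).
split=> [i le_i|i lt_i]; first exact: (preimage_prime (theta charFp 0)) (Qp i le_i).
have [sub /existsNP[r /not_implyP[Qr nQr]]] := QS i lt_i.
split=> [f /=|/(_ (j r))]; first exact: sub.
have thr : th (j r) = r ^+ p by rewrite /th theta_emb expn1.
rewrite /= thr => H; apply: nQr; apply: (prime_expn (n := p)); first exact: Qp (ltnW lt_i).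
apply: H; have [[_ _ QM] _ _] := Qp _ lt_i.
by have -> : r ^+ p = r ^+ p.-1 * r; [rewrite -exprSr prednK | exact: QM].
Qed.

End HypersurfaceDimension.

(** * Cech cohomology and the a-invariant *)

Section IdealTools.
Variable B : comNzRingType.

Lemma ideal_gen_ideal (s : seq B) : is_ideal (ideal_gen s).
Proof.
split=> [|a b [c ->] [c' ->]|r a [c ->]].
- by exists (fun=> 0); rewrite big1 // => i _; rewrite mul0r.
- exists (fun i => c i + c' i); rewrite -big_split.
  by apply: eq_bigr => i _; rewrite mulrDl.
exists (fun i => r * c i); rewrite mulr_sumr.
by apply: eq_bigr => i _; rewrite mulrA.
Qed.

Lemma ideal_gen_nth (s : seq B) i : (i < size s)%N -> ideal_gen s s`_i.
Proof.
move=> lt_i; exists (fun k => (k == i)%:R).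
rewrite (bigD1 (Ordinal lt_i)) //= eqxx mul1r big1 ?addr0 // => k ne_k.
by rewrite -[_ == i]/(k == Ordinal lt_i) (negbTE ne_k) mul0r.
Qed.

Lemma ideal_sum (Q : set B) (I : eqType) (r : seq I) (P : pred I) (h : I -> B) :
  is_ideal Q -> (forall i, i \in r -> P i -> Q (h i)) -> Q (\sum_(i <- r | P i) h i).
Proof.
move=> [Q0 QD _] Qh; rewrite big_seq_cond; elim/big_rec: _ => // i x /andP[ri Pi].
by apply: QD; exact: Qh.
Qed.

End IdealTools.

Section IrrelevantIdeal.
Variables (F : fieldType) (B : comAlgType F) (G : grading B).

Lemma irrelevantE b : irrelevant_ideal G b <-> gproj G 0 b = 0.
Proof.
split=> [[n [h [Gh h0 ->]]]|b0].
  rewrite linear_sum big1 // => d _; rewrite (gprojE _ (Gh d)).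
  by case: eqP => [d0|//]; rewrite d0 h0.
have [n bE] := gproj_dec G b; exists n, (fun d => gproj G d b).
by split=> // d; exact: gproj_piece.
Qed.

Lemma gproj0_mull d c b : (0 < d)%N -> G d b -> gproj G 0 (c * b) = 0.
Proof.
move=> d0 Gb; have [n ->] := gproj_dec G c.
rewrite mulr_suml linear_sum big1 // => i _.
by rewrite (gprojE _ (pieceM (gproj_piece G i c) Gb)) gtn_eqF // addn_gt0 d0 orbT.
Qed.

Lemma irrelevant_is_ideal : is_ideal (irrelevant_ideal G).
Proof.
split=> [|a b /irrelevantE a0 /irrelevantE b0|c a [n [h [Gh h0 ->]]]].
- by apply/irrelevantE; rewrite linear0.
- by apply/irrelevantE; rewrite linearD a0 b0 addr0.
apply/irrelevantE; rewrite mulr_sumr linear_sum big1 // => d _.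
have [d0|d0] := posnP d; first by rewrite d0 h0 mulr0 linear0.
exact: gproj0_mull d0 (Gh d).
Qed.

Lemma irrelevant_homog d b : (0 < d)%N -> G d b -> irrelevant_ideal G b.
Proof. by move=> d0 Gb; apply/irrelevantE; rewrite -[b]mul1r (gproj0_mull _ d0). Qed.

Lemma irrelevant_maximal : connected G -> is_maximal_ideal (irrelevant_ideal G).
Proof.
move=> conG; split; first exact: irrelevant_is_ideal.
  move=> /irrelevantE; rewrite gproj_id; last exact: piece1.
  by move/eqP; rewrite oner_eq0.
move=> I [I0 ID IM] [sub /existsNP[b /not_implyP[Ib nb]]].
have [c cE] := conG _ (gproj_piece G 0 b).
have c0 : c != 0.
  by apply/eqP => c0; apply: nb; apply/irrelevantE; rewrite cE c0 scale0r.
have Ic : I c%:A.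
  have -> : c%:A = b + (-1) * (b - c%:A) by rewrite mulN1r opprB addrC subrK.
  apply: (ID _ _ Ib); apply: IM; apply/sub/irrelevantE.
  by rewrite linearB -cE (gproj_id (gproj_piece G 0 b)) subrr.
by have := IM c^-1%:A _ Ic; rewrite -algM mulVf // scale1r.
Qed.

End IrrelevantIdeal.

Lemma dom_mulI (B : comNzRingType) : (forall a b : B, a * b = 0 -> a = 0 \/ b = 0) ->
  forall a b c : B, a != 0 -> a * b = a * c -> b = c.
Proof.
move=> domB a b c a0 abc; apply/subr0_eq; have [|aE|//] := domB a (b - c).
  by rewrite mulrBr abc subrr.
by rewrite aE eqxx in a0.
Qed.

Section CechThree.
Variables (F : fieldType) (B : comAlgType F) (G : grading B).
Hypothesis domB : forall a b : B, a * b = 0 -> a = 0 \/ b = 0.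
Variables (x y z : B).
Hypotheses (x0 : x != 0) (y0 : y != 0) (z0 : z != 0).
Local Notation f := [:: x; y; z].
Local Notation idx := {set 'I_(size f)}.
Local Notation i0 := (@Ordinal (size f) 0 isT).
Local Notation i1 := (@Ordinal (size f) 1 isT).
Local Notation i2 := (@Ordinal (size f) 2 isT).

Lemma dom_expf (a : B) n : a != 0 -> a ^+ n != 0.
Proof.
move=> a0; elim: n => [|n IH]; first by rewrite expr0 oner_eq0.
rewrite exprS; apply: contraNneq a0 => /domB[->|/eqP E]; first by rewrite eqxx.
by rewrite E in IH.
Qed.

Lemma cech_den_neq0 (J : idx) : cech_den J != 0.
Proof.
rewrite /cech_den; elim/big_rec: _ => [|i a _ a0]; first exact: oner_neq0.
have fi : f`_i != 0 by case: i => [[|[|[|]]]].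
by apply: contraNneq fi => /domB[-> //|/eqP E]; rewrite E in a0.
Qed.

(** In a domain the denominators are nonzero, so equality of fractions is cross multiplication. *)
Lemma eq_fracE (J : idx) a t b u :
  eq_frac J a t b u <-> cech_den J ^+ u * a = cech_den J ^+ t * b.
Proof.
split=> [[k]|E]; last by exists 0%N; rewrite E subrr mulr0.
move=> /domB[/eqP E|/subr0_eq//].
by rewrite (negbTE (dom_expf _ (cech_den_neq0 J))) in E.
Qed.

Lemma cech_diff2 (i k : 'I_(size f)) t (a : idx -> B) : (i < k)%N ->
  cech_diff t a [set i; k] = f`_i ^+ t * a [set k] - f`_k ^+ t * a [set i].
Proof.
move=> lt_ik; have ne_ik : i != k by rewrite -val_eqE /= ltn_eqF.
rewrite /cech_diff big_setU1 ?inE //= big_set1.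
have -> : [set l in [set i; k] | (l < i)%N]%SET = finset.set0.
  apply/setP => l; rewrite !inE; apply/negP => /andP[/orP[]/eqP->].
    by rewrite ltnn.
  by rewrite ltnNge ltnW.
have -> : [set l in [set i; k] | (l < k)%N]%SET = [set i].
  apply/setP => l; rewrite !inE; have [->|ne_li] := eqVneq l i; first by rewrite lt_ik.
  by have [->|//] := eqVneq l k; rewrite ltnn.
have -> : ([set i; k] :\ i = [set k])%SET.
  by apply/setP => l; rewrite !inE; have [->|//] := eqVneq l i; rewrite (negbTE ne_ik).
have -> : ([set i; k] :\ k = [set i])%SET.
  apply/setP => l; rewrite !inE; have [->|//] := eqVneq l k; last by rewrite orbF.
  by rewrite eq_sym (negbTE ne_ik).
by rewrite cards0 cards1 expr0 expr1 mul1r mulN1r.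
Qed.

Lemma idx_card2 (J : idx) : #|J| = 2%N ->
  [\/ J = [set i0; i1]%SET, J = [set i0; i2]%SET | J = [set i1; i2]%SET].
Proof.
move=> /eqP/cards2P[a [b [ne_ab ->]]].
have cases (c : 'I_(size f)) : [\/ c = i0, c = i1 | c = i2].
  case: c => [[|[|[|//]]] lt_c]; [apply: Or31|apply: Or32|apply: Or33]; exact: val_inj.
case: (cases a) ne_ab => ->; case: (cases b) => ->; rewrite ?eqxx //= => _;
  first [by apply: Or31 | by apply: Or32 | by apply: Or33 | by rewrite finset.setUC; apply: Or31
    | by rewrite finset.setUC; apply: Or32 | by rewrite finset.setUC; apply: Or33].
Qed.

Lemma idx_card3 (J : idx) : #|J| = 3%N -> J = [set: 'I_(size f)]%SET.
Proof. by move=> J3; apply/eqP; rewrite eqEcard finset.subsetT cardsT card_ord J3. Qed.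

Lemma cech_diff3 t (a : idx -> B) : cech_diff t a [set: 'I_(size f)]%SET =
  x ^+ t * a [set i1; i2]%SET - y ^+ t * a [set i0; i2]%SET + z ^+ t * a [set i0; i1]%SET.
Proof.
rewrite /cech_diff.
have cardE (i : 'I_(size f)) : #|[set k in [set: 'I_(size f)]%SET | (k < i)%N]%SET| = i.
  rewrite -sum1_card big_mkcond /= !big_ord_recl big_ord0 !inE /=.
  by case: i => [[|[|[|]]]].
under eq_bigr => i _ do rewrite cardE.
rewrite (eq_bigl xpredT) => [|i]; last by rewrite inE.
rewrite !big_ord_recl big_ord0 /= addr0 expr0 mul1r expr1 mulN1r.
rewrite addrA; congr (_ ^+ t * a _ - _ ^+ t * a _ + _).
- by apply/setP => -[[|[|[|]]]] // lt_k; rewrite !inE.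
- by apply/setP => -[[|[|[|]]]] // lt_k; rewrite !inE.
rewrite /bump /= expr2 mulrNN !mul1r; congr (_ * a _).
by apply/setP => -[[|[|[|]]]] // lt_k; rewrite !inE.
Qed.

Variables dx dy dz : nat.
Local Notation D := (fun k => nth 0%N [:: dx; dy; dz] k).

Lemma sum_set2 (V : nmodType) (h : 'I_(size f) -> V) (i k : 'I_(size f)) : (i < k)%N ->
  \sum_(l in [set i; k]%SET) h l = h i + h k.
Proof.
move=> lt_ik; have ne_ik : i != k by rewrite -val_eqE /= ltn_eqF.
by rewrite big_setU1 ?inE //= big_set1.
Qed.

Lemma cech_den2 : cech_den [set i0; i1]%SET = x * y.
Proof. by rewrite /cech_den big_setU1 ?inE //= big_set1. Qed.

(* The class of w / (x y) is nonzero. *)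
Lemma cech_neq0 (w a b : B) (n : int) :
    z * w = x * a + y * b ->
    zpiece G (n + (dx + dy)%:Z) w -> zpiece G (n + (dx + dz)%:Z) b ->
    zpiece G (n + (dy + dz)%:Z) a ->
    (forall u c c', x ^+ u * y ^+ u * w <> x ^+ u.+1 * c + y ^+ u.+1 * c') ->
  local_cohomology_neq0 G f D 2 n.
Proof.
move=> zw Gw Gb Ga w_n0.
(* The cochain w / (x y), b / (x z), - a / (y z): its only cocycle condition is z w = x a + y b. *)
pose h (J : idx) : B := if i2 \notin J then w else if i1 \notin J then b else - a.
exists 1%N, h; split.
- have GaN : zpiece G (n + (dy + dz)%:Z) (- a).
    case: Ga => [->|[d [nE Ga]]]; [left; exact: oppr0 | right; exists d].
    by split=> //; rewrite -scaleN1r; exact: pieceZ.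
  by move=> J /idx_card2[] ->; rewrite sum_set2 // mul1n /h !inE.
- move=> J /idx_card3 ->; apply/eq_fracE; rewrite expr0 mul1r mulr0 cech_diff3 !expr1.
  rewrite /h !inE /= zw mulrN; ring.
(* The component at {x, y} alone would put (x y)^u w in the ideal of x^{u+1} and y^{u+1}. *)
move=> [u [c cE]].
have J2 : #|[set i0; i1]%SET| = 2%N by rewrite cards2.
move/eq_fracE: (cE _ J2); rewrite cech_diff2 // cech_den2 expr1 /= /h !inE /=.
set b1 := c [set i1]%SET; set b0 := c [set i0]%SET => E.
apply: (w_n0 u (y * b1) (- (x * b0))); rewrite -exprMn_comm; last exact: mulrC.
by rewrite E !exprS; ring.
Qed.

(** The first hypothesis makes the component at {x, y} a coboundary of cochains at {x} and {y};
    coprimality of x^t and y^t then supplies the cochain at {z}. *)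
Lemma cech_eq0 (n : int) :
    (forall t r, zpiece G (n + (t * (dx + dy))%:Z) r ->
       exists b b', r = x ^+ t * b + y ^+ t * b') ->
    (forall t r s, y ^+ t * r = x ^+ t * s -> exists c, r = x ^+ t * c) ->
  ~ local_cohomology_neq0 G f D 2 n.
Proof.
move=> H1 H2 [t [a [aG a_coc []]]].
have [|b [b' a01]] := H1 t (a [set i0; i1]%SET).
  by have := aG [set i0; i1]%SET; rewrite sum_set2 //; apply; rewrite cards2.
have coc := a_coc [set: 'I_(size f)]%SET (etrans (cardsT _) (card_ord 3)).
move/eq_fracE: coc; rewrite expr0 mul1r mulr0 cech_diff3 a01.
set a12 := a [set i1; i2]%SET; set a02 := a [set i0; i2]%SET => coc.
(* Substituting x^t b + y^t b' for the component at {x, y}, the cocycle condition becomes y^t (a02 -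
   z^t b') = x^t (a12 + z^t b). *)
have [|c cE] := H2 t (a02 - z ^+ t * b') (a12 + z ^+ t * b).
  apply/eqP; rewrite eq_sym -subr_eq0 -[X in _ == X]coc; apply/eqP; ring.
have a12E : a12 = y ^+ t * c - z ^+ t * b.
  apply: (dom_mulI domB (dom_expf t x0)); apply/subr0_eq.
  have a02c : a02 = x ^+ t * c + z ^+ t * b' by rewrite -cE subrK.
  rewrite -[RHS]coc a02c; ring.
have a02E : a02 = x ^+ t * c - z ^+ t * (- b').
  by rewrite mulrN opprK -cE subrK.
exists t, (fun J : idx => if i0 \in J then - b' else if i1 \in J then b else c) => J.
move=> /idx_card2[] ->; apply/eq_fracE; congr (_ * _);
  rewrite cech_diff2 // !inE /=.
- by rewrite a01 mulrN opprK.
- exact: a02E.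
exact: a12E.
Qed.

End CechThree.

Section MonomialDivision.
Variables (K : comNzRingType) (n : nat).
Implicit Types (f g : {mpoly K[n]}) (m : 'X_{1..n}) (i j : 'I_n).

Lemma mnmUn_le i t m : (U_(i) *+ t <= m)%MM = (t <= m i)%N.
Proof.
apply/mnm_lepP/idP => [/(_ i)|le_t j]; first by rewrite mulmnE mnm1E eqxx mul1n.
by rewrite mulmnE mnm1E; case: eqP => [<-|_]; rewrite ?mul1n.
Qed.

Lemma mpolyX_divX i t m : (t <= m i)%N ->
  'X_[m] = 'X_i ^+ t * 'X_[m - U_(i) *+ t] :> {mpoly K[n]}.
Proof. by move=> le_t; rewrite mpolyXn -mpolyXD addmC submK // mnmUn_le. Qed.

Lemma mcoeffXnM i t f m : (m i < t)%N -> ('X_i ^+ t * f)@_m = 0.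
Proof.
move=> lt_m; have [//|/mcoeffM_neq0[m1 [m2 [mE]]]] := eqVneq ('X_i ^+ t * f)@_m 0.
rewrite mpolyXn mcoeffX; have [m1E|_] := eqVneq _ m1; last by rewrite mul0r eqxx.
by move: lt_m; rewrite mE -m1E mnmDE mulmnE mnm1E eqxx mul1n ltnNge leq_addr.
Qed.

Lemma mcoeffXnMD i t f m : ('X_i ^+ t * f)@_(m + U_(i) *+ t) = f@_m.
Proof. by rewrite mpolyXn mulrC addmC mcoeffMX. Qed.

Lemma mpoly_divX2 i j t f : (forall m, f@_m != 0 -> (t <= m i)%N || (t <= m j)%N) ->
  exists g h, f = 'X_i ^+ t * g + 'X_j ^+ t * h.
Proof.
move=> fP; rewrite [f]mpolyE big_seq.
elim/big_rec: _ => [|m q]; first by exists 0, 0; rewrite !mulr0 addr0.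
rewrite mcoeff_msupp => /fP le_t [g [h ->]].
case/orP: le_t => le_t; rewrite (mpolyX_divX le_t).
  exists (f@_m *: 'X_[m - U_(i) *+ t] + g), h.
  by rewrite [X in _ = X + _]mulrDr -scalerAr addrA.
exists g, (f@_m *: 'X_[m - U_(j) *+ t] + h).
by rewrite [X in _ = _ + X]mulrDr -scalerAr addrCA.
Qed.

Lemma mpoly_divX i t f : (forall m, f@_m != 0 -> (t <= m i)%N) ->
  exists g, f = 'X_i ^+ t * g.
Proof.
move=> fP; have [|g [h ->]] := @mpoly_divX2 i i t f; last first.
  by exists (g + h); rewrite mulrDr.
by move=> m /fP ->.
Qed.

Lemma mpoly_coprimeX i j s t f g : i != j ->
  'X_j ^+ t * f = 'X_i ^+ s * g -> exists h, f = 'X_i ^+ s * h.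
Proof.
move=> ne_ij fg; apply: mpoly_divX => m; rewrite leqNgt; apply: contraNN => lt_m.
rewrite -(mcoeffXnMD j t) fg mcoeffXnM //.
by rewrite mnmDE mulmnE mnm1E eq_sym (negbTE ne_ij) addn0.
Qed.

End MonomialDivision.

(** Ideals generated by elements of E can be tested on coordinates. *)
Lemma free_along_divX2 (E T : comNzRingType) (th : {rmorphism E -> T}) (I : finType)
    (e : I -> T) (eF : free_along th e) (a b : E) (r : T) :
    (forall i, exists g h, coords eF r i = a * g + b * h) ->
  exists c c', r = th a * c + th b * c'.
Proof.
move=> rP; have /choice[g gE] : forall i, exists gh : E * E,
    coords eF r i = a * gh.1 + b * gh.2.
  by move=> i; have [g [h E']] := rP i; exists (g, h).
exists (\sum_i th (g i).1 * e i), (\sum_i th (g i).2 * e i).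
rewrite !mulr_sumr -big_split [r](coordsE eF).
by apply: eq_bigr => i _; rewrite gE rmorphD !rmorphM mulrDl !mulrA.
Qed.

Lemma free_along_divX (E T : comNzRingType) (th : {rmorphism E -> T}) (I : finType)
    (e : I -> T) (eF : free_along th e) (a : E) (r : T) :
    (forall i, exists g, coords eF r i = a * g) -> exists c, r = th a * c.
Proof.
move=> rP; have [|c [c' ->]] := @free_along_divX2 _ _ _ _ _ eF a 0 r.
  by move=> i; have [g ->] := rP i; exists g, 0; rewrite mulr0 addr0.
by exists c; rewrite rmorph0 mul0r addr0.
Qed.

Section HypersurfaceAInvariant.
Variables (F : fieldType) (p : nat).
Hypotheses (charFp : p \in [pchar F]) (p_gt2 : (2 < p)%N).
Local Notation A := {mpoly F[2]}.
Local Notation R := (hyp_ring F p).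
Local Notation hpi := (hyp_pi F p).
Local Notation G := (hyp_grading F p).
Local Notation x := (hpi 'X_0).
Local Notation y := (hpi 'X_1).
Local Notation z := (hpi 'X_2).
Local Notation hF := (hyp_free charFp p_gt2).
Local Notation cf := (coords hF).

Lemma hyp_coordsM a r k : cf (hyp_incl p a * r) k = a * cf r k.
Proof. by have := coordsM hF a r 0 k; rewrite coords0 !addr0. Qed.

Lemma hyp_xn n : x ^+ n = hyp_incl p ('X_0 ^+ n).
Proof. by rewrite rmorphXn /= hyp_incl0. Qed.

Lemma hyp_yn n : y ^+ n = hyp_incl p ('X_1 ^+ n).
Proof. by rewrite rmorphXn /= hyp_incl1. Qed.

Lemma hyp_graded (k : 'I_p) m (a : A) :
  G (p * m + 6 * k)%N (hyp_incl p (pihomog wt2 m a) * hyp_z F k).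
Proof.
apply: pieceM; last exact: hyp_piece_z.
rewrite [a]mpolyE (linear_sum (pihomog wt2 m)) (linear_sum (@hyp_incl F p)).
apply: piece_sum_closed => m' /=; rewrite pihomogZX.
case: eqP => [<-|_]; last by rewrite rmorph0; exact: (piece0 G).
by rewrite linearZ; apply: (@pieceZ _ _ G); exact: hyp_piece_incl.
Qed.

Lemma hyp_coords_deg d r (k : 'I_p) m : G d r -> (cf r k)@_m != 0 ->
  d = (p * wt2 m + 6 * k)%N.
Proof.
move=> Gr nz; have := coords_graded hF (pihomog_grading F wt2) (p_gt0 p_gt2) hyp_graded k
  (wt2 m) Gr.
move=> /(congr1 (mcoeff m)); rewrite mcoeff_pihomog eqxx; case: eqP => // _ E.
by rewrite E mcoeff0 eqxx in nz.
Qed.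

(** This is where p - 6 comes from: x^i y^j z^k with i, j < t and k < p has degree at most 5p (t -
    1) + 6 (p - 1) = 5pt + p - 6. *)
Lemma hyp_xy_split t d r : G d r -> (5 * p * t + p < d + 6)%N ->
  exists b b', r = x ^+ t * b + y ^+ t * b'.
Proof.
move=> Gr lt_d; rewrite hyp_xn hyp_yn; apply: (free_along_divX2 (eF := hF)) => k.
apply: mpoly_divX2 => m nz; have dE := hyp_coords_deg Gr nz.
move: lt_d (ltn_ord k); rewrite dE wt2E.
have [//|lt_t] /= := leqP t (m 0); have [//|lt_t'] := leqP t (m 1).
have le_m : (3 * m 0%R + 2 * m 1%R + 5 <= 5 * t)%N by lia.
have := leq_mul (leqnn p) le_m; lia.
Qed.

Lemma hyp_xy_coprime t r s : y ^+ t * r = x ^+ t * s -> exists c, r = x ^+ t * c.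
Proof.
rewrite hyp_xn hyp_yn => rs; apply: (free_along_divX (eF := hF)) => k.
have := congr1 (fun r => cf r k) rs; rewrite !hyp_coordsM.
by move=> /mpoly_coprimeX; apply.
Qed.

(** On the coordinate along z^{p-1} the left side is X^u Y^u, which is not in the ideal of X^{u+1}
    and Y^{u+1}. *)
Lemma hyp_zpn_notin u c c' :
  x ^+ u * y ^+ u * z ^+ p.-1 <> x ^+ u.+1 * c + y ^+ u.+1 * c'.
Proof.
have lt_p : (p.-1 < p)%N by rewrite prednK // p_gt0.
pose k := Ordinal lt_p; move=> /(congr1 (fun r => cf r k)).
rewrite coordsD !hyp_xn !hyp_yn -rmorphM !hyp_coordsM.
have -> : cf (z ^+ p.-1) k = 1.
  have zE : z ^+ p.-1 = \sum_l hyp_incl p ((l == k)%:R) * hyp_z F l.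
    rewrite (bigD1 k) //= eqxx rmorph1 mul1r big1 ?addr0 // => l /negbTE ->.
    by rewrite rmorph0 mul0r.
  by rewrite zE coords_unique eqxx.
pose m : 'X_{1..2} := (U_((1 : 'I_2)%R) *+ u + U_((0 : 'I_2)%R) *+ u)%MM.
move=> /(congr1 (mcoeff m)); rewrite mulr1 mcoeffXnMD mcoeffD.
rewrite mcoeffXnM; last by rewrite mnmDE !mulmnE !mnm1E mul0n mul1n.
rewrite mcoeffXnM; last by rewrite mnmDE !mulmnE !mnm1E mul0n mul1n addn0.
by rewrite mpolyXn mcoeffX eqxx addr0 => /eqP; rewrite oner_eq0.
Qed.

Lemma hyp_xyz_neq0 : [/\ x != 0, y != 0 & z != 0].
Proof.
have inclI := hyp_incl_inj charFp p_gt2.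
have zn : x ^+ 0 * y ^+ 0 * z ^+ p.-1 <> 0.
  by move=> E; apply: (@hyp_zpn_notin 0 0 0); rewrite E !mulr0 addr0.
split.
- by rewrite -[x]expr1 hyp_xn expr1 -(rmorph0 (@hyp_incl F p)) (inj_eq inclI) mpolyX_neq0.
- by rewrite -[y]expr1 hyp_yn expr1 -(rmorph0 (@hyp_incl F p)) (inj_eq inclI) mpolyX_neq0.
apply/eqP => z0; apply: zn; rewrite z0 expr0n.
by case: (p) p_gt2 => [|[|q]] //= _; rewrite mulr0.
Qed.

Lemma hyp_irrelevant : ideal_gen [:: x; y; z] = irrelevant_ideal G.
Proof.
have [I0 ID IM] := ideal_gen_ideal [:: x; y; z].
apply/seteqP; split=> b.
  move=> [c ->]; have QI := irrelevant_is_ideal G; have [Q0 QD QM] := QI.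
  apply: ideal_sum => // i _ _; apply: QM; have p0 := p_gt0 p_gt2.
  case: i => -[|[|[|//]]] lt_i.
  - apply: (irrelevant_homog (d := 3 * p * 1)); first by rewrite !muln_gt0 p0.
    exact: hyp_piece_x charFp p_gt2 1.
  - apply: (irrelevant_homog (d := 2 * p * 1)); first by rewrite !muln_gt0 p0.
    exact: hyp_piece_y charFp p_gt2 1.
  exact: (irrelevant_homog (d := 6 * 1)) (hyp_piece_z charFp p_gt2 1).
move=> [n [h [Gh h0 ->]]]; apply: ideal_sum; first exact: ideal_gen_ideal.
move=> d _ _; case: d => -[_|d lt_d] /=; first by rewrite h0.
have [g [/dhomogP gP <-]] := Gh d.+1.
rewrite [g]mpolyE rmorph_sum big_seq; apply: ideal_sum; first exact: ideal_gen_ideal.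
move=> m mg _; have := gP _ mg; rewrite -[X in X = _]/(hyp_wdeg p m) hyp_wdegE => mE.
have gen i (lt_i : (i < 3)%N) (k : 'I_3) : (0 < m k)%N ->
    [:: x; y; z]`_i = hpi 'X_k -> ideal_gen [:: x; y; z] (hpi 'X_[m]).
  move=> m_gt0 iE; rewrite (mpolyX_divX F m_gt0) expr1 mulrC rmorphM.
  by apply: IM; have := @ideal_gen_nth _ [:: x; y; z] i lt_i; rewrite iE.
have hZ : hpi (g@_m *: 'X_[m]) = (g@_m)%:A * hpi 'X_[m].
  by rewrite linearZ -scalerAl mul1r.
rewrite -[X in _ X]/(hpi (g@_m *: 'X_[m])) hZ.
apply: IM; have [m0|m0] := posnP (m 0); last by apply: (gen 0%N isT 0).
have [m1|m1] := posnP (m 1); last by apply: (gen 1%N isT 1).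
have [m2|m2] := posnP (m 2); last by apply: (gen 2%N isT 2).
by move: mE; rewrite m0 m1 m2 !muln0.
Qed.

Lemma hyp_a_invariant : (7 <= p)%N -> is_a_invariant G (p%:Z - 6).
Proof.
move=> p7; have [x0 y0 z0] := hyp_xyz_neq0; have domR := hyp_domain charFp p_gt2.
exists 2%N, [:: x; y; z], (fun k => nth 0%N [:: 3 * p; 2 * p; 6]%N k); split.
- exact: hyp_krull_dim.
- case=> [|[|[|//]]] _ /=.
  + by have := hyp_piece_x charFp p_gt2 1; rewrite muln1 expr1.
  + by have := hyp_piece_y charFp p_gt2 1; rewrite muln1 expr1.
  by have := hyp_piece_z charFp p_gt2 1; rewrite expr1.
- exact: hyp_irrelevant.
(* From z z^{p-1} = x x + y y^2 the cocycle has a = x and b = y^2; its degree is 6 (p - 1) - 5p = p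
   - 6. *)
- apply: (@cech_neq0 _ _ G domR _ _ _ x0 y0 z0 _ _ _ (z ^+ p.-1) x (y ^+ 2)).
  + have wE : hyp_incl p (hyp_w F) = x ^+ 2 + y ^+ 3 by rewrite hyp_xn hyp_yn -rmorphD.
    rewrite -exprS prednK ?p_gt0 // hyp_zp wE.
    by rewrite -expr2 -exprS.
  + right; exists (6 * p.-1)%N; split; last exact: hyp_piece_z.
    by lia.
  + right; exists (2 * p * 2)%N; split; last exact: hyp_piece_y.
    by lia.
  + right; exists (3 * p * 1)%N; split; last exact: (hyp_piece_x charFp p_gt2 1).
    by lia.
  exact: hyp_zpn_notin.
move=> m lt_m; apply: (@cech_eq0 _ _ G domR _ _ _ x0 y0 z0); last exact: hyp_xy_coprime.
move=> t r [->|[d [dE Gr]]]; first by exists 0, 0; rewrite !mulr0 addr0.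
by apply: hyp_xy_split Gr _; lia.
Qed.

End HypersurfaceAInvariant.

(** * Depth and codimension of the Segre product *)

Section ShortIdeals.
Variable B : comNzRingType.
Implicit Types f g b : B.

Lemma ideal_gen0 b : ideal_gen [::] b -> b = 0.
Proof. by move=> [c ->]; rewrite big_ord0. Qed.

Lemma ideal_gen1 f b : ideal_gen [:: f] b <-> exists c, b = c * f.
Proof.
split=> [[c ->]|[c ->]]; first by exists (c 0%N); rewrite big_ord1.
by exists (fun=> c); rewrite big_ord1.
Qed.

Lemma ideal_gen2 f g b : ideal_gen [:: f; g] b <-> exists c d, b = c * f + d * g.
Proof.
split=> [[c ->]|[c [d ->]]].
  by exists (c 0%N), (c 1%N); rewrite !big_ord_recl big_ord0 addr0.
by exists (fun i => if i == 0%N then c else d); rewrite !big_ord_recl big_ord0 addr0.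
Qed.

End ShortIdeals.

Section DepthAtMostTwo.
Variables (B T : comNzRingType) (v : {rmorphism B -> T}).
Hypotheses (v_inj : injective v) (domT : forall a b : T, a * b = 0 -> a = 0 \/ b = 0).

Definition submodule_along (M : set T) : Prop :=
  forall a b c d, M a -> M b -> M (v c * a + v d * b).

(** M enters B after multiplication by e, and also by e', with e and e' coprime in T. For the
    twisted pieces these are powers of u and of v, so divisibility known in B can be brought back to
    M. *)
Definition pushed_by (M : set T) : Prop := exists e e' : T,
  [/\ e != 0, (forall r s, e' * r = e * s -> exists c, r = e * c),
      (forall r, M r -> exists b, e * r = v b)
    & (forall r, M r -> exists b, e' * r = v b)].

(** Multiplied by e, the relation lives in B, where g is regular modulo f, so f divides e r;
    likewise f divides e' r. Coprimality of e and e' removes them. *)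
Lemma pushed_divides (M : set T) (f g : B) (r s : T) : pushed_by M -> f != 0 ->
    (forall b, (exists c, g * b = c * f) -> exists c, b = c * f) ->
    M r -> M s -> v g * r = v f * s -> exists c, r = v f * c.
Proof.
move=> [e [e' [e0 coe eM e'M]]] f0 reg Mr Ms rs.
have vf0 : v f != 0 by rewrite -(rmorph0 v) (inj_eq v_inj).
have div a : (forall t, M t -> exists b, a * t = v b) -> exists c, a * r = v f * v c.
  move=> aM; have [r1 r1E] := aM r Mr; have [s1 s1E] := aM s Ms.
  have [|c cE] := reg r1; last by exists c; rewrite r1E cE rmorphM mulrC.
  exists s1; apply: v_inj; rewrite !rmorphM -r1E -s1E.
  by rewrite mulrCA rs mulrCA mulrC.
have [c cE] := div e eM; have [c' c'E] := div e' e'M.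
have [|d dE] := coe (v c) (v c').
  by apply: (dom_mulI domT vf0); rewrite mulrCA -cE [RHS]mulrCA -c'E mulrCA.
by exists d; apply: (dom_mulI domT e0); rewrite cE dE mulrCA.
Qed.

Variables (Q : set B) (MA MB : set T) (x y w : T).
Hypotheses (MAL : submodule_along MA) (MBL : submodule_along MB).
Hypotheses (MAx : MA x) (MBy : MB y) (MAP : pushed_by MA) (MBP : pushed_by MB).
Hypothesis x0 : x != 0.
Hypothesis xy_syz : forall r s, MA r -> y * r = x * s -> exists c, r = x * v c.
Hypothesis Qw : forall b, Q b -> exists r s, [/\ MA r, MB s & v b * w = y * r + x * s].
Hypothesis w_notin : forall r s, w <> y * r + x * s.

(** Eliminating w from the two expressions gives a syzygy of y and x, which is a multiple of the
    trivial one, with a factor in B. *)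
Lemma syzygy (f g : B) (r s r' s' : T) : MA r -> MA r' ->
    v f * w = y * r + x * s -> v g * w = y * r' + x * s' ->
  exists c, v g * r - v f * r' = x * v c /\ v g * s - v f * s' = - (y * v c).
Proof.
move=> Mr Mr' fw gw.
have E : y * (v g * r - v f * r') = x * - (v g * s - v f * s').
  apply/subr0_eq; have -> : y * (v g * r - v f * r') - x * - (v g * s - v f * s') =
    v g * (y * r + x * s) - v f * (y * r' + x * s') by ring.
  by rewrite -fw -gw mulrCA subrr.
have Mrr : MA (v g * r - v f * r').
  by rewrite -mulNr -rmorphN; exact: MAL.
have [c cE] := xy_syz Mrr E; exists c; split=> //.
apply: (dom_mulI domT x0); apply: oppr_inj; rewrite -mulrN -E cE mulrN opprK.
by rewrite mulrCA.
Qed.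

(** Three regular elements would let the expression y r + x s of f w be corrected by a trivial
    syzygy until f divides both r and s; cancelling f puts w in the ideal of x and y. *)
Lemma regular_size_le2 s : (forall b, b \in s -> Q b) -> regular_sequence s ->
  (size s <= 2)%N.
Proof.
case: s => [|f [|g [|h s]]] //= sQ [reg _]; exfalso.
have f0 : f != 0.
  apply/eqP => f0; have := reg 0%N isT 1; rewrite /= f0 mul0r.
  move=> E; have /ideal_gen0/eqP := E (ex_intro _ (fun=> 0) (esym (big_ord0 _ _ _ _))).
  by rewrite oner_eq0.
have reg1 b : (exists c, g * b = c * f) -> exists c, b = c * f.
  by move/ideal_gen1 => gb; apply/ideal_gen1; apply: (reg 1%N isT b gb).
have reg2 b : (exists c d, h * b = c * f + d * g) -> exists c d, b = c * f + d * g.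
  by move/ideal_gen2 => hb; apply/ideal_gen2; apply: (reg 2%N isT b hb).
have [|rf [sf [Mrf Msf fw]]] := Qw (b := f); first by apply: sQ; rewrite !inE eqxx.
have [|rg [sg [Mrg Msg gw]]] := Qw (b := g).
  by apply: sQ; rewrite !inE eqxx orbT.
have [|rh [sh [Mrh Msh hw]]] := Qw (b := h).
  by apply: sQ; rewrite !inE eqxx !orbT.
have [c [cr cs]] := syzygy Mrf Mrg fw gw.
have [c' [cr' _]] := syzygy Mrf Mrh fw hw.
have [c'' [cr'' _]] := syzygy Mrg Mrh gw hw.
(* The three pairwise syzygies satisfy h (g r_f - f r_g) = g (h r_f - f r_h) - f (h r_g - g r_h). *)
have hc : h * c = (- c'') * f + c' * g.
  apply: v_inj; rewrite rmorphD !rmorphM rmorphN; apply: (dom_mulI domT x0).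
  have -> : x * (v h * v c) = v h * (x * v c) by ring.
  have -> : x * (- v c'' * v f + v c' * v g) = v g * (x * v c') - v f * (x * v c'').
    by ring.
  by rewrite -cr -cr' -cr''; ring.
(* The only use of the third element: h is regular modulo f and g. *)
have [|b1 [b2 cE]] := reg2 c; first by exists (- c''), c'.
(* With c = b1 f + b2 g the syzygy becomes g (r_f - x b2) = f (r_g + x b1), and similarly g (s_f + y
   b2) = f (s_g - y b1); the corrections cancel in y r_f + x s_f. *)
have [|||r' rE] := @pushed_divides MA f g (rf - x * v b2) (rg + x * v b1) MAP f0 reg1.
- have -> : rf - x * v b2 = v 1 * rf + v (- b2) * x by rewrite rmorph1 rmorphN; ring.
  exact: MAL.
- have -> : rg + x * v b1 = v 1 * rg + v b1 * x by rewrite rmorph1; ring.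
  exact: MAL.
- apply/subr0_eq; move/eqP: cr; rewrite -subr_eq0 cE rmorphD !rmorphM => /eqP <-.
  by ring.
have [|||s' sE] := @pushed_divides MB f g (sf + y * v b2) (sg - y * v b1) MBP f0 reg1.
- have -> : sf + y * v b2 = v 1 * sf + v b2 * y by rewrite rmorph1; ring.
  exact: MBL.
- have -> : sg - y * v b1 = v 1 * sg + v (- b1) * y by rewrite rmorph1 rmorphN; ring.
  exact: MBL.
- apply/subr0_eq; move/eqP: cs; rewrite -subr_eq0 cE rmorphD !rmorphM => /eqP <-.
  by ring.
apply: (@w_notin r' s'); have vf0 : v f != 0 by rewrite -(rmorph0 v) (inj_eq v_inj).
apply: (dom_mulI domT vf0); rewrite fw.
have -> : v f * (y * r' + x * s') = y * (v f * r') + x * (v f * s') by ring.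
by rewrite -rE -sE; ring.
Qed.

End DepthAtMostTwo.

Section TwistedPieces.
Variables (F : fieldType) (R : comAlgType F) (G : grading R).
Local Notation T := {mpoly R[2]}.
Implicit Types (t : T) (m : 'X_{1..2}).

(* The degree 0 part of T(k), for the grading where 'X_i has degree -1. *)
Definition twisted (k : nat) : set T := [set t | forall m, G (mdeg m + k)%N t@_m]%classic.

Lemma twistedM k l s t : twisted k s -> twisted l t -> twisted (k + l) (s * t).
Proof.
move=> ks lt m; rewrite mcoeffM; rewrite big_seq_cond; elim/big_rec: _ => [|[m1 m2] r].
  exact: piece0.
move=> /andP[_ /eqP mE]; apply: pieceD.
have -> : (mdeg m + (k + l) = (mdeg m1 + k) + (mdeg m2 + l))%N.
  by rewrite [in LHS]mE mdegD addnACA.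
exact: pieceM.
Qed.

Lemma twistedD k s t : twisted k s -> twisted k t -> twisted k (s + t).
Proof. by move=> ks kt m; rewrite mcoeffD; apply: pieceD; [exact: ks | exact: kt]. Qed.

Lemma twistedC k r : G k r -> twisted k r%:MP.
Proof.
move=> Gr m; rewrite mcoeffC; have [->|_] := eqVneq m 0%MM.
  by rewrite mdeg0 mulr1.
by rewrite mulr0; exact: piece0.
Qed.

Lemma twistedXn i n l t : twisted (n + l) t -> twisted l ('X_i ^+ n * t).
Proof.
move=> tT m; have [lt_m|le_m] := ltnP (m i) n.
  by rewrite mcoeffXnM //; exact: piece0.
rewrite -(submK (m := U_(i) *+ n) (m' := m)); last by rewrite mnmUn_le.
rewrite mcoeffXnMD mdegD mdegMn mdeg1 mul1n -addnA; exact: tT.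
Qed.

Lemma twisted_syz k a (x y : R) (r s : T) : G a x ->
    (forall r s, y * r = x * s -> exists c, r = x * c) ->
    twisted (k + a) r -> y%:MP * r = x%:MP * s -> exists2 c, twisted k c & r = x%:MP * c.
Proof.
move=> Gx syz rT rs.
(* The quotient is found coefficient by coefficient and cut to the right degree; the last clause
   makes the family finitely supported. *)
have coef m : exists c, [/\ r@_m = x * c, G (mdeg m + k)%N c & r@_m = 0 -> c = 0].
  have [r0|r0] := eqVneq r@_m 0.
    by exists 0; rewrite r0 mulr0; split=> //; exact: piece0.
  have [|c cE] := syz r@_m s@_m; first by rewrite -!mcoeffCM rs.
  exists (gproj G (mdeg m + k) c); split; last by move=> r0'; rewrite r0' eqxx in r0.
    rewrite -(gproj_mull _ _ Gx) -cE addnC -addnA gproj_id //; exact: rT.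
  exact: gproj_piece.
have /choice[f fP] := coef.
have [c cE] : exists c : T, forall m, c@_m = f m.
  apply: (@mpoly_of_coef _ _ _ (msize r)) => m le_m; have [_ _] := fP m.
  by apply; rewrite mcoeff_eq0_mdeg.
exists c; first by move=> m; rewrite cE; have [] := fP m.
by apply/mpolyP => m; rewrite mcoeffCM cE; have [] := fP m.
Qed.

(** The coefficient of t at a monomial other than 1 has positive degree, so the hypothesis applies
    to each; zero coefficients get the pair (0, 0), so that the answers are polynomials. *)
Lemma twisted_split (x y zeta : R) (a b : nat) t :
    (forall d r, (0 < d)%N -> G d r -> exists r' s',
       [/\ G (d + a)%N r', G (d + b)%N s' & r * zeta = y * r' + x * s']) ->
    twisted 0 t -> t@_0%MM = 0 -> exists r s,
  [/\ twisted a r, twisted b s & t * zeta%:MP = y%:MP * r + x%:MP * s].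
Proof.
move=> zP tT t0.
have coef m : exists rs : R * R, [/\ G (mdeg m + a)%N rs.1, G (mdeg m + b)%N rs.2,
    t@_m * zeta = y * rs.1 + x * rs.2 & t@_m = 0 -> rs = (0, 0)].
  have [tm0|tm0] := eqVneq t@_m 0.
    by exists (0, 0); rewrite tm0 mul0r !mulr0 addr0; split=> //; exact: piece0.
  have Gt := tT m; rewrite addn0 in Gt.
  have [|r [s [Gr Gs E]]] := zP _ _ _ Gt; last first.
    by exists (r, s); split=> // tm0'; rewrite tm0' eqxx in tm0.
  by rewrite lt0n mdeg_eq0; apply: contraNneq tm0 => ->; rewrite t0.
have /choice[f fP] := coef.
have f0 m : (msize t <= mdeg m)%N -> f m = (0, 0).
  by move=> le_m; have [_ _ _] := fP m; apply; rewrite mcoeff_eq0_mdeg.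
have [r rE] : exists r : T, forall m, r@_m = (f m).1.
  by apply: (@mpoly_of_coef _ _ _ (msize t)) => m /f0 ->.
have [s sE] : exists s : T, forall m, s@_m = (f m).2.
  by apply: (@mpoly_of_coef _ _ _ (msize t)) => m /f0 ->.
exists r, s; split=> [m|m|]; first by rewrite rE; have [] := fP m.
  by rewrite sE; have [] := fP m.
apply/mpolyP => m; rewrite mulrC mcoeffD !mcoeffCM rE sE mulrC.
by have [] := fP m.
Qed.

End TwistedPieces.

Section SegreDepth.
Variables (F : fieldType) (R : comAlgType F) (G : grading R).
Local Notation T := {mpoly R[2]}.
Variables (B : comNzRingType) (v : {rmorphism B -> T}).
Hypotheses (v_inj : injective v) (domT : forall s t : T, s * t = 0 -> s = 0 \/ t = 0).
Hypothesis v_im : forall t, twisted G 0 t <-> exists b, v b = t.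
Variables (x y zeta : R) (a b n : nat).
Hypotheses (Gx : G a x) (Gy : G b y) (x0 : x != 0).
Hypothesis xy_coprime : forall r s, y * r = x * s -> exists c, r = x * c.
Hypothesis zeta_in : forall d r, (0 < d)%N -> G d r -> exists r' s',
  [/\ G (d + (n + a))%N r', G (d + (n + b))%N s' & r * zeta = y * r' + x * s'].
Hypothesis zeta_notin : forall r s, zeta <> y * r + x * s.

Lemma twisted_submodule k : submodule_along v (twisted G k).
Proof.
move=> s t c d sT tT; have vT e : twisted G 0 (v e) by apply/v_im; exists e.
by apply: twistedD; rewrite -[k]add0n; apply: twistedM.
Qed.

Lemma twisted_pushed k : pushed_by v (twisted G k).
Proof.
exists ('X_0 ^+ k), ('X_1 ^+ k); split.
- rewrite mpolyXn; apply/eqP => /(congr1 (mcoeff (U_(0) *+ k))).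
  by rewrite mcoeffX eqxx mcoeff0 => /eqP; rewrite oner_eq0.
- by move=> r s; exact: mpoly_coprimeX.
- move=> r rT; have [|c <-] := (v_im ('X_0 ^+ k * r)).1; last by exists c.
  by apply: twistedXn; rewrite addn0.
move=> r rT; have [|c <-] := (v_im ('X_1 ^+ k * r)).1; last by exists c.
by apply: twistedXn; rewrite addn0.
Qed.

(** The factors of y and x in a multiple of [zeta] have twists n + a and n + b. Multiplying by u^n
    lowers them to a and b, the twists of x and y themselves, so u^n [zeta] can serve as w. *)
Lemma segre_regular_size_le2 s : (forall b, b \in s -> (v b)@_0%MM = 0) ->
  regular_sequence s -> (size s <= 2)%N.
Proof.
apply: (@regular_size_le2 B T v v_inj domT [set c : B | (v c)@_0%MM = 0]%classic
  (twisted G a) (twisted G b) x%:MP y%:MP ('X_0 ^+ n * zeta%:MP)).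
- exact: twisted_submodule.
- exact: twisted_submodule.
- exact: twistedC.
- exact: twistedC.
- exact: twisted_pushed.
- exact: twisted_pushed.
- by rewrite mpolyC_eq0.
- move=> r t rT rt; have [c cT ->] := @twisted_syz _ _ _ 0 a _ _ _ _ Gx xy_coprime rT rt.
  by have [d <-] := (v_im c).1 cT; exists d.
- move=> c /= c0; have vT : twisted G 0 (v c) by apply/v_im; exists c.
  have [r [t [rT tT E]]] := twisted_split zeta_in vT c0.
  exists ('X_0 ^+ n * r), ('X_0 ^+ n * t); split; [exact: twistedXn | exact: twistedXn |].
  by rewrite mulrCA E; ring.
move=> r t /(congr1 (mcoeff (U_(0) *+ n))); rewrite mcoeffD !mcoeffCM.
by rewrite -[X in _@_X]add0m mcoeffXnMD mcoeffC eqxx mulr1 => /zeta_notin.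
Qed.

End SegreDepth.

Lemma graded_combination (F : fieldType) (R : comAlgType F) (G : grading R)
    (x y r s t : R) a b k l e :
    G a x -> G b y -> G e t -> e = (b + k)%N -> e = (a + l)%N -> t = y * r + x * s ->
  t = y * gproj G k r + x * gproj G l s.
Proof.
move=> Gx Gy Gt ek el E; rewrite -{1}(gproj_id Gt) E linearD {1}ek el.
by rewrite (gproj_mull _ _ Gx) (gproj_mull _ _ Gy).
Qed.

(** The term in z is absorbed by the equation: z w = x^2 + y^3 already lies in the ideal of x and
    y. *)
Lemma times_cofactor (R : comNzRingType) (x y z w c0 c1 c2 : R) :
    w * z = x ^+ 2 + y ^+ 3 ->
  (c0 * x + c1 * y + c2 * z) * w = y * (c1 * w + c2 * y ^+ 2) + x * (c0 * w + c2 * x).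
Proof.
move=> wz; have -> : (c0 * x + c1 * y + c2 * z) * w =
  (c0 * x + c1 * y) * w + c2 * (w * z) by ring.
rewrite wz; ring.
Qed.

Section SegreNotCohenMacaulay.
Variables (F : fieldType) (p : nat).
Hypotheses (charFp : p \in [pchar F]) (p_gt2 : (2 < p)%N).
Local Notation A := {mpoly F[2]}.
Local Notation R := (hyp_ring F p).
Local Notation hpi := (hyp_pi F p).
Local Notation G := (hyp_grading F p).
Local Notation B := (hyp_segre F p).
Local Notation GB := (hyp_segre_grading F p).
Local Notation x := (hpi 'X_0).
Local Notation y := (hpi 'X_1).
Local Notation z := (hpi 'X_2).

Lemma segre_irrelevantE (b : B) : irrelevant_ideal GB b <-> (segre_vl b)@_0%MM = 0.
Proof.
have [n bE] := gproj_dec GB b.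
have b0 : (segre_vl b)@_0%MM = (segre_vl (gproj GB 0 b))@_0%MM.
  have rest : (segre_vl (b - gproj GB 0 b))@_0%MM = 0.
    case: n bE => [|n] bE.
      by rewrite bE big_ord0 linear0 subrr segre_vl0 mcoeff0.
    rewrite [X in X - _]bE big_ord_recl addrAC subrr add0r.
    rewrite (rmorph_sum (@segre_vl F p)) raddf_sum big1 // => d _.
    have /segre_gradingE dP := gproj_piece GB (lift ord0 d) b.
    by apply: dP; rewrite mdeg0.
  by apply/subr0_eq; rewrite -mcoeffB -segre_vlB.
rewrite irrelevantE b0; split=> [->|E]; first by rewrite segre_vl0 mcoeff0.
apply: segre_vl_inj; rewrite segre_vl0; apply/mpolyP => m; rewrite mcoeff0.
have [->//|m0] := eqVneq m 0%MM.
have /segre_gradingE bP := gproj_piece GB 0 b.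
by apply: bP; rewrite mdeg_eq0.
Qed.

(** An element of positive degree is a combination of x, y, z. Projecting the factors to the
    expected degrees keeps the identity, since d + 6 (p - 1) = 2p + (d + p - 6 + 3p) = 3p + (d + p -
    6 + 2p). *)
Lemma hyp_zeta_in d r : (7 <= p)%N -> (0 < d)%N -> G d r -> exists r' s',
  [/\ G (d + (p - 6 + 3 * p))%N r', G (d + (p - 6 + 2 * p))%N s'
    & r * z ^+ p.-1 = y * r' + x * s'].
Proof.
move=> p7 d0 Gr.
have : irrelevant_ideal G r by exact: irrelevant_homog d0 Gr.
rewrite -(hyp_irrelevant charFp p_gt2) => -[c rE].
have zE : z ^+ p.-1 * z = x ^+ 2 + y ^+ 3.
  rewrite -exprSr prednK ?p_gt0 // hyp_zp (hyp_xn F p) (hyp_yn F p) -rmorphD.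
  by [].
have rE' : r = c 0%N * x + c 1%N * y + c 2%N * z.
  by rewrite rE !big_ord_recl big_ord0 /= addr0 addrA.
have := times_cofactor (c 0%N) (c 1%N) (c 2%N) zE; rewrite -rE'.
set s1 := _ + c 2%N * x; set r1 := _ + c 2%N * y ^+ 2 => E.
have Gx := hyp_piece_x charFp p_gt2 1; have Gy := hyp_piece_y charFp p_gt2 1.
have Gz := hyp_piece_z charFp p_gt2 p.-1.
exists (gproj G (d + (p - 6 + 3 * p)) r1), (gproj G (d + (p - 6 + 2 * p)) s1).
split; [exact: gproj_piece | exact: gproj_piece |].
apply: (graded_combination Gx Gy (pieceM Gr Gz) _ _ E); lia.
Qed.

Lemma segre_regular_le2 (s : seq B) : (7 <= p)%N ->
    (forall b, b \in s -> irrelevant_ideal GB b) ->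
  regular_sequence s -> (size s <= 2)%N.
Proof.
move=> p7 sQ; have [x0 _ _] := hyp_xyz_neq0 charFp p_gt2.
apply: (@segre_regular_size_le2 F R G B (@segre_vl F p) (@segre_vl_inj F p)
  (T_domain charFp p_gt2) _ x y (z ^+ p.-1) (3 * p) (2 * p) (p - 6)).
- move=> t; split=> [tT|[b <-] m]; last by rewrite addn0; exact: segre_valP.
  by apply: segre_ex => m; have := tT m; rewrite addn0.
- by have := hyp_piece_x charFp p_gt2 1; rewrite muln1 expr1.
- by have := hyp_piece_y charFp p_gt2 1; rewrite muln1 expr1.
- exact: x0.
- move=> r t; have := @hyp_xy_coprime F p charFp p_gt2 1 r t; rewrite !expr1; exact.
- by move=> d r; exact: hyp_zeta_in.
- move=> r t E; apply: (@hyp_zpn_notin F p charFp p_gt2 0 t r).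
  by rewrite !expr0 !mul1r !expr1 E addrC.
by move=> b /sQ/segre_irrelevantE.
Qed.

End SegreNotCohenMacaulay.

(** * A chain of four primes in the Segre product *)

Lemma map_mpolyZXn (K L : comNzRingType) (f : {rmorphism K -> L}) n c (i : 'I_n) d :
  map_mpoly f (c *: 'X_i ^+ d) = f c *: 'X_i ^+ d.
Proof.
apply/mpolyP => m; rewrite mcoeff_map_mpoly !mcoeffZ !mpolyXn !mcoeffX.
by case: eqP => _; rewrite ?mulr1 ?mulr0 ?raddf0.
Qed.

Lemma mpolyZXn_neq0 (K : comNzRingType) n (c : K) (i : 'I_n) d :
  c != 0 -> c *: 'X_i ^+ d != 0 :> {mpoly K[n]}.
Proof.
move=> c0; apply/eqP => /(congr1 (mcoeff (U_(i) *+ d)%MM)).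
by rewrite mcoeffZ mpolyXn mcoeffX eqxx mulr1 mcoeff0 => /eqP; apply/negP.
Qed.

Lemma mcoeff0_v0 (K : comNzRingType) (f : {mpoly K[2]}) :
  (f \mPo [tuple 'X_0; 0] : {mpoly K[2]})@_0%MM = f@_0%MM.
Proof.
apply: (mpoly_add_ext (f := fun f : {mpoly K[2]} =>
  (f \mPo [tuple 'X_0; 0] : {mpoly K[2]})@_0%MM) (g := fun f => f@_0%MM)) => [g h|g h|c m].
- by rewrite rmorphD mcoeffD.
- exact: mcoeffD.
rewrite linearZ !mcoeffZ /=; congr (_ * _).
rewrite !mcoeffX comp_mpolyX !big_ord_recl big_ord0 mulr1 /=.
have [->|m0] := eqVneq m 0%MM; first by rewrite !mnm0E !expr0 mulr1 mcoeff1 eqxx.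
have [m1|m1] := posnP (m (lift ord0 ord0)); last by rewrite expr0n (gtn_eqF m1) mulr0 mcoeff0.
rewrite m1 expr0 mulr1 mpolyXn mcoeffX; case: eqP => // /mnmP/(_ 0%R).
rewrite mulmnE mnm1E mnm0E mul1n => m0'; case/eqP: m0; apply/mnmP => i; rewrite mnm0E.
case: i => [[|[|//]] lt_i]; [move: m0' | move: m1];
  by congr (m _ = _); apply: val_inj.
Qed.

Section SegreChain.
Variables (F : fieldType) (R : comAlgType F) (G : grading R).
Variables (B : comNzRingType) (v : {rmorphism B -> {mpoly R[2]}}).
Hypothesis v_im : forall t, twisted G 0 t -> exists b, v b = t.
Hypothesis v_piece : forall b, G 0 (v b)@_0%MM.
Variables (A A' : idomainType) (j : {rmorphism R -> A}) (g : {rmorphism A -> A'}).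
Variables (x y : R) (a b : nat).
Hypotheses (a_gt0 : (0 < a)%N) (Gx : G a x) (Gy : G b y).
Hypotheses (j_inj : injective j) (gx : g (j x) != 0) (gy : g (j y) = 0) (y0 : y != 0).
Hypothesis g0 : forall r, G 0 r -> g (j r) = 0 -> j r = 0.

Let f0 : {rmorphism B -> {mpoly A[2]}} := map_mpoly j \o v.
Let f1 : {rmorphism B -> {mpoly A[2]}} := comp_mpoly [tuple 'X_0; 0] \o f0.
Let f2 : {rmorphism B -> {mpoly A'[2]}} := map_mpoly g \o f1.
Let f3 : {rmorphism B -> A} := mcoeff 0%MM \o f0.

Lemma segre_monomial d (r : R) (i : 'I_2) : G d r ->
  exists c : B, f0 c = j r *: 'X_i ^+ d.
Proof.
move=> Gr; have [|c cE] := v_im (t := r *: 'X_i ^+ d).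
  move=> m; rewrite mcoeffZ mpolyXn mcoeffX addn0; have [<-|_] := eqVneq _ m.
    by rewrite mdegMn mdeg1 mul1n mulr1.
  by rewrite mulr0; exact: (piece0 G).
by exists c; rewrite /f0 /= cE map_mpolyZXn.
Qed.

Lemma segre_coef0 c : f3 c = 0 <-> (v c)@_0%MM = 0.
Proof.
rewrite /f3 /= mcoeff_map_mpoly; split=> [c0|->]; last exact: rmorph0.
by apply: j_inj; rewrite c0 rmorph0.
Qed.

(** The primes are the kernels of successive specializations: the embedding, then v = 0, then Y = 0
    on the coefficients, then the constant term. *)
Lemma segre_chain : exists P : nat -> set B, prime_chain 3 P /\
  forall c, P 3 c -> (v c)@_0%MM = 0.
Proof.
pose P (i : nat) : set B :=
  if i is 0%N then [set c | f0 c = 0]%classic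
  else if i is 1%N then [set c | f1 c = 0]%classic
  else if i is 2%N then [set c | f2 c = 0]%classic
  else [set c | f3 c = 0]%classic.
have jx : j x != 0 by apply: contraNneq gx => ->; rewrite rmorph0.
have jy : j y != 0 by rewrite -(rmorph0 j) (inj_eq j_inj).
have evX c (i : 'I_2) d : (c *: 'X_i ^+ d : {mpoly A[2]}) \mPo [tuple 'X_0; 0] =
    c *: (tnth [tuple 'X_0; 0] i) ^+ d :> {mpoly A[2]}.
  by rewrite linearZ rmorphXn /= comp_mpolyXU -tnth_nth.
(* Witnesses of strictness, made homogeneous by powers of u and v: x v^a vanishes at v = 0, y u^b
   vanishes only once Y = 0, and x u^a survives until the constant term is taken. *)
have [bx bxE] := segre_monomial 0 Gx.
have [by_ byE] := segre_monomial 0 Gy.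
have [bz bzE] := segre_monomial 1 Gx.
have tE : tnth [tuple 'X_0; 0] (0 : 'I_2) = 'X_0 :> {mpoly A[2]} by rewrite (tnth_nth 0).
have tE1 : tnth [tuple 'X_0; 0] (1 : 'I_2) = 0 :> {mpoly A[2]} by rewrite (tnth_nth 0).
have f1E c : f1 c = f0 c \mPo [tuple 'X_0; 0] := erefl.
have f2E c : f2 c = map_mpoly g (f1 c) := erefl.
exists P; split; last by move=> c /segre_coef0.
split=> [[|[|[|i]]] _ /=|[|[|[|//]]] _].
- exact: (kernel_prime f0).
- exact: (kernel_prime f1).
- exact: (kernel_prime f2).
- exact: (kernel_prime f3).
- split=> [c c0|/(_ bz)]; first by change (f1 c = 0); rewrite f1E c0 rmorph0.
  change ((f1 bz = 0 -> f0 bz = 0) -> False).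
  rewrite f1E bzE evX tE1 expr0n (gtn_eqF a_gt0) scaler0 => /(_ erefl)/eqP.
  by rewrite (negbTE (mpolyZXn_neq0 _ _ jx)).
- split=> [c c0|/(_ by_)]; first by change (f2 c = 0); rewrite f2E c0 rmorph0.
  change ((f2 by_ = 0 -> f1 by_ = 0) -> False).
  rewrite f2E !f1E byE evX tE map_mpolyZXn gy scale0r => /(_ erefl)/eqP.
  by rewrite (negbTE (mpolyZXn_neq0 _ _ jy)).
(* The constant coefficient has degree 0 in R, where setting Y = 0 loses nothing. *)
split=> [c c0|/(_ bx)].
  have := congr1 (mcoeff 0%MM) (c0 : f2 c = 0).
  rewrite f2E f1E mcoeff_map_mpoly mcoeff0_v0 mcoeff_map_mpoly mcoeff0.
  by move=> /(g0 (v_piece c)) E; change (f3 c = 0); rewrite /f3 /= mcoeff_map_mpoly.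
change ((f3 bx = 0 -> f2 bx = 0) -> False).
have -> : f3 bx = (f0 bx)@_0%MM by [].
rewrite f2E f1E bxE evX tE map_mpolyZXn mcoeffZ mpolyXn mcoeffX.
case: eqP => [/mnmP/(_ 0)|_].
  by rewrite mulmnE mnm1E mnm0E /= mul1n => a0; have := a_gt0; rewrite a0.
rewrite mulr0 => /(_ erefl)/eqP.
by rewrite (negbTE (mpolyZXn_neq0 _ _ gx)).
Qed.

End SegreChain.

Lemma segre_not_CM (F : fieldType) (p : nat) (charFp : p \in [pchar F]) :
  (7 <= p)%N -> ~ cohen_macaulay (hyp_segre F p).
Proof.
move=> p7 CM; have p_gt2 : (2 < p)%N by apply: leq_trans p7.
have p0 := p_gt0 p_gt2; have conG := segre_connected charFp p_gt2.
have [d [[_ dmax] [[s [sd sQ sreg]] _]]] := CM _ (irrelevant_maximal conG).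
have Xp0 i : ('X_i ^+ p : {mpoly F[2]}) != 0 by rewrite expf_eq0 p0 mpolyX_neq0.
have [||||||||||P [Pch Psub]] := @segre_chain F (hyp_ring F p) (hyp_grading F p)
  (hyp_segre F p) (@segre_vl F p) _ _ {mpoly F[2]} {mpoly F[2]} (hyp_emb charFp)
  (@eval_y0 F) (hyp_pi F p 'X_0) (hyp_pi F p 'X_1) (3 * p) (2 * p).
- move=> t tT; apply: segre_ex => m; have := tT m; rewrite addn0; exact.
- by move=> b; have := segre_valP b 0%MM; rewrite mdeg0.
- by rewrite muln_gt0.
- by have := hyp_piece_x charFp p_gt2 1; rewrite muln1 expr1.
- by have := hyp_piece_y charFp p_gt2 1; rewrite muln1 expr1.
- exact: (hyp_emb_inj (charFp := charFp) p_gt2).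
- change (eval_y0 (hyp_emb charFp (hyp_pi F p 'X_0)) != 0).
  by rewrite hyp_emb_x rmorphXn /= eval_y0_x.
- have jy0 : eval_y0 (hyp_emb charFp (hyp_pi F p 'X_1)) = 0.
    by rewrite hyp_emb_y rmorphXn /= eval_y0_y expr0n gtn_eqF.
  exact jy0.
- have [_ y0 _] := hyp_xyz_neq0 charFp p_gt2; exact y0.
- have jr0 r : hyp_grading F p 0 r -> eval_y0 (hyp_emb charFp r) = 0 -> hyp_emb charFp r = 0.
    move=> Gr; have [c ->] := hyp_connected charFp p_gt2 Gr.
    by rewrite hyp_emb_alg /eval_y0 comp_mpolyC.
  exact jr0.
have le3 : (3 <= d)%N.
  by apply: (dmax 3%N P Pch) => b Pb; apply/segre_irrelevantE/Psub.
by have := segre_regular_le2 charFp p_gt2 p7 sQ sreg; rewrite sd leqNgt le3.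
Qed.

Theorem mainTheorem4 (F : fieldType) (p : nat)
    (charFp : p \in [pchar F]) (perfF : perfect_field p F) (p_ge7 : (7 <= p)%N) :
  let R := hyp_ring F p in
  let x : R := hyp_pi F p 'X_0 in
  let y : R := hyp_pi F p 'X_1 in
  let z : R := hyp_pi F p 'X_2 in
  [/\ (* F[x, y] embeds in R, and R in F[x, y]^{1/p} = F[x^{1/p}, y^{1/p}];
         the variables of the target of j are x^{1/p} and y^{1/p} *)
      exists (i : {lrmorphism {mpoly F[2]} -> R})
             (j : {lrmorphism R -> {mpoly F[2]}}),
        [/\ injective i, i 'X_0 = x & i 'X_1 = y] /\
        [/\ injective j,
            j x = 'X_0 ^+ p,
            j y = 'X_1 ^+ p,
            j z = 'X_0 ^+ 2 + 'X_1 ^+ 3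
          & is_root_ring p (fun a => j (i a))],
      FFRT (hyp_grading F p) p,
      FFRT (hyp_segre_grading F p) p,
      is_a_invariant (hyp_grading F p) (p%:Z - 6) /\ 0 < p%:Z - 6
    & ~ cohen_macaulay (hyp_segre F p)].
Proof.
have p_gt2 : (2 < p)%N by apply: leq_trans p_ge7.
split.
- exists (@hyp_incl F p), (hyp_emb charFp); split; first split.
  + exact: hyp_incl_inj charFp p_gt2.
  + exact: hyp_incl0.
  + exact: hyp_incl1.
  split.
  + exact: (hyp_emb_inj (charFp := charFp) p_gt2).
  + exact: hyp_emb_x.
  + exact: hyp_emb_y.
  + exact: hyp_emb_z.
  exact: hyp_root_ring.
- exact: hyp_FFRT.
- exact: segre_FFRT.
- split; first exact: hyp_a_invariant.
  by rewrite subr_gt0 ltz_nat.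
exact: segre_not_CM.
Qed.
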